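(* Let $G$ be a countable exact discrete group acting on a compact space $X$ by homeomorphisms, $Y$ a $G$-invariant open dense subset of $X$ and $\partial Y=X\setminus Y$. For any $T\in C(X)\rtimes_r G$, the following are equivalent: (1) $T$ is invertible modulo $C_0(Y)\rtimes_r G$. (2) $\sigma(T)$ is invertible in $C_{\mathrm{WOT}}(\partial Y,C^*_u(G))^G$. (3) For each $\omega\in\partial Y$ the limit operator $\sigma_\omega(T)$ is invertible, and $\sup_{\omega\in\partial Y}\|\sigma_\omega(T)^{-1}\|<\infty$. Furthermore, if the action of $G$ on $X$ is amenable, then conditions (1), (2) and (3) are also equivalent to: (4) For each $\omega\in\partial Y$ the limit operator $\sigma_\omega(T)$ is invertible.
   Context: Compact spaces are Hausdorff. $C(X)\rtimes_rG$ is the reduced crossed product, the completion of the algebra $C_c(G,C(X))$ of finite sums $\sum_\gamma f_\gamma\gamma$ with twisted convolution; $C_0(Y)\rtimes_rG$ is an ideal in it, and ''invertible modulo'' it means that the image in the quotient is invertible. Uniform Roe algebra: $C^*_u(G)=C^*_u(|G|)\subseteq\mathfrak{B}(\ell^2(G))$ is the norm closure of the $*$-algebra generated by the left translations $L_\gamma:\delta_\alpha\mapsto\delta_{\gamma\alpha}$ and the diagonal operators $\ell^\infty(G)$. For $\omega\in\partial Y$ let $M_\omega:C(X)\to\mathfrak{B}(\ell^2(G))$, $M_\omega(f)\delta_\gamma=f(\gamma\omega)\delta_\gamma$, and $\rho(\gamma')\delta_\gamma=\delta_{\gamma'\gamma}$. The map $\sum f_\gamma\gamma\mapsto\sum M_\omega(f_\gamma)\rho(\gamma)$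 extends to a representation $M_\omega\times\rho:C(X)\rtimes_rG\to C^*_u(G)$, and the limit operator is $\sigma_\omega(T)=(M_\omega\times\rho)(T)$. $C_{\mathrm{WOT}}(\partial Y,C^*_u(G))^G$ is the set of functions $F:\partial Y\to C^*_u(G)$, continuous for the weak operator topology, with $F(\gamma\omega)=R_\gamma^*F(\omega)R_\gamma$ for all $\gamma\in G$, $\omega\in\partial Y$, where $R_\gamma:\delta_\alpha\mapsto\delta_{\alpha\gamma}$; operations are pointwise and an element is invertible if its pointwise inverse exists and belongs to the set. Symbol morphism. The transformation groupoid $X\rtimes G=X\times G$ has $r(x,\gamma)=x$, $s(x,\gamma)=\gamma^{-1}x$, $(x,\gamma)(\gamma^{-1}x,\gamma')=(x,\gamma\gamma')$. Its source fibre at $\omega$ is $(X\rtimes G)_\omega=\{(\gamma\omega,\gamma):\gamma\in G\}$; $V_\omega:\ell^2((X\rtimes G)_\omega)\to\ell^2(G)$ is the unitary induced by $(\gamma\omega,\gamma)\mapsto\gamma$. The regular representation at $\omega$ of the reduced groupoid $C^*$-algebra $C^*_r(X\rtimes G)$ is determined by $(\lambda_\omega(f)\xi)(\eta)=\sum_{\alpha\in(X\rtimes G)_\omega}f(\eta\alpha^{-1})\xi(\alpha)$, $f\in C_c(X\rtimes G)$. Let $\Theta:C^*_r(X\rtimes G)\to C(X)\rtimes_rG$ be the $*$-isomorphism extending $F\mapsto\sum_\gamma f_\gamma\gamma$, $f_\gamma(x)=F(x,\gamma)$. Then $\sigma:C(X)\rtimes_rG\to C_{\mathrm{WOT}}(\partial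 Y,C^*_u(G))^G$ is defined by $\sigma(T)(\omega)=V_\omega\,\lambda_\omega(\Theta^{-1}(T))\,V_\omega^*$. The action of $G$ on $X$ is amenable if the groupoid $X\rtimes G$ is topologically amenable (equivalently, the action is topologically amenable in the usual sense). *)

(* Defs.v *)
From HB Require Import structures.
From mathcomp Require Import all_boot all_order all_algebra.
From mathcomp Require Import all_classical all_reals all_analysis.
From mathcomp Require Import complex.
From mathcomp Require summability.
From mathcomp Require Import ring lra.

(* MathComp-Analysis, over the complex numbers R[i] of a realType R.

   All C*-algebras are realised as norm-closed *-subalgebras of the bounded
   operators on some ell^2(I), I an arbitrary (possibly uncountable) index type;
   every Hilbert space is of this form.  Completions are therefore closures for
   the operator norm, and *-homomorphisms given on a dense *-subalgebra are
   extended by continuity (ext_lim). *)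

Set Implicit Arguments.
Unset Strict Implicit.
Unset Printing Implicit Defensive.

Import Order.TTheory GRing.Theory Num.Theory numFieldNormedType.Exports.

Local Open Scope classical_set_scope.
Local Open Scope complex_scope.
Local Open Scope ring_scope.

HB.instance Definition _ (R : realType) := NormedModule.copy R[i] R[i]^o.

Section Ell2.
Context {R : realType} {I : choiceType}.
Implicit Types (f g : I -> R[i]).

(* |z|^2, as an element of R *)
Definition sqmod (z : R[i]) : R := complex.Re z ^+ 2 + complex.Im z ^+ 2.

Definition sqsum f : \bar R := (\esum_(i in [set: I]) (sqmod (f i))%:E)%E.

Definition sq_summable : {pred I -> R[i]} := [pred f | `[< (sqsum f < +oo)%E >]].

Lemma sqmod_ge0 z : 0 <= sqmod z.
Proof. by rewrite addr_ge0// sqr_ge0. Qed.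

Lemma sqmodM (z w : R[i]) : sqmod (z * w) = sqmod z * sqmod w.
Proof. by case: z => a b; case: w => c d; rewrite /sqmod /=; ring. Qed.

Lemma sqmodD (t : R) (z w : R[i]) : 0 < t ->
  sqmod (z + w) <= (1 + t) * sqmod z + (1 + t^-1) * sqmod w.
Proof.
move=> t0; case: z => a b; case: w => c d; rewrite /sqmod /=.
have key (x y : R) : 2 * x * y <= t * x ^+ 2 + t^-1 * y ^+ 2.
  rewrite -subr_ge0.
  have -> : t * x ^+ 2 + t^-1 * y ^+ 2 - 2 * x * y = t^-1 * (t * x - y) ^+ 2.
    by field; rewrite gt_eqF.
  by rewrite mulr_ge0 ?sqr_ge0// invr_ge0 ltW.
have := key a c; have := key b d; nra.
Qed.

Lemma sqsum_ge0 f : (0 <= sqsum f)%E.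
Proof. by apply: esum_ge0 => i _; rewrite lee_fin sqmod_ge0. Qed.

Lemma sqsumZ (k : R) (h : I -> \bar R) : 0 <= k -> (forall i, 0 <= h i)%E ->
  (\esum_(i in [set: I]) (k%:E * h i) = k%:E * \esum_(i in [set: I]) h i)%E.
Proof.
move=> k0 h0; rewrite /esum -ereal_supZl//; last first.
  by apply/set0P; exists 0%E; exists set0; [exact: fsets_set0|rewrite fsbig_set0].
congr ereal_sup; rewrite eqEsubset; split => x /=.
- case=> A fA <-; exists (\sum_(i \in A) h i)%E; first by exists A.
  by rewrite ge0_mule_fsumr.
- case=> _ [A fA <-] <-; exists A => //.
  by rewrite ge0_mule_fsumr.
Qed.

Lemma sqsumD (t : R) f g : 0 < t ->
  (sqsum (f + g)%R <= (1 + t)%:E * sqsum f + (1 + t^-1)%:E * sqsum g)%E.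
Proof.
move=> t0; have t'0 : 0 < t^-1 by rewrite invr_gt0.
rewrite /sqsum -!sqsumZ; [|lra|by move=> i; rewrite lee_fin sqmod_ge0
  |lra|by move=> i; rewrite lee_fin sqmod_ge0].
rewrite -esumD; [|by move=> i _; rewrite -EFinM lee_fin mulr_ge0 ?sqmod_ge0//; lra..].
by apply: le_esum => i _; rewrite -!EFinM -EFinD lee_fin; apply: sqmodD.
Qed.

Lemma sqsumM (k : R[i]) f : sqsum (k *: f)%R = ((sqmod k)%:E * sqsum f)%E.
Proof.
rewrite /sqsum -sqsumZ ?sqmod_ge0//; last by move=> i; rewrite lee_fin sqmod_ge0.
by apply: eq_esum => i _; rewrite -EFinM -sqmodM.
Qed.

Lemma sq_summable_submod : submod_closed sq_summable.
Proof.
split.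
  apply/asboolP.
  rewrite /sqsum esum1 ?ltry// => i _.
  by rewrite /sqmod /= expr0n/= addr0.
move=> k f g /asboolP sf /asboolP sg; apply/asboolP.
apply: (le_lt_trans (sqsumD (k *: f) g ltr01)).
rewrite sqsumM; apply: lte_add_pinfty.
  apply: lte_mul_pinfty; rewrite ?lee_fin ?addr_ge0//.
  by apply: lte_mul_pinfty; rewrite ?lee_fin ?sqmod_ge0.
by apply: lte_mul_pinfty; rewrite ?lee_fin ?addr_ge0 ?invr_ge0.
Qed.

HB.instance Definition _ := GRing.isSubmodClosed.Build R[i] (I -> R[i])
  sq_summable sq_summable_submod.


Lemma sqmod_le_sqsum f i : ((sqmod (f i))%:E <= sqsum f)%E.
Proof.
apply: esum_ge; exists [set i]; first by split; [exact: finite_set1|].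
by rewrite fsbig_set1.
Qed.

Lemma sqmod_eq0 z : sqmod z = 0 -> z = 0.
Proof.
case: z => a b /eqP; rewrite /sqmod /= paddr_eq0 ?sqr_ge0// !sqrf_eq0.
by case/andP => /eqP-> /eqP->.
Qed.

End Ell2.

Section HilbertSpace.
Variables (R : realType) (I : choiceType).

Record ell2 := Ell2 {
  ell2_fun :> I -> R[i];
  ell2P : ell2_fun \in @sq_summable R I }.

HB.instance Definition _ := [isSub for ell2_fun].
HB.instance Definition _ := [Choice of ell2 by <:].
HB.instance Definition _ := [SubChoice_isSubLmodule of ell2 by <:].

Implicit Types x y : ell2.

Definition ell2_norm x : R := Num.sqrt (fine (sqsum x)).

Lemma sqsum_fin_num x : sqsum x \is a fin_num.
Proof.
rewrite ge0_fin_numE; first by have /asboolP := ell2P x.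
exact: sqsum_ge0.
Qed.

Lemma ell2_norm_ge0 x : 0 <= ell2_norm x. Proof. exact: sqrtr_ge0. Qed.

Lemma ell2_norm_sqr x : ((ell2_norm x ^+ 2)%:E = sqsum x)%E.
Proof. by rewrite sqr_sqrtr ?fineK ?fine_ge0 ?sqsum_ge0 ?sqsum_fin_num. Qed.

Lemma ell2_norm0_eq0 x : ell2_norm x = 0 -> x = 0.
Proof.
move=> x0; apply/val_inj/funext => i /=; apply: sqmod_eq0.
apply/eqP; rewrite eq_le sqmod_ge0 andbT -lee_fin.
by rewrite (le_trans (sqmod_le_sqsum x i))// -ell2_norm_sqr x0 expr0n.
Qed.

Lemma ell2_normZ (k : R[i]) x : ell2_norm (k *: x) = Num.sqrt (sqmod k) * ell2_norm x.
Proof.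
rewrite /ell2_norm -sqrtrM ?sqmod_ge0//; congr Num.sqrt.
have -> : sqsum (k *: x) = ((sqmod k)%:E * sqsum x)%E by rewrite -sqsumM.
by rewrite fineM// sqsum_fin_num.
Qed.

Lemma ell2_normD x y : ell2_norm (x + y) <= ell2_norm x + ell2_norm y.
Proof.
have [/ell2_norm0_eq0->|x0] := eqVneq (ell2_norm x) 0.
  by rewrite add0r lerDr ell2_norm_ge0.
have [/ell2_norm0_eq0->|y0] := eqVneq (ell2_norm y) 0.
  by rewrite addr0 lerDl ell2_norm_ge0.
have {}x0 : 0 < ell2_norm x by rewrite lt_def x0 ell2_norm_ge0.
have {}y0 : 0 < ell2_norm y by rewrite lt_def y0 ell2_norm_ge0.
rewrite -(@ler_pXn2r _ 2)// ?nnegrE ?addr_ge0 ?ell2_norm_ge0//.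
rewrite -lee_fin ell2_norm_sqr.
apply: (le_trans (sqsumD x y (divr_gt0 y0 x0))).
rewrite -!ell2_norm_sqr -!EFinM -EFinD lee_fin le_eqVlt; apply/orP; left.
by apply/eqP; field; rewrite !gt_eqF.
Qed.

Definition ell2_cnorm x : R[i] := (ell2_norm x)%:C.

Lemma ell2_cnormD x y : ell2_cnorm (x + y) <= ell2_cnorm x + ell2_cnorm y.
Proof. by rewrite -rmorphD /= lecR ell2_normD. Qed.

Lemma ell2_cnormZ (k : R[i]) x : ell2_cnorm (k *: x) = `|k| * ell2_cnorm x.
Proof. by rewrite normc_def -rmorphM /= /ell2_cnorm ell2_normZ. Qed.

Lemma ell2_cnorm0_eq0 x : ell2_cnorm x = 0 -> x = 0.
Proof. by case=> /ell2_norm0_eq0. Qed.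

HB.instance Definition _ := Lmodule_isNormed.Build R[i] ell2
  ell2_cnormD ell2_cnormZ ell2_cnorm0_eq0.

End HilbertSpace.

Section BoundedOperators.
Variables (R : realType) (V W : normedModType R[i]).
Implicit Types (f g : V -> W).

(* The library norm on a normedModType R[i] takes values in R[i]; rnorm is the
   same norm seen in R. *)
Definition rnorm (U : normedModType R[i]) (x : U) : R := complex.Re `|x|.

Lemma rnormE (U : normedModType R[i]) (x : U) : `|x| = (rnorm x)%:C.
Proof. by rewrite RRe_real ?normr_real. Qed.

Lemma rnorm_ge0 (U : normedModType R[i]) (x : U) : 0 <= rnorm x.
Proof. by rewrite -lecR -rnormE normr_ge0. Qed.

Definition bounded_op : {pred V -> W} := [pred f | `[<
  (forall (k : R[i]) (x y : V), f (k *: x + y) = k *: f x + f y) /\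
  (exists M : R, forall x, rnorm (f x) <= M * rnorm x) >]].

Lemma rnormD (U : normedModType R[i]) (x y : U) : rnorm (x + y) <= rnorm x + rnorm y.
Proof. by rewrite -lecR rmorphD /= -!rnormE ler_normD. Qed.

Lemma rnormZ (U : normedModType R[i]) (k : R[i]) (x : U) :
  rnorm (k *: x) = complex.Re `|k| * rnorm x.
Proof.
by apply: (@complexI R); rewrite rmorphM /= -!rnormE normrZ.
Qed.

Lemma rnorm0 (U : normedModType R[i]) : rnorm (0 : U) = 0.
Proof. by rewrite /rnorm normr0. Qed.

Lemma Re_norm_ge0 (k : R[i]) : 0 <= complex.Re `|k|.
Proof. by rewrite normc_def sqrtr_ge0. Qed.

Lemma bounded_op_submod : submod_closed bounded_op.
Proof.
split.
  apply/asboolP; split => [k x y|]; first by rewrite scaler0 addr0.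
  by exists 0 => x; rewrite mul0r rnorm0.
move=> a f g /asboolP[fl [M fM]] /asboolP[gl [N gN]]; apply/asboolP; split.
  move=> k x y; rewrite !fctE fl gl !scalerDr addrACA; congr (_ + _ + _).
  by rewrite !scalerA mulrC.
exists (complex.Re `|a| * M + N) => x.
rewrite !fctE (le_trans (rnormD _ _))// mulrDl lerD// rnormZ -mulrA.
by rewrite ler_wpM2l ?Re_norm_ge0.
Qed.

HB.instance Definition _ := GRing.isSubmodClosed.Build R[i] (V -> W)
  bounded_op bounded_op_submod.

Record bop := Bop {
  bop_fun :> V -> W;
  bopP : bop_fun \in bounded_op }.

HB.instance Definition _ := [isSub for bop_fun].
HB.instance Definition _ := [Choice of bop by <:].
HB.instance Definition _ := [SubChoice_isSubLmodule of bop by <:].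

Implicit Types S T : bop.

Lemma bop_linear T : linear T.
Proof. by have /asboolP[] := bopP T. Qed.

HB.instance Definition _ T := GRing.isLinear.Build R[i] V W _ T (bop_linear T).

Lemma bop_bounded T : exists M : R, forall x, rnorm (T x) <= M * rnorm x.
Proof. by have /asboolP[] := bopP T. Qed.

Definition op_norm T : R := sup [set rnorm (T x) | x in [set x | rnorm x <= 1]].

Lemma op_norm_has_sup T : has_sup [set rnorm (T x) | x in [set x | rnorm x <= 1]].
Proof.
split; first by exists (rnorm (T 0)), 0 => //=; rewrite rnorm0.
have [M TM] := bop_bounded T; exists `|M| => _ [x /= x1 <-].
rewrite (le_trans (TM x))// (le_trans (ler_norm _))// normrM.
by rewrite (ger0_norm (rnorm_ge0 _)) ler_piMr.
Qed.

Lemma op_norm_ge0 T : 0 <= op_norm T.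
Proof.
have := ub_le_sup (op_norm_has_sup T).2; apply.
by exists 0; rewrite /= ?rnorm0// linear0 rnorm0.
Qed.

Lemma op_norm_le T (M : R) : 0 <= M ->
  (forall x, rnorm (T x) <= M * rnorm x) -> op_norm T <= M.
Proof.
move=> M0 TM; apply: ge_sup; first exact: (op_norm_has_sup T).1.
by move=> _ [x /= x1 <-]; rewrite (le_trans (TM x))// ler_piMr.
Qed.

Lemma op_normP T x : rnorm (T x) <= op_norm T * rnorm x.
Proof.
have [x0|x0] := eqVneq (rnorm x) 0.
  have [M TM] := bop_bounded T.
  by rewrite x0 mulr0 (le_trans (TM x))// x0 mulr0.
have {}x0 : 0 < rnorm x by rewrite lt_def x0 rnorm_ge0.
have i0 : 0 <= (rnorm x)^-1 by rewrite invr_ge0 ltW.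
rewrite -ler_pdivrMr//.
apply: (ub_le_sup (op_norm_has_sup T).2); exists ((rnorm x)^-1%:C *: x) => /=.
  rewrite rnormZ normc_def /= expr0n addr0 sqrtr_sqr ger0_norm//.
  by rewrite mulVf// gt_eqF.
rewrite linearZ /= rnormZ normc_def /= expr0n addr0 sqrtr_sqr.
by rewrite ger0_norm// mulrC.
Qed.

Definition op_cnorm T : R[i] := (op_norm T)%:C.

Lemma op_cnormD S T : op_cnorm (S + T) <= op_cnorm S + op_cnorm T.
Proof.
rewrite -rmorphD /= lecR; apply: op_norm_le => [|x].
  by rewrite addr_ge0 ?op_norm_ge0.
by rewrite (le_trans (rnormD _ _))// mulrDl lerD ?op_normP.
Qed.

Lemma op_norm0_eq0 T : op_norm T = 0 -> T = 0.
Proof.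
move=> T0; apply/val_inj/funext => x /=.
apply/eqP; rewrite -normr_le0 rnormE -[leRHS]/(0%:C) lecR.
by have := op_normP T x; rewrite T0 mul0r.
Qed.

Lemma op_cnorm0_eq0 T : op_cnorm T = 0 -> T = 0.
Proof. by case=> /op_norm0_eq0. Qed.

Lemma op_normZ_le k T : op_norm (k *: T) <= complex.Re `|k| * op_norm T.
Proof.
apply: op_norm_le => [|x]; first by rewrite mulr_ge0 ?Re_norm_ge0 ?op_norm_ge0.
by rewrite /= fctE rnormZ -mulrA ler_wpM2l ?Re_norm_ge0 ?op_normP.
Qed.

Lemma op_cnormZ k T : op_cnorm (k *: T) = `|k| * op_cnorm T.
Proof.
have [->|k0] := eqVneq k 0.
  rewrite scale0r normr0 mul0r; congr (_%:C).
  by apply/eqP; rewrite eq_le op_norm_ge0 andbT op_norm_le// => x; rewrite /= rnorm0 mul0r.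
apply/eqP; rewrite eq_le; apply/andP; split.
  by rewrite -[`|k|]RRe_real ?normr_real// -rmorphM /= lecR op_normZ_le.
rewrite -ler_pdivlMl ?normr_gt0// -normfV.
rewrite -[`|k^-1|]RRe_real ?normr_real// -rmorphM /= lecR.
by rewrite -{1}[T](scalerK k0) op_normZ_le.
Qed.

HB.instance Definition _ := Lmodule_isNormed.Build R[i] bop
  op_cnormD op_cnormZ op_cnorm0_eq0.

End BoundedOperators.

Section Composition.
Context {R : realType} {U V W : normedModType R[i]}.

Lemma id_bop_subproof : (idfun : V -> V) \in @bounded_op R V V.
Proof. by apply/asboolP; split => //; exists 1 => x; rewrite mul1r. Qed.

Definition id_bop : bop V V := Bop id_bop_subproof.

Lemma comp_bop_subproof (S : bop V W) (T : bop U V) :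
  (S \o T : U -> W) \in @bounded_op R U W.
Proof.
apply/asboolP; split=> [k x y|]; first by rewrite /= !linearP.
exists (op_norm S * op_norm T) => x /=.
by rewrite (le_trans (op_normP S _))// -mulrA ler_wpM2l ?op_norm_ge0 ?op_normP.
Qed.

Definition comp_bop (S : bop V W) (T : bop U V) : bop U W :=
  Bop (comp_bop_subproof S T).

End Composition.

Notation "S *o T" := (comp_bop S T) (at level 40, left associativity) : ring_scope.

Section Inverse.
Context {R : realType} {V : normedModType R[i]}.
Implicit Types S T : bop V V.

Definition is_inverse T S := S *o T = id_bop /\ T *o S = id_bop.

Definition invertible T := exists S, is_inverse T S.

Definition inv_bop T : bop V V := get (is_inverse T).

End Inverse.

(* If phi is dominated by iota on D, then v |-> ext_lim D iota phi v is the
   extension by continuity of  iota a |-> phi a  (a in D)  to the closure of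
   iota @` D. *)
Definition ext_lim {E : Type} {V : topologicalType} {W : ptopologicalType}
    (D : set E) (iota : E -> V) (phi : E -> W) (v : V) : W :=
  lim (phi x @[x --> filter_from (nbhs v) (fun N => D `&` iota @^-1` N)]).

Section OperatorsOnEll2.
Context {R : realType}.
Implicit Types I J : choiceType.

(* f itself when it is square-summable (and 0 otherwise). *)
Definition mk_ell2 {I} (f : I -> R[i]) : ell2 R I := insubd 0 f.

(* The bounded operator acting on ell^2 by the formula f (see mk_bopE). *)
Definition mk_bop {I J} (f : (I -> R[i]) -> (J -> R[i])) :
    bop (ell2 R I) (ell2 R J) :=
  get [set T : bop (ell2 R I) (ell2 R J) |
    forall xi : ell2 R I, T xi = f xi :> (J -> R[i])].

Definition inner {I} (xi eta : ell2 R I) : R[i] :=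
  (* limit of the sums over finite subsets of I *)
  summability.sum (fun i => xi i * conjc (eta i)).

Definition is_adjoint {I J} (T : bop (ell2 R I) (ell2 R J))
    (S : bop (ell2 R J) (ell2 R I)) :=
  forall xi eta, inner (T xi) eta = inner xi (S eta).

Definition adj {I J} (T : bop (ell2 R I) (ell2 R J)) :
  bop (ell2 R J) (ell2 R I) := get (is_adjoint T).

End OperatorsOnEll2.

Section MkBop.
Context {R : realType} {I J : choiceType}.

Lemma mk_bopE (f : (I -> R[i]) -> (J -> R[i])) (M : R) :
  (forall (k : R[i]) (xi eta : ell2 R I),
     f (k *: (xi : I -> R[i]) + (eta : I -> R[i])) = k *: f xi + f eta) ->
  (forall xi : ell2 R I, (sqsum (f xi) <= M%:E * sqsum xi)%E) ->
  forall xi : ell2 R I, mk_bop f xi = f xi :> (J -> R[i]).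
Proof.
move=> flin fM.
have fP xi : f (ell2_fun xi) \in @sq_summable R J.
  apply/asboolP; apply: (le_lt_trans (fM xi)).
  by rewrite -ell2_norm_sqr -EFinM ltry.
pose T0 (xi : ell2 R I) : ell2 R J := Ell2 (fP xi).
have T0P : T0 \in @bounded_op R (ell2 R I) (ell2 R J).
  apply/asboolP; split; first by move=> k x y; apply/val_inj; exact: flin.
  exists (Num.sqrt `|M|) => xi.
  change (ell2_norm (T0 xi) <= Num.sqrt `|M| * ell2_norm xi).
  rewrite -(@ler_pXn2r _ 2)// ?nnegrE ?ell2_norm_ge0 ?mulr_ge0 ?sqrtr_ge0
    ?ell2_norm_ge0//.
  rewrite exprMn (sqr_sqrtr (normr_ge0 M)) -lee_fin ell2_norm_sqr EFinM ell2_norm_sqr.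
  apply: (le_trans (fM xi)); apply: lee_wpmul2r; first exact: sqsum_ge0.
  by rewrite lee_fin ler_norm.
suff : [set T : bop (ell2 R I) (ell2 R J) |
    forall xi : ell2 R I, T xi = f xi :> (J -> R[i])] (mk_bop f) by [].
by apply: (@getPex _ _); exists (Bop T0P).
Qed.

Lemma mk_bop_reindexE (p : J -> I) : injective p ->
  forall xi : ell2 R I,
    mk_bop (fun xi : I -> R[i] => xi \o p) xi = xi \o p :> (J -> R[i]).
Proof.
move=> pI; apply: (@mk_bopE _ 1) => [//|xi]; rewrite mul1e.
rewrite /sqsum.
have -> : (\esum_(j in [set: J]) (sqmod ((xi \o p) j))%:E =
  \esum_(i in p @` [set: J]) (sqmod (xi i))%:E)%E.
  by rewrite esum_image// => x y _ _; exact: pI.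
rewrite esum_mkcond; apply: le_esum => i _; case: ifP => // _.
by rewrite lee_fin sqmod_ge0.
Qed.

End MkBop.

Notation B2 R I := (bop (ell2 R I) (ell2 R I)).

Section CstarAlgebras.
Context {R : realType}.

Definition star_subalgebra {I : choiceType} (A : set (B2 R I)) :=
  [/\ A 0,
      forall (k : R[i]) S T, A S -> A T -> A (k *: S + T),
      forall S T, A S -> A T -> A (S *o T) &
      forall S, A S -> A (adj S)].

Definition Cstar_algebra {I : choiceType} (A : set (B2 R I)) :=
  star_subalgebra A /\ closed A.

Definition star_hom {I K : choiceType} (A : set (B2 R I))
    (phi : B2 R I -> B2 R K) :=
  [/\ forall (k : R[i]) S T, A S -> A T -> phi (k *: S + T) = k *: phi S + phi T,
      forall S T, A S -> A T -> phi (S *o T) = phi S *o phi T &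
      forall S, A S -> phi (adj S) = adj (phi S)].

(* A C*-algebra A with an action alpha of G by *-automorphisms; only the values
   of alpha g on A matter. *)
Definition GCstar_algebra {G : groupType} {I : choiceType} (A : set (B2 R I))
    (alpha : G -> B2 R I -> B2 R I) :=
  Cstar_algebra A /\
  [/\ forall g a, A a -> A (alpha g a),
      forall g, star_hom A (alpha g),
      forall a, A a -> alpha 1%g a = a &
      forall g h a, A a -> alpha (g * h)%g a = alpha g (alpha h a)].

(* The class of T in A / J has an inverse, represented by S in A. *)
Definition invertible_modulo {I : choiceType} (A J : set (B2 R I)) (T : B2 R I) :=
  exists S, [/\ A S, J (T *o S - id_bop) & J (S *o T - id_bop)].

End CstarAlgebras.

Section ReducedCrossedProduct.
Context {R : realType} {G : groupType} {I : choiceType}.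

(* C_c(G, A): the finite sums  \sum_g a_g g  with coefficients in A. *)
Definition Cc {E : zmodType} (A : set E) : set (G -> E) :=
  [set a | (forall g, A (a g)) /\ finite_set [set g | a g <> 0]].

Definition shift_op (g : G) : B2 R (I * G)%type :=
  mk_bop (fun xi p => xi (p.1, (g^-1 * p.2)%g)).

Section Coefficients.
Context {E : zmodType} (pi : E -> B2 R I) (alpha : G -> E -> E).

(* The regular covariant representation on ell^2(I * G) = ell^2(I) (x) ell^2(G)
   induced by a representation pi of the coefficients:
     (coef_op a xi)(., h) = pi (alpha_{h^-1} a) (xi (., h)),
     (shift_op g xi)(., h) = xi (., g^-1 h). *)
Definition coef_op (a : E) : B2 R (I * G)%type :=
  mk_bop (fun xi p =>
    pi (alpha (p.2)^-1%g a) (mk_ell2 (fun i => xi (i, p.2))) p.1).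

Definition regular (a : G -> E) : B2 R (I * G)%type :=
  \sum_(g \in [set: G]) (coef_op (a g) *o shift_op g).

(* The reduced crossed product, when pi is faithful on A; the reduced norm does
   not depend on the faithful representation. *)
Definition crossed (A : set E) : set (B2 R (I * G)%type) :=
  closure (regular @` Cc A).

End Coefficients.
End ReducedCrossedProduct.

Definition crossed_hom {R : realType} {G : groupType} {I K : choiceType}
    (A : set (B2 R I)) (alpha : G -> B2 R I -> B2 R I)
    (beta : G -> B2 R K -> B2 R K) (phi : B2 R I -> B2 R K) :
    B2 R (I * G)%type -> B2 R (K * G)%type :=
  ext_lim (Cc A) (regular id alpha) (fun a => regular id beta (phi \o a)).

(* Exactness in the sense of Kirchberg and Wassermann: the reduced crossed
   product functor maps every short exact sequence 0 -> J -> A -> D -> 0 of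
   G-C*-algebras to an exact sequence.  At J-crossed-G the sequence is an
   inclusion, hence only the two other places are to be stated. *)
Definition exact_group (R : realType) (G : groupType) :=
  forall (I K : choiceType)
    (A : set (B2 R I)) (alpha : G -> B2 R I -> B2 R I)
    (D : set (B2 R K)) (beta : G -> B2 R K -> B2 R K)
    (phi : B2 R I -> B2 R K),
  GCstar_algebra A alpha -> GCstar_algebra D beta ->
  star_hom A phi -> (forall g a, A a -> phi (alpha g a) = beta g (phi a)) ->
  phi @` A = D ->
  let J := A `&` [set a | phi a = 0] in
  crossed id alpha A `&` [set T | crossed_hom A alpha beta phi T = 0]
    = crossed id alpha J /\
  crossed_hom A alpha beta phi @` crossed id alpha A = crossed id beta D.

Section UniformRoe.
Context {R : realType} {G : groupType}.

Definition Ltrans (g : G) : B2 R G := mk_bop (fun xi h => xi (g^-1 * h)%g).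

Definition Rtrans (g : G) : B2 R G := mk_bop (fun xi h => xi (h * g^-1)%g).

Definition diag_op {I : choiceType} (f : I -> R[i]) : B2 R I :=
  mk_bop (fun xi i => f i * xi i).

Definition linfty (I : choiceType) : set (I -> R[i]) :=
  [set f | exists M : R, forall i, `|f i| <= M%:C].

(* Ltrans g maps delta_a to delta_{ga}, Rtrans g maps delta_a to delta_{ag}. *)
Definition uniform_roe : set (B2 R G) :=
  closure (smallest star_subalgebra (range Ltrans `|` diag_op @` @linfty G)).

End UniformRoe.

Record homeo_action (G : groupType) (X : topologicalType) := HomeoAction {
  act_fun :> G -> X -> X;
  act1 : forall x, act_fun 1%g x = x;
  actM : forall g h x, act_fun (g * h)%g x = act_fun g (act_fun h x);
  act_continuous : forall g, continuous (act_fun g) }.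

Section TransformationGroupoid.
Context {R : realType} {G : groupType} {X : topologicalType}.
Variable act : homeo_action G X.

Definition CX : set (X -> R[i]) := [set f | continuous f].

(* C_0(Y), for Y open in the compact Hausdorff space X, as an ideal of C(X). *)
Definition C0 (Y : set X) : set (X -> R[i]) :=
  [set f | continuous f /\ forall x, ~ Y x -> f x = 0].

Definition translate (g : G) (f : X -> R[i]) : X -> R[i] :=
  fun x => f (act g^-1%g x).

Definition CX_regular : (G -> X -> R[i]) -> B2 R (X * G)%type :=
  regular (@diag_op R X) translate.

Definition CX_crossed : set (B2 R (X * G)%type) :=
  crossed (@diag_op R X) translate CX.

Definition C0_crossed (Y : set X) : set (B2 R (X * G)%type) :=
  crossed (@diag_op R X) translate (C0 Y).

Definition Mult (w : X) (f : X -> R[i]) : B2 R G :=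
  diag_op (fun g => f (act g w)).

(* sigma_w: the extension of  \sum f_g g |-> \sum M_w(f_g) rho(g) *)
Definition limit_op (w : X) : B2 R (X * G)%type -> B2 R G :=
  ext_lim (Cc CX) CX_regular
    (fun a => \sum_(g \in [set: G]) (Mult w (a g) *o Ltrans g)).

(* The transformation groupoid X * G; gmul e e' is the product when
   gsrc e = grng e'. *)
Definition gsrc (e : X * G) : X := act e.2^-1%g e.1.
Definition grng (e : X * G) : X := e.1.
Definition gmul (e e' : X * G) : X * G := (e.1, (e.2 * e'.2)%g).
Definition ginv (e : X * G) : X * G := (act e.2^-1%g e.1, e.2^-1%g).

(* C_c(X * G), G being discrete, with values in K whose zero is z. *)
Definition gpd_Cc (K : topologicalType) (z : K) : set (X * G -> K) :=
  [set f | continuous (f : X * discrete_topology G -> K) /\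
    compact (closure ([set e | f e <> z] : set (X * discrete_topology G)))].

(* The direct sum over x in X of the regular representations lambda_x:
   ell^2(X * G) is the orthogonal sum of the ell^2 of the source fibres, so that
   the operator norm of gpd_regular f is the reduced norm of f. *)
Definition gpd_regular (f : X * G -> R[i]) : B2 R (X * G)%type :=
  mk_bop (fun xi e =>
    \sum_(a \in [set a | gsrc a = gsrc e]) f (gmul e (ginv a)) * xi a).

Definition gpd_Cstar : set (B2 R (X * G)%type) :=
  closure (gpd_regular @` gpd_Cc 0).

Definition fibre (w : X) : set (X * G) := [set e | gsrc e = w].

(* lambda_w on C_c(X * G) *)
Definition regular_at0 (w : X) (f : X * G -> R[i]) : B2 R (fibre w) :=
  mk_bop (fun xi (e : fibre w) =>
    \sum_(a \in [set: fibre w]) f (gmul (val e) (ginv (val a))) * xi a).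

(* lambda_w on the reduced C*-algebra of the groupoid *)
Definition regular_at (w : X) : B2 R (X * G)%type -> B2 R (fibre w) :=
  ext_lim (gpd_Cc 0) gpd_regular (regular_at0 w).

Definition Theta : B2 R (X * G)%type -> B2 R (X * G)%type :=
  ext_lim (gpd_Cc 0) gpd_regular (fun F => CX_regular (fun g x => F (x, g))).

Definition Theta_inv (T : B2 R (X * G)%type) : B2 R (X * G)%type :=
  get [set A | gpd_Cstar A /\ Theta A = T].

Lemma fibre_point_subproof (w : X) (g : G) : (act g w, g) \in fibre w.
Proof. by apply/mem_set; rewrite /fibre /gsrc /= -actM mulVg act1. Qed.

Definition fibre_point (w : X) (g : G) : fibre w :=
  exist _ (act g w, g) (fibre_point_subproof w g).

Definition Vunitary (w : X) : bop (ell2 R (fibre w)) (ell2 R G) :=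
  mk_bop (fun xi g => xi (fibre_point w g)).

Definition symbol (T : B2 R (X * G)%type) (w : X) : B2 R G :=
  Vunitary w *o regular_at w (Theta_inv T) *o adj (Vunitary w).

Definition wot_continuous_on (B : set X) (F : X -> B2 R G) :=
  forall xi eta, {within B, continuous (fun w => inner (F w xi) eta)}.

(* C_WOT(B, C*_u(G))^G for an invariant B: functions are considered on B only,
   their values outside B being irrelevant. *)
Definition symbol_algebra (B : set X) : set (X -> B2 R G) :=
  [set F | [/\ forall w, B w -> uniform_roe (F w),
               wot_continuous_on B F &
               forall g w, B w ->
                 F (act g w) = adj (Rtrans g) *o F w *o Rtrans g]].

Definition symbol_invertible (B : set X) (F : X -> B2 R G) :=
  symbol_algebra B F /\
  exists2 F', symbol_algebra B F' & forall w, B w -> is_inverse (F w) (F' w).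

End TransformationGroupoid.

(* Topological amenability of the groupoid X * G: approximately invariant
   functions in C_c(X * G) with values in [0, 1], uniformly on compact sets. *)
Definition amenable_action (R : realType) {G : groupType} {X : topologicalType}
    (act : homeo_action G X) :=
  forall (K : set (X * G)) (e : R),
  compact (K : set (X * discrete_topology G)) -> 0 < e ->
  exists f : X * G -> R,
    [/\ gpd_Cc 0 f, (forall a, 0 <= f a <= 1) &
      forall g, K g ->
        `|1 - \sum_(a \in [set a | gsrc act a = grng g]) f a| < e /\
        \sum_(a \in [set a | gsrc act a = grng g]) `|f a - f (gmul a g)| < e].

Section OperatorFacts.
Context {R : realType}.

Lemma diag_opE {I : choiceType} (f : I -> R[i]) : linfty f ->
  forall xi i, diag_op f xi i = f i * xi i.
Proof.
move=> [M fM] xi i.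
rewrite /diag_op (@mk_bopE _ _ _ _ (M ^+ 2))// => [k x y|x].
  by apply/funext => j; rewrite !fctE mulrDr; congr (_ + _); exact: mulrCA.
rewrite /sqsum -sqsumZ ?sqr_ge0//; last by move=> j; rewrite lee_fin sqmod_ge0.
apply: le_esum => j _; rewrite -EFinM lee_fin sqmodM ler_wpM2r ?sqmod_ge0//.
have := fM j; rewrite normc_def lecR => fjM.
rewrite -[leLHS]sqr_sqrtr ?sqmod_ge0// ler_pXn2r// nnegrE ?sqrtr_ge0//.
exact: le_trans (sqrtr_ge0 _) fjM.
Qed.

Lemma LtransE {G : groupType} (g : G) (xi : ell2 R G) h :
  Ltrans g xi h = xi (g^-1 * h)%g.
Proof. by rewrite /Ltrans (@mk_bop_reindexE R _ _ (fun h => g^-1 * h)%g)//; exact: mulgI. Qed.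

Lemma RtransE {G : groupType} (g : G) (xi : ell2 R G) h :
  Rtrans g xi h = xi (h * g^-1)%g.
Proof.
by rewrite /Rtrans (@mk_bop_reindexE R _ _ (fun h => h * g^-1)%g)//; exact: mulIg.
Qed.

Lemma shift_opE {G : groupType} {I : choiceType} (g : G)
  (xi : ell2 R (I * G)%type) p : shift_op g xi p = xi (p.1, (g^-1 * p.2)%g).
Proof.
rewrite /shift_op (@mk_bop_reindexE R _ _ (fun p : I * G => (p.1, g^-1 * p.2)%g))//.
by move=> [i h] [j k] /= [-> /mulgI->].
Qed.

Lemma VunitaryE {G : groupType} {X : topologicalType} (act : homeo_action G X)
  (w : X) (xi : ell2 R (fibre act w)) g :
  Vunitary act w xi g = xi (fibre_point act w g).
Proof.
rewrite /Vunitary (@mk_bop_reindexE R _ _ (fibre_point act w))//.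
by move=> g1 g2 [].
Qed.

Lemma sqsum_slices {I J : choiceType} (f : I * J -> R[i]) :
  (sqsum f = \esum_(j in [set: J]) sqsum (fun i => f (i, j)))%E.
Proof.
rewrite /sqsum (esum_esum _ (a := fun j i => (sqmod (f (i, j)))%:E)).
  apply: reindex_esum; split => //= [[? ?] [? ?] _ _ [-> ->]//|[i j] _].
  by exists (j, i).
by move=> *; rewrite lee_fin sqmod_ge0.
Qed.

Lemma coef_opE {G : groupType} {I : choiceType} {E : zmodType}
  (pi : E -> B2 R I) (alpha : G -> E -> E) (a : E) (M : R) :
  (forall h, op_norm (pi (alpha h a)) <= M) ->
  forall xi (p : I * G), coef_op pi alpha a xi p =
    pi (alpha p.2^-1%g a) (mk_ell2 (fun i => xi (i, p.2))) p.1.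
Proof.
move=> aM xi p.
have slice (x : ell2 R (I * G)%type) (h : G) :
    (fun i => x (i, h)) \in @sq_summable R I.
  apply/asboolP; apply: (@le_lt_trans _ _ (sqsum x)); last first.
    by rewrite -ell2_norm_sqr ltry.
  rewrite sqsum_slices; apply: esum_ge; exists [set h].
    by split => //; exact: finite_set1.
  by rewrite fsbig_set1.
have mkE (x : ell2 R (I * G)%type) (h : G) :
    mk_ell2 (fun i => x (i, h)) = Ell2 (slice x h).
  by apply/val_inj; rewrite /mk_ell2 insubdK//; exact: slice.
rewrite /coef_op (@mk_bopE _ _ _ _ (M ^+ 2))// => [k x y|x].
  apply/funext => q; rewrite !fctE.
  have -> : mk_ell2 (fun i => (k *: (x : _ -> _) + (y : _ -> _)) (i, q.2)) =
      k *: mk_ell2 (fun i => x (i, q.2)) + mk_ell2 (fun i => y (i, q.2)).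
    by rewrite !mkE (mkE (k *: x + y)); apply/val_inj.
  by rewrite linearP.
rewrite [in leRHS]sqsum_slices sqsum_slices -sqsumZ ?sqr_ge0//; last first.
  by move=> h; exact: sqsum_ge0.
apply: le_esum => h _ /=; rewrite mkE.
rewrite -ell2_norm_sqr -[sqsum _](ell2_norm_sqr (Ell2 (slice x h))).
rewrite -EFinM lee_fin -exprMn ler_pXn2r ?nnegrE ?ell2_norm_ge0//.
  exact: (le_trans (op_normP (pi (alpha h^-1%g a)) (Ell2 (slice x h)))
    (ler_wpM2r (rnorm_ge0 _) (aM _))).
by rewrite mulr_ge0 ?ell2_norm_ge0// (le_trans (op_norm_ge0 _) (aM 1%g)).
Qed.

End OperatorFacts.

(* Main.v *)
(* The crossed product A = C(X) x G acts block-diagonally on ell^2(X * G), and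
   its block at w is both the limit operator sigma_w(T) and the value at w of the
   symbol of T.  Exactness, applied to C_0(Y) -> C(X) -> C(~Y), says that
   C_0(Y) x G consists of the T in A whose blocks over ~Y vanish, and that the
   compression of A to the blocks over ~Y is closed.

   (1) => (2): the blocks of an inverse modulo C_0(Y) x G invert the symbol.
   (2) => (3): a WOT-continuous family on the compact set ~Y is bounded, by the
   uniform boundedness principle.
   (3) => (1): the inverses of the blocks add up to a bounded operator, which is
   a norm limit of compressions of elements of A (a Neumann series), hence is
   itself such a compression.

   (4) => (3) when the action is amenable: the approximately invariant functions
   give partitions of unity on G with uniformly finite supports which nearly
   commute with the blocks, so that a vector almost annihilated by some block can
   be cut down to a vector with controlled finite support.  If the blocks were
   not uniformly bounded below, one could do this at all scales 4^-k around a
   common point of G, move that point to 1 by equivariance, and pass to a cluster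
   point w in ~Y, whose block would not be bounded below. *)
Require Import Defs.
From HB Require Import structures.
From mathcomp Require Import all_boot all_order all_algebra.
From mathcomp Require Import all_classical all_reals all_analysis.
From mathcomp Require Import complex.
From mathcomp Require summability.
From mathcomp Require Import finmap ring lra.

Set Implicit Arguments.
Unset Strict Implicit.
Unset Printing Implicit Defensive.

Import Order.TTheory GRing.Theory Num.Theory numFieldNormedType.Exports.

Local Open Scope classical_set_scope.
Local Open Scope complex_scope.
Local Open Scope ring_scope.

(** * Norms and bounded operators *)

(** (3) => (1): no functional calculus or spectral permanence is used, so the inverse has to be
    built by hand. The Neumann series contracts only on the range of the projection onto the blocks
    over the boundary: its partial sums lie in the crossed product but need to converge only after
    compression, and it is the closedness of the compressed algebra that brings the limit back.

    (4) => (3): the blocks are in general not norm continuous in the point, so pointwise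
    invertibility gives no local bound by itself. On vectors supported in a fixed finite subset of
    the group they are norm continuous, which is why almost annihilated vectors are cut down to
    finite supports. One cut weakens the smallness by a factor 4, whence the scales 4^-k. The scale
    at which the contradiction appears depends on the cluster point, so every point of the sequence
    must serve many scales at once. Lower bounds are all that has to be estimated, invertibility of
    the blocks being assumed.

    Identities and memberships on the crossed product are checked on monomials and carried to the
    closure by Lipschitz maps. *)

Section Norms.
Context {R : realType}.
Implicit Types (U V W : normedModType R[i]).

Lemma rnorm_opp V (x : V) : rnorm (- x) = rnorm x.
Proof. by rewrite /rnorm normrN. Qed.

Lemma rnorm_distC V (x y : V) : rnorm (x - y) = rnorm (y - x).
Proof. by rewrite -rnorm_opp opprB. Qed.

Lemma rnorm_eq0 V (x : V) : rnorm x = 0 -> x = 0.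
Proof. by move=> x0; apply/normr0_eq0; rewrite rnormE x0. Qed.

Lemma rnorm_gt0 V (x : V) : (0 < rnorm x) = (x != 0).
Proof.
rewrite lt_def rnorm_ge0 andbT; apply/idP/idP; apply: contraNN.
  by move=> /eqP ->; rewrite rnorm0.
by move=> /eqP/rnorm_eq0 ->.
Qed.

(** Comparable complex numbers have equal imaginary parts, so a positive radius is real. This is
    what allows neighbourhoods to be described by real radii. *)
Lemma lt0c (e : R[i]) : 0 < e -> e = (complex.Re e)%:C /\ 0 < complex.Re e.
Proof.
by case: e => a b; rewrite ltcE /= => /andP[/eqP -> a0]; split.
Qed.

Lemma near_rnorm V (v : V) (P : set V) :
  nbhs v P <-> exists2 e : R, 0 < e & forall x, rnorm (v - x) < e -> P x.
Proof.
split.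
  move=> /nbhs_normP [e /= e0 eP]; have [ee re0] := lt0c e0.
  exists (complex.Re e) => // x vx; apply: eP.
  by rewrite /ball_ /= rnormE ee ltcR.
move=> [e e0 eP]; apply/nbhs_normP; exists e%:C; first by rewrite /= ltcR.
by move=> x; rewrite /ball_ /= rnormE ltcR; exact: eP.
Qed.

Lemma closure_rnorm V (A : set V) (v : V) :
  closure A v <-> forall e : R, 0 < e -> exists2 a, A a & rnorm (v - a) < e.
Proof.
split.
  move=> cA e e0; have [|a [Aa va]] := cA [set x | rnorm (v - x) < e].
    by apply/near_rnorm; exists e.
  by exists a.
move=> cA B /near_rnorm [e e0 eB]; have [a Aa va] := cA e e0.
by exists a; split => //; exact: eB.
Qed.

Lemma rnorm_small_eq0 V (x : V) :
  (forall e : R, 0 < e -> rnorm x <= e) -> x = 0.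
Proof.
move=> xe; apply: rnorm_eq0; apply/eqP; rewrite eq_le rnorm_ge0 andbT.
by apply/ler_addgt0Pl => e e0; rewrite addr0; exact: xe.
Qed.

(** A form of continuity that also covers affine maps such as [x - v]; the constant is required to
    be positive so that one may divide by it. *)
Definition lip V W (f : V -> W) :=
  exists2 C : R, 0 < C & forall x y, rnorm (f x - f y) <= C * rnorm (x - y).

Lemma eq_lip V W (f g : V -> W) : f =1 g -> lip f -> lip g.
Proof. by move=> /funext ->. Qed.

Lemma closure_lip_eq V W (f g : V -> W) (A : set V) v : lip f -> lip g ->
  (forall a, A a -> f a = g a) -> closure A v -> f v = g v.
Proof.
move=> [C C0 fC] [D D0 gD] fg /closure_rnorm cA.
apply/eqP; rewrite -subr_eq0; apply/eqP; apply: rnorm_small_eq0 => e e0.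
have CD0 : 0 < C + D by rewrite addr_gt0.
have [a Aa va] := cA (e / (C + D)) (divr_gt0 e0 CD0).
have -> : f v - g v = (f v - f a) + (g a - g v).
  by rewrite (fg a Aa) addrA subrK.
apply: le_trans (rnormD _ _) _.
apply: (@le_trans _ _ (C * rnorm (v - a) + D * rnorm (v - a))).
  by apply: lerD; rewrite ?fC// (rnorm_distC v) gD.
by rewrite -mulrDl mulrC -ler_pdivlMr// ltW.
Qed.

Lemma closure_lip V W (f : V -> W) (A : set V) (B : set W) v : lip f ->
  (forall a, A a -> closure B (f a)) -> closure A v -> closure B (f v).
Proof.
move=> [C C0 fC] fAB /closure_rnorm cA; apply/closure_rnorm => e e0.
have e20 : 0 < e / 2 by rewrite divr_gt0.
have [a Aa va] := cA (e / 2 / C) (divr_gt0 e20 C0).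
have [b Bb fab] := (closure_rnorm _ _).1 (fAB a Aa) _ e20.
exists b => //; have -> : f v - b = (f v - f a) + (f a - b).
  by rewrite addrA subrK.
apply: le_lt_trans (rnormD _ _) _; rewrite [ltRHS]splitr ler_ltD//.
by rewrite (le_trans (fC _ _))// mulrC -ler_pdivlMr// ltW.
Qed.

(** Any Lipschitz map that agrees with [phi] on [D] computes the extension, so it is never necessary
    to show that [phi a] depends only on [iota a]. The filter is proper because [v] is in the
    closure. *)
Lemma ext_limE (E : Type) V W (D : set E) (iota : E -> V) (phi : E -> W)
    (f : V -> W) v : lip f -> (forall a, D a -> phi a = f (iota a)) ->
  closure (iota @` D) v -> ext_lim D iota phi v = f v.
Proof.
move=> [C C0 fC] phif cD; rewrite /ext_lim.
set F := filter_from _ _.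
have FF : ProperFilter F.
  apply: filter_from_proper; last first.
    by move=> N /cD [_ [[a Da <-] Na]]; exists a.
  apply: filter_from_filter; first by exists setT; exact: filterT.
  move=> N M vN vM; exists (N `&` M); first exact: filterI.
  by move=> x [Dx [Nx Mx]].
apply: cvg_lim => //.
move=> P /near_rnorm [e e0 eP].
exists [set x | rnorm (v - x) < e / C].
  by apply/near_rnorm; exists (e / C); rewrite ?divr_gt0.
move=> a [Da va] /=; apply: eP; rewrite (phif a Da).
by apply: le_lt_trans (fC _ _) _; rewrite mulrC -ltr_pdivlMr.
Qed.

Lemma lip_sub V (v : V) : lip (fun x : V => x - v).
Proof. by exists 1 => // x y; rewrite mul1r opprB addrA subrK. Qed.

Lemma lip_subr V (v : V) : lip (fun x : V => v - x).
Proof.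
exists 1 => // x y; rewrite mul1r opprB addrC addrA subrK.
by rewrite rnorm_distC.
Qed.

Lemma lip_scale V (k : R[i]) : lip (fun x : V => k *: x).
Proof.
exists (complex.Re `|k| + 1) => [|x y].
  by rewrite ltr_wpDl ?Re_norm_ge0.
by rewrite -scalerBr rnormZ ler_wpM2r ?rnorm_ge0// lerDl.
Qed.

End Norms.

(** * Algebra of bounded operators *)

Section Composition.
Context {R : realType}.
Implicit Types (U V W : normedModType R[i]).

Lemma bop_ext V W (S T : bop V W) : (forall x, S x = T x) -> S = T.
Proof. by move=> ST; apply/val_inj/funext. Qed.

Lemma op_norm_comp U V W (S : bop V W) (T : bop U V) :
  op_norm (S *o T) <= op_norm S * op_norm T.
Proof.
apply: op_norm_le => [|x]; first by rewrite mulr_ge0 ?op_norm_ge0.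
rewrite /=; apply: le_trans (op_normP _ _) _.
by rewrite -mulrA ler_wpM2l ?op_norm_ge0 ?op_normP.
Qed.

Lemma comp_bopA U V W V' (S : bop W V') (T : bop V W) (Q : bop U V) :
  S *o (T *o Q) = S *o T *o Q.
Proof. exact/bop_ext. Qed.

Lemma comp_idl V W (S : bop V W) : id_bop *o S = S.
Proof. exact/bop_ext. Qed.

Lemma comp_idr V W (S : bop V W) : S *o id_bop = S.
Proof. exact/bop_ext. Qed.

Lemma comp_bopDl U V W (S S' : bop V W) (T : bop U V) :
  (S + S') *o T = S *o T + S' *o T.
Proof. exact/bop_ext. Qed.

Lemma comp_bopDr U V W (S : bop V W) (T T' : bop U V) :
  S *o (T + T') = S *o T + S *o T'.
Proof. by apply/bop_ext => x /=; rewrite !fctE linearD. Qed.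

Lemma comp_bopNl U V W (S : bop V W) (T : bop U V) : (- S) *o T = - (S *o T).
Proof. exact/bop_ext. Qed.

Lemma comp_bopNr U V W (S : bop V W) (T : bop U V) : S *o (- T) = - (S *o T).
Proof. by apply/bop_ext => x /=; rewrite !fctE linearN. Qed.

Lemma comp_bopZl U V W (k : R[i]) (S : bop V W) (T : bop U V) :
  (k *: S) *o T = k *: (S *o T).
Proof. exact/bop_ext. Qed.

Lemma comp_bopZr U V W (k : R[i]) (S : bop V W) (T : bop U V) :
  S *o (k *: T) = k *: (S *o T).
Proof. by apply/bop_ext => x /=; rewrite !fctE linearZ. Qed.

Lemma comp_bop0l U V W (T : bop U V) : (0 : bop V W) *o T = 0.
Proof. exact/bop_ext. Qed.

Lemma comp_bop0r U V W (S : bop V W) : S *o (0 : bop U V) = 0.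
Proof. by apply/bop_ext => x /=; rewrite linear0. Qed.

Lemma comp_bopBl U V W (S S' : bop V W) (T : bop U V) :
  (S - S') *o T = S *o T - S' *o T.
Proof. by rewrite comp_bopDl comp_bopNl. Qed.

Lemma comp_bopBr U V W (S : bop V W) (T T' : bop U V) :
  S *o (T - T') = S *o T - S *o T'.
Proof. by rewrite comp_bopDr comp_bopNr. Qed.

Lemma bop_sumE (J : Type) V W (s : seq J) (F : J -> bop V W) x :
  (\sum_(j <- s) F j) x = \sum_(j <- s) F j x.
Proof.
by elim: s => [|j s IH]; rewrite ?big_nil// !big_cons /= fctE IH.
Qed.

Lemma comp_bop_suml (J : Type) U V W (s : seq J) (F : J -> bop V W) (T : bop U V) :
  (\sum_(j <- s) F j) *o T = \sum_(j <- s) (F j *o T).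
Proof. by apply/bop_ext => x /=; rewrite !bop_sumE. Qed.

Lemma comp_bop_sumr (J : Type) U V W (s : seq J) (S : bop V W) (F : J -> bop U V) :
  S *o (\sum_(j <- s) F j) = \sum_(j <- s) (S *o F j).
Proof. by apply/bop_ext => x /=; rewrite !bop_sumE linear_sum. Qed.

Lemma lip_comp U V W V' (S : bop W V') (T : bop U V) :
  lip (fun Q : bop V W => S *o Q *o T).
Proof.
exists (op_norm S * op_norm T + 1) => [|Q Q'].
  by rewrite ltr_wpDl// mulr_ge0 ?op_norm_ge0.
rewrite -comp_bopBl -comp_bopBr.
change (op_norm (S *o (Q - Q') *o T) <= (op_norm S * op_norm T + 1) * op_norm (Q - Q')).
apply: le_trans (op_norm_comp _ _) _.
apply: (@le_trans _ _ (op_norm S * op_norm (Q - Q') * op_norm T)).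
  by rewrite ler_wpM2r ?op_norm_ge0 ?op_norm_comp.
by rewrite mulrAC ler_wpM2r ?op_norm_ge0// lerDl.
Qed.

Lemma lip_compl V W V' (S : bop W V') : lip (fun Q : bop V W => S *o Q).
Proof.
have := lip_comp (W := W) S (@id_bop R V); congr lip; apply/funext => Q.
by rewrite comp_idr.
Qed.

Lemma lip_compr U V W (T : bop U V) : lip (fun Q : bop V W => Q *o T).
Proof.
have := lip_comp (V := V) (@id_bop R W) T; congr lip; apply/funext => Q.
by rewrite comp_idl.
Qed.

Lemma is_inverse_uniq V (T S S' : bop V V) :
  is_inverse T S -> is_inverse T S' -> S = S'.
Proof.
by move=> [ST _] [_ TS']; rewrite -[S]comp_idr -TS' comp_bopA ST comp_idl.
Qed.

Lemma inv_bopE V (T S : bop V V) : is_inverse T S -> inv_bop T = S.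
Proof.
move=> TS; apply: (is_inverse_uniq (T := T)) => //.
suff : [set S | is_inverse T S] (inv_bop T) by [].
by apply: getPex; exists S.
Qed.

End Composition.

(** * Hilbert space *)

#[local] Existing Instance summability.totally_filter.

Section Inner.
Context {R : realType} {I : choiceType}.
Implicit Types (x y z : ell2 R I) (f g : I -> R[i]) (l m k : R[i]).

Lemma ell2_ext x y : (forall i, x i = y i) -> x = y.
Proof. by move=> xy; apply/val_inj/funext. Qed.

Lemma ell2ZE k x i : (k *: x) i = k * x i. Proof. by []. Qed.

Lemma ell2DE x y i : (x + y) i = x i + y i. Proof. by []. Qed.

Lemma rnorm_ell2 x : rnorm x = ell2_norm x. Proof. by []. Qed.

Definition has_sum f l := summability.partial_sum f @ summability.totally --> l.

Lemma has_sumE f l : has_sum f l -> summability.sum f = l.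
Proof. by move=> fl; apply: cvg_lim => //; exact: summability.totally_filter. Qed.

Lemma has_sumD f g l m : has_sum f l -> has_sum g m -> has_sum (f \+ g) (l + m).
Proof.
move=> fl gm; rewrite /has_sum.
have -> : summability.partial_sum (f \+ g) =
    (summability.partial_sum f \+ summability.partial_sum g).
  by apply/funext => A; rewrite /summability.partial_sum big_split.
exact: (@cvgD R[i] R[i] _ _ (@summability.totally_filter I) _ _ _ _ fl gm).
Qed.

Lemma has_sumZ f k l : has_sum f l -> has_sum (fun i => k * f i) (k * l).
Proof.
move=> fl; rewrite /has_sum.
have -> : summability.partial_sum (fun i => k * f i) =
    (fun A => k * summability.partial_sum f A).
  by apply/funext => A; rewrite /summability.partial_sum mulr_sumr.
exact: (@cvgM R[i] _ _ (@summability.totally_filter I) _ _ _ _ (cvg_cst _) fl).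
Qed.

(** Partial sums of nonnegative terms grow with the finite set and stay below [sqsum], so one finite
    set within [e] of the supremum controls all larger ones. This links the extended real sums to
    limits along finite sets. *)
Lemma has_sum_sqmod x : has_sum (fun i => (sqmod (x i))%:C) (ell2_norm x ^+ 2)%:C.
Proof.
move=> P /near_rnorm [e e0 eP].
have : ((ell2_norm x ^+ 2 - e)%:E < sqsum x)%E.
  by rewrite -ell2_norm_sqr lte_fin ltrBlDr ltrDl.
rewrite /sqsum /esum => /ereal_sup_gt [_ [A [finA _] <-] eA].
exists (fset_set A) => // B /= AB; apply: eP.
have bound (D : {fset I}) : \sum_(i <- D) sqmod (x i) <= ell2_norm x ^+ 2.
  rewrite -lee_fin ell2_norm_sqr; apply: esum_ge.
  exists [set` D]; first by split => //; exact: finite_fset.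
  by rewrite fsbig_finite//= set_fsetK sumEFin.
have pE : summability.partial_sum (fun i => (sqmod (x i))%:C) B =
    (\sum_(i <- B) sqmod (x i))%:C.
  rewrite /summability.partial_sum rmorph_sum /=.
  by rewrite (big_seq_fsetE _ _ predT (fun i => (sqmod (x i))%:C)).
rewrite pE -rmorphB /= /rnorm normc_def /= expr0n addr0 sqrtr_sqr ger0_norm.
  rewrite ltrBlDr -ltrBlDl.
  apply: (@lt_le_trans _ _ (\sum_(i <- fset_set A) sqmod (x i))).
    by rewrite -lte_fin -sumEFin -fsbig_finite.
  rewrite (big_fsetID _ [in fset_set A] B) /=.
  have -> : [fset i | i in B & i \in fset_set A]%fset = fset_set A.
    apply/fsetP => i; rewrite !inE /= andbC.
    by case: (boolP (i \in fset_set A)) => //= iA; exact: (fsubsetP AB).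
  by rewrite lerDl sumr_ge0// => i _; rewrite sqmod_ge0.
by rewrite subr_ge0 bound.
Qed.

(** The polarization identity. It reduces the convergence of the inner product to that of squared
    norms, and shows at once that isometries preserve inner products. The differences are spelled
    [+ -1 *] to match [has_sumZ]. *)
Definition polar x y : R[i] :=
  4^-1 * ((ell2_norm (x + y) ^+ 2)%:C + -1 * (ell2_norm (x - y) ^+ 2)%:C) +
  4^-1 * 'i%C * ((ell2_norm (x + 'i%C *: y) ^+ 2)%:C + -1 *
                 (ell2_norm (x - 'i%C *: y) ^+ 2)%:C).

Lemma has_sum_polar x y : has_sum (fun i => x i * conjc (y i)) (polar x y).
Proof.
have S := @has_sum_sqmod.
have -> : (fun i => x i * conjc (y i)) =
  (fun i => 4^-1 * ((sqmod ((x + y) i))%:C + -1 * (sqmod ((x - y) i))%:C) +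
    4^-1 * 'i%C * ((sqmod ((x + 'i%C *: y) i))%:C +
                 -1 * (sqmod ((x - 'i%C *: y) i))%:C)).
  apply/funext => i.
  change ((x + y) i) with (x i + y i).
  change ((x - y) i) with (x i - y i).
  change ((x + 'i%C *: y) i) with (x i + 'i%C * y i).
  change ((x - 'i%C *: y) i) with (x i - 'i%C * y i).
  case: (x i) => a b; case: (y i) => c d.
  have -> : 4^-1 = (4^-1)%:C :> R[i] by rewrite fmorphV rmorphMn.
  by apply/eqP; rewrite /sqmod eq_complex /=; apply/andP; split; apply/eqP; field.
rewrite /polar.
have D (u v : ell2 R I) : has_sum (fun i => (sqmod (u i))%:C + -1 * (sqmod (v i))%:C)
    ((ell2_norm u ^+ 2)%:C + -1 * (ell2_norm v ^+ 2)%:C).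
  exact: (has_sumD (S u) (@has_sumZ _ (-1) _ (S v))).
exact: (has_sumD (@has_sumZ _ _ _ (D _ _)) (@has_sumZ _ _ _ (D _ _))).
Qed.

Lemma innerE x y : inner x y = polar x y.
Proof. exact/has_sumE/has_sum_polar. Qed.

Lemma has_sum_inner x y : has_sum (fun i => x i * conjc (y i)) (inner x y).
Proof. by rewrite innerE; exact: has_sum_polar. Qed.

Lemma inner_eq x y l : has_sum (fun i => x i * conjc (y i)) l -> inner x y = l.
Proof. by move=> /has_sumE. Qed.

Lemma innerDl x y z : inner (x + y) z = inner x z + inner y z.
Proof.
apply: inner_eq; have := has_sumD (@has_sum_inner x z) (@has_sum_inner y z).
by congr has_sum; apply/funext => i /=; rewrite -mulrDl.
Qed.

Lemma innerZl k x z : inner (k *: x) z = k * inner x z.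
Proof.
apply: inner_eq; have := @has_sumZ _ k _ (@has_sum_inner x z).
by congr has_sum; apply/funext => i /=; rewrite mulrA.
Qed.

Lemma innerDr x y z : inner z (x + y) = inner z x + inner z y.
Proof.
apply: inner_eq; have := has_sumD (@has_sum_inner z x) (@has_sum_inner z y).
by congr has_sum; apply/funext => i /=; rewrite -mulrDr -rmorphD.
Qed.

Lemma innerZr k x z : inner z (k *: x) = conjc k * inner z x.
Proof.
apply: inner_eq; have := @has_sumZ _ (conjc k) _ (@has_sum_inner z x).
by congr has_sum; apply/funext => i /=; rewrite mulrCA -rmorphM.
Qed.

Lemma innerNl x z : inner (- x) z = - inner x z.
Proof. by rewrite -scaleN1r innerZl mulN1r. Qed.

Lemma innerNr x z : inner z (- x) = - inner z x.
Proof. by rewrite -scaleN1r innerZr rmorphN rmorph1 mulN1r. Qed.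

Lemma innerBl x y z : inner (x - y) z = inner x z - inner y z.
Proof. by rewrite innerDl innerNl. Qed.

Lemma innerBr x y z : inner z (x - y) = inner z x - inner z y.
Proof. by rewrite innerDr innerNr. Qed.

Lemma inner0l z : inner 0 z = 0.
Proof. by rewrite -(scale0r (0 : ell2 R I)) innerZl mul0r. Qed.

Lemma inner0r z : inner z 0 = 0.
Proof. by rewrite -(scale0r (0 : ell2 R I)) innerZr rmorph0 mul0r. Qed.

Lemma inner_sumr (J : Type) (s : seq J) (F : J -> ell2 R I) z :
  inner z (\sum_(j <- s) F j) = \sum_(j <- s) inner z (F j).
Proof.
by elim: s => [|j s IH]; rewrite ?big_nil ?inner0r// !big_cons innerDr IH.
Qed.

Lemma inner_self x : inner x x = (ell2_norm x ^+ 2)%:C.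
Proof.
apply: inner_eq; have := @has_sum_sqmod x; congr has_sum; apply/funext => i.
case: (x i) => a b; apply/eqP; rewrite /sqmod eq_complex /=.
by apply/andP; split; apply/eqP; ring.
Qed.

Lemma inner_conj x y : conjc (inner x y) = inner y x.
Proof.
have N z : ell2_norm (- z) = ell2_norm z by rewrite -!rnorm_ell2 rnorm_opp.
have NZ z : ell2_norm ('i%C *: z) = ell2_norm z.
  by rewrite ell2_normZ /sqmod /= expr0n expr1n add0r sqrtr1 mul1r.
rewrite !innerE /polar !mulN1r.
have -> : y - x = - (x - y) by rewrite opprB.
have -> : y + 'i%C *: x = 'i%C *: (x - 'i%C *: y).
  by rewrite scalerBr scalerA -expr2 sqr_i scaleN1r opprK addrC.
have -> : y - 'i%C *: x = - ('i%C *: (x + 'i%C *: y)).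
  by rewrite scalerDr scalerA -expr2 sqr_i scaleN1r opprD opprK addrC.
rewrite !N !NZ (addrC y x).
have -> : 4^-1 = (4^-1)%:C :> R[i] by rewrite fmorphV rmorphMn.
by apply/eqP; rewrite eq_complex /=; apply/andP; split; apply/eqP; field.
Qed.

Lemma cauchy_schwarz x y : rnorm (inner x y) <= ell2_norm x * ell2_norm y.
Proof.
set c := inner x y.
have cE : rnorm c ^+ 2 = complex.Re (c * conjc c).
  rewrite /rnorm normc_def sqr_sqrtr ?addr_ge0 ?sqr_ge0//.
  by case: (c) => a b /=; ring.
have [y0|y0] := eqVneq (ell2_norm y) 0.
  by rewrite /c (ell2_norm0_eq0 y0) inner0r rnorm0 mulr_ge0 ?ell2_norm_ge0.
have {}y0 : 0 < ell2_norm y ^+ 2 by rewrite exprn_gt0// lt_def y0 ell2_norm_ge0.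
set n := ell2_norm y ^+ 2 in y0.
(* The vector is [n] times the component of [x] orthogonal to [y], scaled so that no division
   occurs. *)
have : complex.Re (inner (n%:C *: x - c *: y) (n%:C *: x - c *: y)) =
    n * (n * ell2_norm x ^+ 2 - rnorm c ^+ 2).
  rewrite cE innerBl !innerBr !innerZl !innerZr !inner_self -(inner_conj x y) -/c -/n.
  by case: c {cE} => a b /=; ring.
rewrite inner_self /= => E.
have : 0 <= n * (n * ell2_norm x ^+ 2 - rnorm c ^+ 2) by rewrite -E sqr_ge0.
rewrite pmulr_rge0// subr_ge0 -exprMn => H.
by rewrite -(@ler_pXn2r _ 2)// ?nnegrE ?rnorm_ge0 ?mulr_ge0 ?ell2_norm_ge0// mulrC.
Qed.

Lemma delta_subproof (h : I) :
  (fun i => (i == h)%:R : R[i]) \in @sq_summable R I.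
Proof.
apply/asboolP; rewrite /sqsum.
have -> : (\esum_(i in [set: I]) (sqmod ((i == h)%:R : R[i]))%:E =
    \esum_(i in [set h]) 1 :> \bar R)%E.
  rewrite [RHS]esum_mkcond; apply: eq_esum => i _; case: eqP => [->|ih].
    by rewrite mem_set// /sqmod /= expr1n expr0n addr0.
  by rewrite memNset// /sqmod /= expr0n addr0.
by rewrite esum_set1// ltry.
Qed.

Definition delta h : ell2 R I := Ell2 (delta_subproof h).

Lemma deltaE h i : delta h i = (i == h)%:R. Proof. by []. Qed.

Lemma inner_delta x h : inner x (delta h) = x h.
Proof.
apply: inner_eq; rewrite /has_sum.
apply: (@cvg_trans _ ((fun=> x h) @ summability.totally)); last first.
  exact: (@cvg_cst _ _ _ _ summability.totally_filter).
apply: near_eq_cvg; exists [fset h]%fset => // B /fsubsetP /(_ h); rewrite fset11 => /(_ isT) hB /=.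
rewrite /summability.partial_sum.
rewrite -(big_seq_fsetE _ _ predT (fun i => x i * conjc (delta h i))) /=.
rewrite (big_fsetD1 h)//= eqxx conjc1 mulr1 big_seq big1 ?addr0// => i.
by rewrite !inE => /andP[/negPf ih _]; rewrite ih conjc0 mulr0.
Qed.

Lemma ell2_eval_le x h : rnorm (x h) <= ell2_norm x.
Proof.
rewrite -(@ler_pXn2r _ 2)// ?nnegrE ?rnorm_ge0 ?ell2_norm_ge0//.
rewrite -lee_fin ell2_norm_sqr; apply: le_trans (sqmod_le_sqsum x h).
by rewrite lee_fin /rnorm normc_def /= sqr_sqrtr ?sqmod_ge0.
Qed.

Lemma inner_nondeg x y : (forall z, inner z x = inner z y) -> x = y.
Proof.
move=> xy; apply/eqP; rewrite -subr_eq0; apply/eqP/ell2_norm0_eq0.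
have := inner_self (x - y); rewrite innerBr (xy (x - y)) subrr.
by case=> /esym/eqP; rewrite sqrf_eq0 => /eqP.
Qed.

End Inner.

Lemma bopZE {R : realType} {V W : normedModType R[i]} (k : R[i]) (T : bop V W) x :
  (k *: T) x = k *: T x.
Proof. by []. Qed.

Lemma bopDE {R : realType} {V W : normedModType R[i]} (S T : bop V W) x :
  (S + T) x = S x + T x.
Proof. by []. Qed.

Section Adjoint.
Context {R : realType}.
Implicit Types I J : choiceType.

(** An adjoint is unique because the inner product is nondegenerate, so the choice made by [adj] is
    whichever adjoint has been exhibited. Adjoints are exhibited by explicit formulas, case by
    case. *)
Lemma adjE {I J} (T : bop (ell2 R I) (ell2 R J)) S : is_adjoint T S -> adj T = S.
Proof.
move=> TS; have : is_adjoint T (adj T).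
  by suff : [set S | is_adjoint T S] (adj T) by []; apply: getPex; exists S.
move=> TA; apply/bop_ext => y; apply: inner_nondeg => z.
by rewrite -TS TA.
Qed.

Lemma is_adjoint_comp {I J K : choiceType} (T : bop (ell2 R J) (ell2 R K))
    (Q : bop (ell2 R I) (ell2 R J)) T' Q' :
  is_adjoint T T' -> is_adjoint Q Q' -> is_adjoint (T *o Q) (Q' *o T').
Proof. by move=> TT QQ x y /=; rewrite TT QQ. Qed.

Lemma is_adjointD {I J} (T S : bop (ell2 R I) (ell2 R J)) T' S' :
  is_adjoint T T' -> is_adjoint S S' -> is_adjoint (T + S) (T' + S').
Proof. by move=> TT SS x y /=; rewrite !fctE innerDl innerDr TT SS. Qed.

Lemma is_adjoint0 {I J} : is_adjoint (0 : bop (ell2 R I) (ell2 R J)) 0.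
Proof. by move=> x y /=; rewrite inner0l inner0r. Qed.

End Adjoint.

(** * Uniform boundedness *)

#[local] Existing Instance summability.totally_filter.
Section Truncation.
Context {R : realType} {I : choiceType}.
Implicit Types x : ell2 R I.

Definition trunc (s : seq I) x : ell2 R I := \sum_(h <- s) x h *: delta h.

Lemma ell2_sumE (J : Type) (s : seq J) (F : J -> ell2 R I) i :
  (\sum_(j <- s) F j) i = \sum_(j <- s) F j i.
Proof.
elim: s => [|j s IH]; first by rewrite !big_nil.
by rewrite !big_cons -IH.
Qed.

(** Truncation is an orthogonal projection, so the squared error is the squared norm minus the
    finite sum, which [has_sum_sqmod] makes small. *)
Lemma trunc_approx x (e : R) : 0 < e -> exists2 s : seq I, uniq s &
  ell2_norm (x - trunc s x) < e.
Proof.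
move=> e0.
have := @has_sum_sqmod R I x [set l | rnorm ((ell2_norm x ^+ 2)%:C - l) < e ^+ 2].
case; first by apply/near_rnorm; exists (e ^+ 2); rewrite ?exprn_gt0.
move=> A _ /(_ A (fsubset_refl A)) /=.
rewrite /summability.partial_sum.
rewrite -(big_seq_fsetE _ _ predT (fun i => (sqmod (x i))%:C)) /= -rmorph_sum.
rewrite -rmorphB /rnorm normc_def /= expr0n addr0 sqrtr_sqr => ltA.
exists (enum_fset A); first exact: fset_uniq.
set t := trunc _ _.
have tk k : k \in A -> t k = x k.
  move=> kA; rewrite /t /trunc ell2_sumE.
  rewrite (big_fsetD1 k)//= big_seq big1.
    change (x k * (k == k)%:R + 0 = x k).
    by rewrite eqxx mulr1 addr0.
  move=> i; rewrite !inE => /andP[ik _].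
  change (x i * (k == i)%:R = 0).
  by rewrite eq_sym (negPf ik) mulr0.
have tE z : inner z t = \sum_(k <- A) conjc (x k) * z k.
  by rewrite /t /trunc inner_sumr; apply: eq_bigr => k _; rewrite innerZr inner_delta.
have xt : inner x t = (\sum_(k <- A) sqmod (x k))%:C.
  rewrite tE rmorph_sum; apply: eq_bigr => k _ /=.
  case: (x k) => a b; apply/eqP; rewrite /sqmod eq_complex /=.
  by apply/andP; split; apply/eqP; ring.
have tt : inner t t = inner x t.
  by rewrite !tE big_seq [RHS]big_seq; apply: eq_bigr => k /tk ->.
have : inner (x - t) (x - t) = (ell2_norm x ^+ 2 - \sum_(k <- A) sqmod (x k))%:C.
  rewrite innerBl !innerBr tt -(inner_conj x t) xt inner_self.
  by apply/eqP; rewrite eq_complex /=; apply/andP; split; apply/eqP; ring.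
rewrite inner_self => -[E].
rewrite -(@ltr_pXn2r _ 2)// ?nnegrE ?ell2_norm_ge0 ?(ltW e0)// E.
by apply: le_lt_trans ltA; rewrite ler_norm.
Qed.

End Truncation.

(** * Completeness of ell^2 *)

Section Complete.
Context {R : realType} {I : choiceType}.

(** The intervals of radius [b n] around [a n] meet pairwise; the supremum of their left ends lies
    in all of them. *)
Lemma real_squeeze (a b : nat -> R) : (forall n, 0 <= b n) ->
  (forall n m, (n <= m)%N -> `|a m - a n| <= b n) ->
  exists l, forall n, `|l - a n| <= b n.
Proof.
move=> b0 ab.
have key n m : a n - b n <= a m + b m.
  case: (leqP n m) => [nm|/ltnW mn].
    by have := ab _ _ nm; have := b0 m; rewrite ler_norml => ? /andP[]; lra.
  by have := ab _ _ mn; have := b0 n; rewrite ler_norml => ? /andP[]; lra.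
pose S := [set a n - b n | n in [set: nat]].
have S0 : S !=set0 by exists (a 0%N - b 0%N), 0%N.
exists (sup S) => n; rewrite ler_distl; apply/andP; split.
  have : a n - b n <= sup S.
    apply: ub_le_sup; last by exists n.
    by exists (a 0%N + b 0%N) => _ [k _ <-]; exact: key.
  lra.
have : sup S <= a n + b n by apply: ge_sup => // _ [k _ <-]; exact: key.
lra.
Qed.

(** The limit is taken coordinatewise, in real and imaginary parts. The factor 2 pays for joining
    the two parts and for comparing with [u n] through a much later [u m]. The rate [b] need not be
    monotone. *)
Lemma ell2_complete (u : nat -> ell2 R I) (b : nat -> R) : (forall n, 0 < b n) ->
  (forall (e : R) n, 0 < e -> exists2 m, (n <= m)%N & b m < e) ->
  (forall n m, (n <= m)%N -> ell2_norm (u m - u n) <= b n) ->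
  exists x, forall n, ell2_norm (x - u n) <= 2 * b n.
Proof.
move=> b0 bsmall ub.
have sq n m i : (n <= m)%N -> sqmod (u m i - u n i) <= b n ^+ 2.
  move=> nm; apply: (@le_trans _ _ (ell2_norm (u m - u n) ^+ 2)).
    rewrite -lee_fin ell2_norm_sqr.
    exact: (sqmod_le_sqsum (ell2_fun (u m - u n)) i).
  by rewrite ler_pXn2r ?ub// nnegrE ?ell2_norm_ge0// ltW.
have re i : exists l, forall n, `|l - complex.Re (u n i)| <= b n.
  apply: real_squeeze => [n|n m nm]; first exact: ltW.
  rewrite -(@ler_pXn2r _ 2)// ?nnegrE// ?(ltW (b0 n))//.
  apply: le_trans _ (sq n m i nm); rewrite real_normK ?num_real//.
  by case: (u m i) => ? ?; case: (u n i) => ? ?; rewrite /sqmod /= lerDl sqr_ge0.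
have im i : exists l, forall n, `|l - complex.Im (u n i)| <= b n.
  apply: real_squeeze => [n|n m nm]; first exact: ltW.
  rewrite -(@ler_pXn2r _ 2)// ?nnegrE// ?(ltW (b0 n))//.
  apply: le_trans _ (sq n m i nm); rewrite real_normK ?num_real//.
  by case: (u m i) => ? ?; case: (u n i) => ? ?; rewrite /sqmod /= lerDr sqr_ge0.
have [p pP] := boolp.choice re; have [q qP] := boolp.choice im.
pose x i : R[i] := p i +i* q i.
have xu n i : sqmod (x i - u n i) <= 2 * b n ^+ 2.
  have := pP i n; have := qP i n; case: (u n i) => a c /=.
  rewrite -!(@ler_pXn2r _ 2 _ `|_|)// ?nnegrE// ?(ltW (b0 n))//.
  by rewrite !real_normK ?num_real// /sqmod /=; lra.
have bound n (A : set I) : finite_set A ->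
    (\sum_(i \in A) (sqmod (x i - u n i))%:E <= ((2 * b n) ^+ 2)%:E)%E.
  move=> fA; rewrite fsbig_finite//= sumEFin lee_fin.
  set s := fset_set A.
  (* The coordinates in [A] each contribute an error of order [b m], so [b m] must be small against
     [b n] divided by their number; the summand 1 keeps the denominator positive when [A] is
     empty. *)
  pose e := b n / ((size s)%:R + 1) / 2.
  have s0 : 0 < (size s)%:R + 1 :> R by rewrite ltr_wpDl.
  have e0 : 0 < e by rewrite !divr_gt0.
  have [m nm bm] := bsmall e n e0.
  apply: (@le_trans _ _ (\sum_(i <- s)
      (2 * sqmod (u m i - u n i) + 2 * (2 * b m ^+ 2)))).
    apply: ler_sum => i _.
    have -> : x i - u n i = (u m i - u n i) + (x i - u m i) by ring.
    apply: le_trans (sqmodD _ _ ltr01) _; rewrite invr1.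
    by rewrite lerD// ler_wpM2l.
  rewrite big_split /= -mulr_sumr big_const_seq count_predT iter_addr_0.
  have -> : (2 * b n) ^+ 2 = 2 * b n ^+ 2 + 2 * b n ^+ 2 by ring.
  apply: lerD.
    rewrite ler_wpM2l// -lee_fin.
    apply: (@le_trans _ _ (sqsum (ell2_fun (u m - u n)))).
      apply: esum_ge; exists A; first by split.
      by rewrite fsbig_finite//= sumEFin.
    rewrite -ell2_norm_sqr lee_fin ler_pXn2r ?ub// nnegrE ?ell2_norm_ge0// ltW//.
  rewrite -mulr_natr.
  have bme : b m ^+ 2 <= e ^+ 2 by rewrite ler_pXn2r ?nnegrE ?(ltW (b0 _)) ?(ltW bm) ?(ltW e0).
  have s1 : 0 <= (size s)%:R :> R by [].
  have : e ^+ 2 * (2 * (size s)%:R) <= b n ^+ 2.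
    have -> : e ^+ 2 * (2 * (size s)%:R) = b n ^+ 2 *
        (2 * (size s)%:R / ((size s)%:R + 1) ^+ 2 / 4).
      by rewrite /e; field; rewrite gt_eqF.
    rewrite ler_piMr ?sqr_ge0// ler_pdivrMr// mul1r ler_pdivrMr ?exprn_gt0//.
    nra.
  have : b m ^+ 2 * (2 * (size s)%:R) <= e ^+ 2 * (2 * (size s)%:R).
    by rewrite ler_wpM2r// mulr_ge0.
  lra.
have fin n : (sqsum (fun i => x i - u n i)%R <= ((2 * b n) ^+ 2)%:E)%E.
  by apply: ge_ereal_sup => _ [A [fA _] <-]; exact: bound.
(* Square summability is known for differences with the [u n] only; the limit is recovered by adding
   [u 0] back. *)
have xuP : (fun i => x i - u 0%N i) \in @sq_summable R I.
  by apply/asboolP; apply: le_lt_trans (fin 0%N) _; rewrite ltry.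
pose y := Ell2 xuP + u 0%N.
exists y => n; rewrite -(@ler_pXn2r _ 2)// ?nnegrE ?ell2_norm_ge0 ?mulr_ge0 ?(ltW (b0 n))//.
rewrite -lee_fin ell2_norm_sqr.
have -> : ell2_fun (y - u n) = (fun i => x i - u n i).
  apply/funext => i; change (x i - u 0%N i + u 0%N i - u n i = x i - u n i).
  by rewrite subrK.
exact: fin.
Qed.

End Complete.

Section UniformBoundedness.
Context {R : realType} {I : choiceType} {W : normedModType R[i]}.

Lemma op_norm_near (T : bop (ell2 R I) W) (c : R) : 0 <= c -> c < op_norm T ->
  exists x, c * rnorm x < rnorm (T x).
Proof.
move=> c0 cT; apply: contrapT => /forallNP H.
have : op_norm T <= c.
  by apply: op_norm_le => // x; rewrite leNgt; apply/negP; exact: H.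
by rewrite leNgt cT.
Qed.

Lemma rnormZr (V : normedModType R[i]) (t : R) (x : V) : 0 <= t ->
  rnorm (t%:C *: x) = t * rnorm x.
Proof. by move=> t0; rewrite rnormZ normc_def /= expr0n addr0 sqrtr_sqr ger0_norm. Qed.

(* Sokal's proof: one of x + z and x - z is mapped by F j to a vector of norm at
   least |F j z|, so a limit of such perturbations escapes every bound. *)
Lemma uniform_boundedness (J : Type) (F : J -> bop (ell2 R I) W) :
  (forall x, exists M, forall j, rnorm (F j x) <= M) ->
  exists M, forall j, op_norm (F j) <= M.
Proof.
move=> pb; apply: contrapT => /forallNP nM.
(* Norms grow like 20^n while perturbations shrink like 10^-n, so their products grow like 2^n and
   the perturbations still add up. Any factor below 1 could be attained; 3/4 is enough for the final
   count. *)
have hyp n : exists jz : J * ell2 R I, 20 ^+ n <= op_norm (F jz.1) /\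
    rnorm jz.2 = 10 ^- n /\ 3 / 4 * op_norm (F jz.1) * 10 ^- n <= rnorm (F jz.1 jz.2).
  have /existsNP [j /negP] := nM (20 ^+ n); rewrite -ltNge => jn.
  have N0 : 0 < op_norm (F j) by apply: lt_trans jn; rewrite exprn_gt0.
  have [||z zP] := @op_norm_near (F j) (3 / 4 * op_norm (F j)); [lra|lra|].
  have z0 : 0 < rnorm z.
    rewrite rnorm_gt0; apply/eqP => z0; move: zP.
    by rewrite z0 linear0 !rnorm0 mulr0 ltxx.
  have t0 : 0 < 10 ^- n / rnorm z by rewrite divr_gt0// invr_gt0 exprn_gt0.
  exists (j, (10 ^- n / rnorm z)%:C *: z); split; [exact: ltW|split].
    by rewrite /= rnormZr ?(ltW t0)// mulfVK// gt_eqF.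
  rewrite /= linearZ /= rnormZr ?(ltW t0)//.
  have -> : 3 / 4 * op_norm (F j) * 10 ^- n =
      10 ^- n / rnorm z * (3 / 4 * op_norm (F j) * rnorm z).
    by field; rewrite !gt_eqF// exprn_gt0.
  by rewrite ler_pM2l// ltW.
have [jz jzP] := boolp.choice hyp.
pose step n (x : ell2 R I) := if rnorm (F (jz n).1 (jz n).2) <= rnorm (F (jz n).1 (x + (jz n).2))
  then x + (jz n).2 else x - (jz n).2.
pose fix u n := if n is n'.+1 then step n' (u n') else 0.
have stepF n x : rnorm (F (jz n).1 (jz n).2) <= rnorm (F (jz n).1 (step n x)).
  rewrite /step; case: ifP => // /negbT; rewrite -ltNge => lt.
  have : 2 * rnorm (F (jz n).1 (jz n).2) <=
      rnorm (F (jz n).1 (x + (jz n).2)) + rnorm (F (jz n).1 (x - (jz n).2)).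
    rewrite -rnormZr// -linearZ /=.
    have -> : 2%:C *: (jz n).2 = (x + (jz n).2) - (x - (jz n).2).
      by rewrite opprB addrC addrA subrK rmorphMn/= scaler_nat mulr2n.
    rewrite linearB; apply: le_trans (rnormD _ _) _.
    by rewrite rnorm_opp.
  lra.
have stepu n : rnorm (u n.+1 - u n) = 10 ^- n.
  have [_ [zn _]] := jzP n; rewrite /= /step; case: ifP => _.
    by rewrite addrAC subrr add0r.
  by rewrite addrAC subrr add0r rnorm_opp.
have p10 n : 0 < 10 ^- n :> R by rewrite invr_gt0 exprn_gt0.
have e10 n : 10 ^- n.+1 = 10 ^- n / 10 :> R by rewrite exprS invfM mulrC.
(* The exact value of the geometric sum from [n] to [n + k - 1], in which form the induction
   closes. *)
have um n k : ell2_norm (u (n + k)%N - u n) <= 10 / 9 * (10 ^- n - 10 ^- (n + k)).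
  elim: k => [|k IH]; first by rewrite addn0 !subrr mulr0 -rnorm_ell2 rnorm0.
  rewrite addnS e10; have -> : u (n + k).+1 - u n = (u (n + k).+1 - u (n + k)%N) +
    (u (n + k)%N - u n) by rewrite addrA subrK.
  apply: le_trans (ell2_normD _ _) _.
  have := stepu (n + k)%N; rewrite rnorm_ell2 => ->.
  by have := p10 (n + k)%N; lra.
have b0 n : 0 < 10 / 9 * 10 ^- n :> R by rewrite mulr_gt0// divr_gt0.
have um' n m : (n <= m)%N -> ell2_norm (u m - u n) <= 10 / 9 * 10 ^- n.
  move=> nm; rewrite -(subnKC nm); apply: le_trans (um _ _) _.
  by rewrite ler_wpM2l ?divr_ge0// gerBl ltW.
have b10 (e : R) n : 0 < e -> exists2 m, (n <= m)%N & 10 / 9 * 10 ^- m < e.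
  move=> e0; pose m := (Num.truncn (2 / e)).+1.
  exists (n + m)%N; first exact: leq_addr.
  have m1 : 2 / e < m%:R by rewrite truncnS_gt.
  have m10 : m%:R <= 10 ^+ (n + m) :> R.
    rewrite -natrX ler_nat; apply: leq_trans (ltnW (ltn_expl m (isT : 1 < 10)%N)) _.
    by rewrite leq_exp2l// leq_addl.
  have : 2 / e < 10 ^+ (n + m) by apply: lt_le_trans m1 _.
  rewrite ltr_pdivrMr// -ltr_pdivrMl ?exprn_gt0// mulrC => H.
  by have := p10 (n + m)%N; lra.
have [x xP] := @ell2_complete R I u (fun n => 10 / 9 * 10 ^- n) b0
  b10 um'.
have [M MP] := pb x.
(* Perturbations after stage [n] amount to at most 2 (10/9) 10^-(n+1), that is 2/9 of 10^-n, the
   factor 2 coming from [ell2_complete]. What is left is 3/4 - 2/9 = 19/36, more than 1/2. *)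
have low n : 2 ^+ n / 2 <= M.
  have [Nn [zn Fn]] := jzP n.
  apply: le_trans (MP (jz n).1).
  have := xP n.+1; rewrite -rnorm_ell2 rnorm_distC e10 => xn.
  have A := le_trans Fn (stepF n (u n)).
  have B : rnorm (F (jz n).1 (step n (u n))) <= rnorm (F (jz n).1 x) +
      op_norm (F (jz n).1) * (2 * (10 / 9 * (10 ^- n / 10))).
    have -> : step n (u n) = x + (step n (u n) - x) by rewrite addrC subrK.
    rewrite linearD; apply: le_trans (rnormD _ _) _; rewrite lerD2l.
    by apply: le_trans (op_normP _ _) _; rewrite ler_wpM2l ?op_norm_ge0.
  have C : 20 ^+ n * 10 ^- n <= op_norm (F (jz n).1) * 10 ^- n.
    by rewrite ler_wpM2r// ltW.
  have D : 20 ^+ n * 10 ^- n = 2 ^+ n :> R.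
    rewrite -exprVn -exprMn; congr (_ ^+ _); lra.
  rewrite D in C; move: A B C.
  set N := op_norm _; set t := 10 ^- n; set r := 2 ^+ n.
  have := exprn_gt0 n (ltr0n R 2); rewrite -/r.
  nra.
pose m := (Num.truncn (2 * M)).+1.
have m1 : 2 * M < m%:R by rewrite truncnS_gt.
have m2 : m%:R <= 2 ^+ m :> R by rewrite -natrX ler_nat ltnW// ltn_expl.
by have := low m; lra.
Qed.

End UniformBoundedness.

(** * Block decomposition *)

#[local] Existing Instance summability.totally_filter.
Section Isometries.
Context {R : realType}.
Implicit Types I J : choiceType.

Lemma isometry_inner {I J} (U : bop (ell2 R I) (ell2 R J)) :
  (forall x, ell2_norm (U x) = ell2_norm x) ->
  forall x y, inner (U x) (U y) = inner x y.
Proof.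
by move=> UN x y; rewrite !innerE /polar -!linearZ -!linearD -!linearB !UN.
Qed.

(** An isometry preserves inner products, and [y = U (V y)]. *)
Lemma unitary_adjoint {I J} (U : bop (ell2 R I) (ell2 R J))
    (V : bop (ell2 R J) (ell2 R I)) :
  (forall x, ell2_norm (U x) = ell2_norm x) -> U *o V = id_bop ->
  is_adjoint U V.
Proof.
move=> UN UV x y; rewrite -(isometry_inner UN) -[U (V y)]/((U *o V) y).
by rewrite UV.
Qed.

Lemma ell2_norm_reindex {I J} (p : J -> I) (x : ell2 R I) (y : ell2 R J) :
  bijective p -> (forall j, y j = x (p j)) -> ell2_norm y = ell2_norm x.
Proof.
move=> [q pK qK] yx; rewrite /ell2_norm; congr (Num.sqrt (fine _)).
rewrite /sqsum (@reindex_esum R J I [set: J] [set: I] p).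
  by apply: eq_esum => j _; rewrite yx.
split => //; first by move=> j k _ _; exact: can_inj pK j k.
by move=> i _; exists (q i).
Qed.

Lemma sqsum_fibres {I J} (f : I * J -> R[i]) :
  (sqsum f = \esum_(i in [set: I]) sqsum (fun j => f (i, j)))%E.
Proof.
rewrite /sqsum (esum_esum _ (a := fun i j => (sqmod (f (i, j)))%:E)).
  apply: reindex_esum; split => //= [[? ?] [? ?] _ _ [-> ->]//|[i j] _].
  by exists (i, j).
by move=> *; rewrite lee_fin sqmod_ge0.
Qed.

Lemma diag_adjoint {I} (f : I -> R[i]) : linfty f ->
  is_adjoint (diag_op f) (diag_op (fun i => conjc (f i))).
Proof.
move=> fb; have fb' : linfty (fun i => conjc (f i)).
  by case: fb => M fM; exists M => i; rewrite normcJ.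
move=> x y; apply: inner_eq; have := has_sum_inner (y := diag_op (fun i => conjc (f i)) y) (x := x).
congr has_sum; apply/funext => i; rewrite !diag_opE// rmorphM /= conjcK.
by rewrite mulrCA mulrA.
Qed.

Lemma linfty_op_norm {I} (f : I -> R[i]) (M : R) : 0 <= M ->
  (forall i, `|f i| <= M%:C) -> op_norm (diag_op f) <= M.
Proof.
move=> M0 fM; apply: op_norm_le => // x.
have fb : linfty f by exists M.
rewrite !rnorm_ell2 -(@ler_pXn2r _ 2)// ?nnegrE ?mulr_ge0 ?ell2_norm_ge0//.
rewrite exprMn -lee_fin ell2_norm_sqr EFinM ell2_norm_sqr -sqsumZ ?sqr_ge0//.
  apply: le_esum => i _; rewrite diag_opE// sqmodM -EFinM lee_fin.
  rewrite ler_wpM2r ?sqmod_ge0//.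
  have := fM i; rewrite normc_def lecR => H.
  by rewrite -[leLHS]sqr_sqrtr ?sqmod_ge0// ler_pXn2r ?nnegrE ?sqrtr_ge0.
by move=> i; rewrite lee_fin sqmod_ge0.
Qed.

End Isometries.

Section Blocks.
Context {R : realType} {X G : choiceType}.
Implicit Types (w : X).

(* ell^2(X * G) is the orthogonal sum of copies of ell^2(G) indexed by X; on the
   crossed product the block at w is the limit operator at w. *)
Definition pr w : bop (ell2 R (X * G)%type) (ell2 R G) :=
  mk_bop (fun xi h => xi (w, h)).

Lemma prE w xi h : pr w xi h = xi (w, h).
Proof. by rewrite /pr (@mk_bop_reindexE R _ _ (fun h => (w, h)))// => ? ? []. Qed.

Definition emb w : bop (ell2 R G) (ell2 R (X * G)%type) :=
  mk_bop (fun xi p => if p.1 == w then xi p.2 else 0).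

Lemma embE w xi p : emb w xi p = if p.1 == w then xi p.2 else 0.
Proof.
rewrite /emb (@mk_bopE _ _ _ _ 1)// => [k x y|x].
  by apply/funext => q; rewrite !fctE; case: ifP => // _; rewrite scaler0 addr0.
rewrite mul1e sqsum_fibres.
rewrite (_ : (\esum_(i in [set: X]) _)%E = (\esum_(i in [set w]) sqsum x)%E).
  by rewrite esum_set1// sqsum_ge0.
rewrite [RHS]esum_mkcond; apply: eq_esum => i _; rewrite /sqsum.
case: (eqVneq i w) => [->|iw]; first by rewrite mem_set//=; under eq_esum do rewrite eqxx.
rewrite memNset/=; last exact/eqP.
by rewrite esum1// => j _; rewrite /sqmod /= expr0n addr0.
Qed.

Lemma pr_emb w : pr w *o emb w = id_bop.
Proof. by apply/bop_ext => x; apply/ell2_ext => h; rewrite /= prE embE eqxx. Qed.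

Lemma op_norm_pr w : op_norm (pr w) <= 1.
Proof.
apply: op_norm_le => // x; rewrite mul1r !rnorm_ell2.
rewrite -(@ler_pXn2r _ 2)// ?nnegrE ?ell2_norm_ge0// -lee_fin !ell2_norm_sqr.
rewrite [leRHS]sqsum_fibres; apply: esum_ge; exists [set w].
  by split => //; exact: finite_set1.
rewrite fsbig_set1 /sqsum; apply: le_esum => h _; by rewrite prE.
Qed.

Lemma op_norm_emb w : op_norm (emb w) <= 1.
Proof.
apply: op_norm_le => // x; rewrite mul1r !rnorm_ell2.
rewrite -(@ler_pXn2r _ 2)// ?nnegrE ?ell2_norm_ge0// -lee_fin !ell2_norm_sqr.
rewrite sqsum_fibres.
rewrite (_ : (\esum_(i in [set: X]) _)%E = (\esum_(i in [set w]) sqsum x)%E).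
  by rewrite esum_set1// sqsum_ge0.
rewrite [RHS]esum_mkcond; apply: eq_esum => i _; rewrite /sqsum.
case: (eqVneq i w) => [->|iw].
  by rewrite mem_set//=; apply: eq_esum => j _; rewrite embE /= eqxx.
rewrite memNset/=; last exact/eqP.
by rewrite esum1// => j _; rewrite embE /= (negPf iw) /sqmod /= expr0n addr0.
Qed.

Definition blk w (T : B2 R (X * G)%type) : B2 R G := pr w *o T *o emb w.

(** One-sided form: the component of [T x] at [w] depends only on that of [x]. This already makes
    [blk w] multiplicative on products with such an operator on the left. *)
Definition block_diag (T : B2 R (X * G)%type) :=
  forall w, pr w *o T = blk w T *o pr w.

Lemma blk_comp w S T : block_diag S -> blk w (S *o T) = blk w S *o blk w T.
Proof. by move=> bS; rewrite [LHS]/blk comp_bopA bS [in RHS]/blk -!comp_bopA. Qed.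

Lemma blkB w S T : blk w (S - T) = blk w S - blk w T.
Proof. by rewrite /blk comp_bopBr comp_bopBl. Qed.

Lemma blkD w S T : blk w (S + T) = blk w S + blk w T.
Proof. by rewrite /blk comp_bopDr comp_bopDl. Qed.

Lemma blk_id w : blk w id_bop = id_bop.
Proof. by rewrite /blk comp_idr pr_emb. Qed.

Lemma op_norm_blk w T : op_norm (blk w T) <= op_norm T.
Proof.
apply: le_trans (op_norm_comp _ _) _.
apply: (@le_trans _ _ (op_norm T * 1)); last by rewrite mulr1.
apply: ler_pM; rewrite ?op_norm_ge0 ?op_norm_emb//.
apply: le_trans (op_norm_comp _ _) _.
by rewrite -[leRHS]mul1r ler_wpM2r ?op_norm_ge0 ?op_norm_pr.
Qed.

Lemma bop_pr_ext (S T : B2 R (X * G)%type) :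
  (forall w, pr w *o S = pr w *o T) -> S = T.
Proof.
move=> ST; apply/bop_ext => x; apply/ell2_ext => -[w h].
by rewrite -!prE -![pr w (_ x)]/((pr w *o _) x) ST.
Qed.

(** The direct sum of the operators [F w]. It has this meaning for uniformly bounded families, which
    is where the supremum in condition (3) enters. *)
Definition bdiag (F : X -> B2 R G) : B2 R (X * G)%type :=
  mk_bop (fun xi p => F p.1 (mk_ell2 (fun h => xi (p.1, h))) p.2).

Lemma bdiagE (F : X -> B2 R G) (M : R) : (forall w, op_norm (F w) <= M) ->
  forall w, pr w *o bdiag F = F w *o pr w.
Proof.
move=> FM.
have prM (x : ell2 R (X * G)%type) w : mk_ell2 (fun h => x (w, h)) = pr w x.
  have E : (fun h => x (w, h)) = ell2_fun (pr w x).
    by apply/funext => h; rewrite prE.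
  by apply/val_inj; rewrite /mk_ell2 E insubdK//; exact: ell2P.
have bE xi p : bdiag F xi p = F p.1 (pr p.1 xi) p.2.
  rewrite /bdiag (@mk_bopE _ _ _ _ (M ^+ 2)) ?prM// => [k x y|x].
    apply/funext => q; rewrite !fctE.
    have := prM (k *: x + y) q.1 => /= ->.
    by rewrite !prM linearP linearP.
  rewrite !sqsum_fibres -sqsumZ ?sqr_ge0//; last by move=> i; exact: sqsum_ge0.
  apply: le_esum => w _ /=.
  rewrite prM; have -> : sqsum (fun h => x (w, h)) = sqsum (pr w x).
    by congr sqsum; apply/funext => h; rewrite prE.
  have -> : sqsum (fun h => F w (pr w x) h) = sqsum (F w (pr w x)) by [].
  rewrite -!ell2_norm_sqr -EFinM lee_fin -exprMn ler_pXn2r ?nnegrE ?ell2_norm_ge0//.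
    rewrite -!rnorm_ell2; apply: le_trans (op_normP _ _) _.
    by rewrite ler_wpM2r ?rnorm_ge0.
  by rewrite mulr_ge0 ?ell2_norm_ge0// (le_trans (op_norm_ge0 _) (FM w)).
move=> w; apply/bop_ext => x; apply/ell2_ext => h.
by rewrite /= prE bE.
Qed.

End Blocks.

(** * The crossed product *)

#[local] Existing Instance summability.totally_filter.
Lemma fsum_seq {I : choiceType} {V : zmodType} (F : I -> V) (s : seq I) :
  uniq s -> (forall i, i \notin s -> F i = 0) ->
  \sum_(i \in [set: I]) F i = \sum_(i <- s) F i.
Proof.
move=> us Fs; rewrite (fsbig_seq _ _ us).
by rewrite (fsbig_widen [set` s] [set: I])// => i [_ /negP si]; exact: Fs.
Qed.

(** * Continuous functions in terms of real norms *)

Section Continuity.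
Context {R : realType} {X : topologicalType}.

Lemma continuous_rnorm (V : normedModType R[i]) (f : X -> V) : continuous f <->
  forall x (e : R), 0 < e -> nbhs x [set y | rnorm (f x - f y) < e].
Proof.
split => [cf x e e0|H x P /near_rnorm [e e0 eP]].
  apply: (cf x [set z | rnorm (f x - z) < e]).
  by apply/near_rnorm; exists e.
by apply: (filterS _ (H x e e0)) => y; exact: eP.
Qed.

Lemma continuous_approx (V : normedModType R[i]) (f : X -> V) :
  (forall e : R, 0 < e -> exists2 g : X -> V, continuous g &
     forall x, rnorm (f x - g x) < e) -> continuous f.
Proof.
move=> H; apply/continuous_rnorm => x e e0.
have e30 : 0 < e / 3 by rewrite divr_gt0.
have [g /continuous_rnorm cg fg] := H _ e30.
apply: (filterS _ (cg x _ e30)) => y /= gxy.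
have -> : f x - f y = (f x - g x) + (g x - g y) + (g y - f y).
  by rewrite (addrA (f x - g x)) subrK addrA subrK.
apply: le_lt_trans (rnormD _ _) _.
have := rnormD (f x - g x) (g x - g y).
by have := fg x; have := fg y; rewrite (rnorm_distC (f y)); lra.
Qed.

Lemma continuous_conj (f : X -> R[i]) : continuous f ->
  continuous (fun x => conjc (f x)).
Proof.
move=> /continuous_rnorm cf; apply/continuous_rnorm => x e e0.
apply: (filterS _ (cf x e e0)) => y /=.
by rewrite -rmorphB /rnorm normcJ.
Qed.

Lemma compact_rnorm_bounded (B : set X) (f : X -> R[i]) : compact B ->
  {within B, continuous f} -> exists M, forall x, B x -> rnorm (f x : R[i]) <= M.
Proof.
move=> Bc cf.
have cr : {within B, continuous (fun x => rnorm (f x : R[i]) : R^o)}.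
  move=> x; apply/cvgrPdist_lt => e e0.
  have cfx : nbhs (x : subspace B) [set y | rnorm (f x - f y : R[i]) < e].
    apply: (cf x [set z | rnorm (f x - z : R[i]) < e]).
    by apply/near_rnorm; exists e.
  apply: (filterS _ cfx) => y /= fxy.
  apply: le_lt_trans fxy; rewrite ler_norml; apply/andP; split.
    have := rnormD (f y - f x) (f x); rewrite subrK (rnorm_distC (f x)); lra.
  by have := rnormD (f x - f y) (f y); rewrite subrK; lra.
have [M [_ MP]] := compact_bounded (continuous_compact cr Bc).
exists (M + 1) => x Bx; have := MP (M + 1); rewrite ltrDl ltr01 => /(_ isT).
move=> /(_ (rnorm (f x : R[i]))) H.
have {}H : `|rnorm (f x : R[i])| <= M + 1 by apply: H; exists x.
exact: le_trans (ler_norm _) H.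
Qed.

Lemma continuous_linfty (f : X -> R[i]) : compact [set: X] -> continuous f ->
  linfty f.
Proof.
move=> Xc /(@continuous_subspaceT _ _ [set: X]) /(compact_rnorm_bounded Xc) [M fM].
by exists M => x; rewrite (rnormE (f x : R[i])) lecR fM.
Qed.

End Continuity.

(** * Monomials of the crossed product *)

Section Monomials.
Context {R : realType} {G : groupType} {X : topologicalType}.
Variable act : homeo_action G X.
Implicit Types (f : X -> R[i]) (g h : G) (w x : X).

(** The regular covariant representation multiplies at [(x, h)] by the translate of [f] by h^-1,
    evaluated at x, that is by f(hx). On the block at [w] this is [Mult act w f]. *)
Definition hfun f : X * G -> R[i] := fun p => f (act p.2 p.1).

Lemma linfty_hfun f : linfty f -> linfty (hfun f).
Proof. by case=> M fM; exists M => p; exact: fM. Qed.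

Lemma linfty_translate g f : linfty f -> linfty (translate act g f).
Proof. by case=> M fM; exists M => p; exact: fM. Qed.

Lemma linfty_ge0 {I : choiceType} (f : I -> R[i]) : linfty f ->
  exists2 M : R, 0 <= M & forall i, `|f i| <= M%:C.
Proof.
move=> [M fM]; exists `|M| => // i; apply: le_trans (fM i) _.
by rewrite lecR ler_norm.
Qed.

Lemma coef_op_diag f : linfty f ->
  coef_op (@diag_op R X) (translate act) f = diag_op (hfun f).
Proof.
move=> fb; have [M M0 fM] := linfty_ge0 fb.
apply/bop_ext => xi; apply/ell2_ext => p.
rewrite (@coef_opE R G X _ (@diag_op R X) (translate act) f M); last first.
  by move=> h; apply: linfty_op_norm => // i; exact: fM.
rewrite diag_opE; last exact: linfty_translate.
rewrite diag_opE; last exact: linfty_hfun.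
rewrite /translate /hfun invgK; congr (_ * _).
have slice : (fun i => xi (i, p.2)) \in @sq_summable R X.
  apply/asboolP; apply: (@le_lt_trans _ _ (sqsum xi)); last first.
    by rewrite -ell2_norm_sqr ltry.
  rewrite [leRHS]sqsum_slices; apply: esum_ge; exists [set p.2].
    by split => //; exact: finite_set1.
  by rewrite fsbig_set1.
rewrite /mk_ell2 /=.
by rewrite insubdK//=; case: (p).
Qed.

Definition mon f g : B2 R (X * G)%type := diag_op (hfun f) *o shift_op g.

Lemma monE f g xi p : linfty f ->
  mon f g xi p = f (act p.2 p.1) * xi (p.1, (g^-1 * p.2)%g).
Proof. by move=> fb; rewrite /= diag_opE ?shift_opE//; exact: linfty_hfun. Qed.

Lemma linftyD {I : choiceType} (f f' : I -> R[i]) :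
  linfty f -> linfty f' -> linfty (f + f').
Proof.
move=> [M fM] [N fN]; exists (M + N) => i.
by rewrite rmorphD; apply: le_trans (ler_normD _ _) _; rewrite lerD.
Qed.

Lemma linftyM {I : choiceType} (f f' : I -> R[i]) :
  linfty f -> linfty f' -> linfty (fun i => f i * f' i).
Proof.
move=> fb fb'; have [M M0 fM] := linfty_ge0 fb; have [N N0 fN] := linfty_ge0 fb'.
by exists (M * N) => i; rewrite normrM rmorphM /=; apply: ler_pM.
Qed.

Lemma linfty0 {I : choiceType} : linfty (0 : I -> R[i]).
Proof. by exists 0 => i; rewrite normr0. Qed.

Lemma monD f f' g : linfty f -> linfty f' -> mon (f + f') g = mon f g + mon f' g.
Proof.
move=> fb fb'; apply/bop_ext => xi; apply/ell2_ext => p.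
rewrite monE; last exact: linftyD.
rewrite mulrDl -(monE _ xi p fb) -(monE _ xi p fb') //.
Qed.

Lemma mon0 g : mon 0 g = 0.
Proof.
apply/bop_ext => xi; apply/ell2_ext => p.
by rewrite monE ?mul0r//; exact: linfty0.
Qed.

Lemma mon_mul f g f' g' : linfty f -> linfty f' ->
  mon f g *o mon f' g' = mon (fun x => f x * translate act g f' x) (g * g')%g.
Proof.
move=> fb fb'; apply/bop_ext => xi; apply/ell2_ext => p.
rewrite monE; last by apply: linftyM => //; exact: linfty_translate.
rewrite [LHS](monE _ _ _ fb) monE// mulrA /translate -actM invgM mulgA.
by [].
Qed.

Lemma shift_adjoint {I : choiceType} g :
  is_adjoint (@shift_op R G I g) (shift_op g^-1%g).
Proof.
apply: unitary_adjoint => [x|].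
  apply: (@ell2_norm_reindex _ _ _ (fun p : I * G => (p.1, (g^-1 * p.2)%g))); last first.
    by move=> p; rewrite shift_opE.
  by exists (fun p : I * G => (p.1, (g * p.2)%g)) => -[i h] /=; rewrite ?mulVKg ?mulKg.
by apply/bop_ext => x; apply/ell2_ext => -[i h]; rewrite /= !shift_opE/= invgK mulVKg.
Qed.

(** The adjoint of f g is g^-1 times the conjugate of f; covariance moves the coefficient back to
    the left, translated by g^-1. *)
Lemma mon_adjoint f g : linfty f -> is_adjoint (mon f g)
  (mon (translate act g^-1%g (fun x => conjc (f x))) g^-1%g).
Proof.
move=> fb; have fb' : linfty (fun x => conjc (f x)).
  by case: fb => M fM; exists M => i; rewrite normcJ.
have -> : mon (translate act g^-1%g (fun x => conjc (f x))) g^-1%g =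
    shift_op g^-1%g *o diag_op (fun p => conjc (hfun f p)).
  apply/bop_ext => xi; apply/ell2_ext => p.
  rewrite monE; last exact: linfty_translate.
  rewrite [RHS]shift_opE diag_opE; last exact: (@linfty_hfun (fun x => conjc (f x))).
  by rewrite /translate /hfun /= invgK actM.
apply: is_adjoint_comp; last exact: shift_adjoint.
exact/diag_adjoint/linfty_hfun.
Qed.

Lemma pr_mon w f g : linfty f ->
  pr w *o mon f g = Mult act w f *o Ltrans g *o pr w.
Proof.
move=> fb; apply/bop_ext => xi; apply/ell2_ext => h.
rewrite [LHS]prE monE//= diag_opE ?LtransE ?prE//.
by case: fb => M fM; exists M => i; exact: fM.
Qed.

Lemma blk_mon w f g : linfty f -> blk w (mon f g) = Mult act w f *o Ltrans g.
Proof. by move=> fb; rewrite /blk pr_mon// -(comp_bopA _ (pr w)) pr_emb comp_idr. Qed.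

(** Finite sums of monomials in a form suited to induction. There is no constructor for scalars:
    they are absorbed into the coefficients. *)
Inductive mon_span (E : set (X -> R[i])) : B2 R (X * G)%type -> Prop :=
| MonSpan0 : mon_span E 0
| MonSpanD f g T : E f -> mon_span E T -> mon_span E (mon f g + T).

Lemma mon_spanD E S T : mon_span E S -> mon_span E T -> mon_span E (S + T).
Proof.
elim=> [|f g S' fE _ IH] ET; first by rewrite add0r.
by rewrite -addrA; apply: MonSpanD => //; exact: IH.
Qed.

Lemma mon_span1 (E : set (X -> R[i])) f g : E f -> mon_span E (mon f g).
Proof. by move=> Ef; rewrite -[mon f g]addr0; apply: MonSpanD => //; left. Qed.

Lemma regular_seq (E : set (X -> R[i])) (a : G -> X -> R[i]) (s : seq G) :
  E `<=` linfty (I := X) -> (forall g, E (a g)) -> uniq s -> (forall g, g \notin s -> a g = 0) ->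
  CX_regular act a = \sum_(g <- s) mon (a g) g.
Proof.
move=> Eb aE us as0; rewrite /CX_regular /regular (fsum_seq us).
  by apply: eq_bigr => g _; rewrite coef_op_diag//; exact: Eb.
move=> g /as0 ->; rewrite coef_op_diag; last exact: linfty0.
exact: mon0.
Qed.

Lemma Cc_seq {E : zmodType} (A : set E) (a : G -> E) : Cc A a ->
  exists2 s : seq G, uniq s & forall g, g \notin s -> a g = 0.
Proof.
move=> [_ fa]; exists (fset_set [set g | a g <> 0]); first exact: fset_uniq.
by move=> g; rewrite in_fset_set// notin_setE /= => /contrapT.
Qed.

Lemma regular_mon_span (E : set (X -> R[i])) : E `<=` linfty (I := X) -> E 0 ->
  (forall f f', E f -> E f' -> E (f + f')) ->
  CX_regular act @` Cc E = mon_span E.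
Proof.
move=> Eb E0 ED; apply/seteqP; split => [_ [a aE <-]|T].
  have [s us as0] := Cc_seq aE; case: aE => aE _.
  rewrite (regular_seq Eb aE us as0).
  elim: (s) => [|g s' IH]; first by rewrite big_nil; left.
  by rewrite big_cons; apply: MonSpanD.
elim=> [|f g _ fE _ [a aE <-]].
  have E0' (g : G) : E 0 by [].
  exists 0; last by rewrite (@regular_seq E _ [::])// big_nil.
  split; first by move=> g; exact: E0.
  rewrite (_ : [set g | _] = set0); first exact: finite_set0.
  by apply/seteqP; split => // g /=.
have [s us as0] := Cc_seq aE; case: aE => aE fa.
pose a' k := a k + (if k == g then f else 0).
have a'E k : E (a' k) by apply: ED => //; case: ifP.
(* [g] may already occur in [s], in which case the new monomial only changes a coefficient. *)
pose s' := undup (g :: s).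
have us' : uniq s' by exact: undup_uniq.
have as' k : k \notin s' -> a k = 0.
  by rewrite mem_undup inE negb_or => /andP[_]; exact: as0.
have as'' k : k \notin s' -> a' k = 0.
  move=> ks; rewrite /a' as'// add0r.
  by move: ks; rewrite mem_undup inE negb_or => /andP[/negPf ->].
exists a'.
  split => //; apply: sub_finite_set (finite_seq s') => k /= ak.
  by apply: contrapT => /negP /as''.
rewrite (regular_seq Eb aE us' as') (regular_seq Eb a'E us' as'').
have -> : \sum_(k <- s') mon (a' k) k =
    \sum_(k <- s') (mon (a k) k + mon (if k == g then f else 0) k).
  by apply: eq_bigr => k _; rewrite monD//; [exact: Eb|case: ifP => _; exact: Eb].
rewrite big_split addrC /=; congr (_ + _).
rewrite (bigD1_seq g) ?mem_undup ?mem_head//= eqxx big1 ?addr0// => k /negPf ->.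
exact: mon0.
Qed.

End Monomials.

(* Elements of the crossed product and their blocks *)
#[local] Existing Instance summability.totally_filter.
Section CrossedProduct.
Context {R : realType} {G : groupType} {X : topologicalType}.
Variable act : homeo_action G X.
Hypothesis X_compact : compact [set: X].
Implicit Types (f : X -> R[i]) (g h : G) (w x : X) (S T : B2 R (X * G)%type).

Local Notation CXR := (CX : set (X -> R[i])).
Local Notation A := (CX_crossed act : set (B2 R (X * G)%type)).

Lemma CX_linfty : CXR `<=` linfty (I := X).
Proof. by move=> f; exact: continuous_linfty. Qed.

Lemma CX_0 : CXR 0.
Proof. by move=> x; exact: cvg_cst. Qed.

Lemma CX_D f f' : CXR f -> CXR f' -> CXR (f + f').
Proof. by move=> cf cf' x; apply: cvgD; [exact: cf|exact: cf']. Qed.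

Lemma CX_M f f' : CXR f -> CXR f' -> CXR (fun x => f x * f' x).
Proof. by move=> cf cf' x; apply: cvgM; [exact: cf|exact: cf']. Qed.

Lemma CX_translate g f : CXR f -> CXR (translate act g f).
Proof.
move=> cf x; apply: (@continuous_comp _ _ _ (act g^-1%g) f); last exact: cf.
exact: act_continuous.
Qed.

Lemma CX_crossedE : A = closure (mon_span act CXR).
Proof.
rewrite /CX_crossed /crossed; congr closure.
exact: (regular_mon_span act CX_linfty CX_0 CX_D).
Qed.

(** The density argument by which identities on the crossed product are reduced to sums of
    monomials; [crossed_lip] does the same for membership in a closed set. *)
Lemma crossed_lip_eq (W : normedModType R[i]) (F F' : B2 R (X * G)%type -> W) T :
  lip F -> lip F' -> (forall T, mon_span act CXR T -> F T = F' T) -> A T -> F T = F' T.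
Proof. by rewrite CX_crossedE => FL F'L FF; exact: closure_lip_eq. Qed.

Lemma crossed_lip (W : normedModType R[i]) (F : B2 R (X * G)%type -> W) B T :
  lip F -> (forall T, mon_span act CXR T -> closure B (F T)) -> A T -> closure B (F T).
Proof. by rewrite CX_crossedE => FL; exact: closure_lip. Qed.

Lemma mon_span_M S T : mon_span act CXR S -> mon_span act CXR T ->
  mon_span act CXR (S *o T).
Proof.
move=> ES ET; elim: ES => [|f g S' cf _ IH]; first by rewrite comp_bop0l; left.
rewrite comp_bopDl; apply: mon_spanD IH.
elim: ET => [|f' g' T' cf' _ IH']; first by rewrite comp_bop0r; left.
rewrite comp_bopDr mon_mul; [|exact: CX_linfty|exact: CX_linfty].
apply: MonSpanD; last exact: IH'.
exact: (@CX_M _ _ cf (@CX_translate g _ cf')).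
Qed.

(** Each monomial has an explicit adjoint. Adjoints on this dense part are enough for the
    parametrix, which tolerates a small error. *)
Lemma mon_span_adj S : mon_span act CXR S ->
  exists2 S', mon_span act CXR S' & is_adjoint S S'.
Proof.
elim=> [|f g S' cf _ [T' ET' ST']].
  by exists 0; [left|exact: is_adjoint0].
exists (mon act (translate act g^-1%g (fun x => conjc (f x))) g^-1%g + T').
  apply: MonSpanD; last exact: ET'.
  exact: (@CX_translate g^-1%g _ (continuous_conj cf)).
by apply: is_adjointD => //; apply: mon_adjoint; exact: CX_linfty.
Qed.

Lemma crossed_span S : mon_span act CXR S -> A S.
Proof. by rewrite CX_crossedE; exact: subset_closure. Qed.

Lemma crossed_M S T : A S -> A T -> A (S *o T).
Proof.
move=> AS AT; rewrite CX_crossedE.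
apply: (crossed_lip (F := fun S => S *o T)) AS; first exact: lip_compr.
move=> S' ES'; apply: (crossed_lip (F := fun T => S' *o T)) AT.
  exact: lip_compl.
by move=> T' ET'; apply/subset_closure/mon_span_M.
Qed.

Lemma mon_spanZ k S : mon_span act CXR S -> mon_span act CXR (k *: S).
Proof.
elim=> [|f g S' cf _ IH]; first by rewrite scaler0; left.
have cf' : CXR (fun x => k * f x) by apply: (@CX_M (fun=> k) f _ cf) => x; exact: cvg_cst.
rewrite scalerDr; have -> : k *: mon act f g = mon act (fun x => k * f x) g.
  apply/bop_ext => xi; apply/ell2_ext => p.
  rewrite monE; last exact: CX_linfty.
  by rewrite -mulrA -(@monE _ _ _ act f g xi p (CX_linfty cf)) bopZE ell2ZE.
exact: MonSpanD.
Qed.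

Lemma crossed_B S T : A S -> A T -> A (S - T).
Proof.
move=> AS AT; rewrite CX_crossedE.
apply: (crossed_lip (F := fun S => S - T)) AS; first exact: lip_sub.
move=> S' ES'; apply: (crossed_lip (F := fun T => S' - T)) AT.
  exact: lip_subr.
move=> T' ET'; apply/subset_closure/mon_spanD => //.
by rewrite -scaleN1r; exact: mon_spanZ.
Qed.

Lemma crossed_Z k S : A S -> A (k *: S).
Proof.
move=> AS; rewrite CX_crossedE.
apply: (crossed_lip (F := fun S => k *: S)) AS; first exact: lip_scale.
by move=> S' ES'; apply/subset_closure/mon_spanZ.
Qed.

Lemma crossed_id : A id_bop.
Proof.
have -> : id_bop = mon act (fun=> 1 : R[i]) 1%g.
  apply/bop_ext => xi; apply/ell2_ext => -[x h].
  rewrite monE ?mul1r /= ?invg1 ?mul1g//.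
  by exists 1 => i; rewrite normr1.
by apply/crossed_span/mon_span1 => x; exact: cvg_cst.
Qed.

Lemma crossed_D S T : A S -> A T -> A (S + T).
Proof.
move=> AS AT; rewrite -[S + T]/(S + T) -[T]opprK; apply: crossed_B => //.
by rewrite -scaleN1r; exact: crossed_Z.
Qed.

Lemma lip_blk w : lip (@blk R X G w).
Proof. exact: lip_comp. Qed.

Lemma crossed_block T : A T -> block_diag T.
Proof.
move=> AT w.
have -> : blk w T *o pr w = pr w *o T *o (emb w *o pr w).
  by rewrite /blk -!comp_bopA.
apply: (crossed_lip_eq (F := fun T => pr w *o T)
    (F' := fun T => pr w *o T *o (emb w *o pr w))) AT.
- exact: lip_compl.
- exact: lip_comp.
- move=> S; elim=> [|f g S' cf _ IH]; first by rewrite comp_bop0r comp_bop0l.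
  rewrite comp_bopDr comp_bopDl -IH; congr (_ + _).
  rewrite pr_mon; last exact: CX_linfty.
  by rewrite comp_bopA -(comp_bopA _ (pr w)) pr_emb comp_idr.
Qed.

Lemma limit_opE w T : A T -> limit_op act w T = blk w T.
Proof.
move=> AT; apply: ext_limE; [exact: lip_blk| |exact: AT].
move=> a Ca; have [s us as0] := Cc_seq Ca; case: Ca => aE _.
rewrite (regular_seq act CX_linfty aE us as0) (fsum_seq us) => [|g /as0 ->].
  rewrite /blk comp_bop_sumr comp_bop_suml; apply: eq_bigr => g _.
  by rewrite -(blk_mon act w g (CX_linfty (aE g))).
rewrite -blk_mon; last exact: linfty0.
by rewrite mon0 /blk comp_bop0r comp_bop0l.
Qed.

Lemma blk_roe w T : A T -> uniform_roe (blk w T).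
Proof.
move=> AT; apply: (crossed_lip (F := blk w)) AT; first exact: lip_blk.
move=> S ES; apply: subset_closure => B [[B0 BD BM BA] Bgen].
elim: ES => [|f g S' cf _ IH]; first by rewrite /blk comp_bop0r comp_bop0l.
rewrite blkD -[blk w (mon _ _ _)]scale1r; apply: (BD) => //.
rewrite blk_mon; last exact: CX_linfty.
apply: BM; apply: Bgen; [right|left; by exists g].
exists (fun h => f (act h w)) => //.
by have [M fM] := CX_linfty cf; exists M => i; exact: fM.
Qed.

Lemma Rtrans_mul g : Rtrans g^-1%g *o Rtrans g = id_bop :> B2 R G.
Proof.
apply/bop_ext => x; apply/ell2_ext => h.
by rewrite /= !RtransE invgK mulgK.
Qed.

Lemma Rtrans_norm g (x : ell2 R G) : ell2_norm (Rtrans g x) = ell2_norm x.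
Proof.
apply: (@ell2_norm_reindex _ _ _ (fun h => h * g^-1)%g); last first.
  by move=> h; rewrite RtransE.
by exists (fun h => h * g)%g => h; rewrite ?mulgK ?mulgVK.
Qed.

Lemma Rtrans_adj g : adj (Rtrans g) = Rtrans g^-1%g :> B2 R G.
Proof.
apply/adjE/unitary_adjoint; first exact: Rtrans_norm.
by have := Rtrans_mul g^-1%g; rewrite invgK.
Qed.

(** Right translations commute with left ones, and conjugation by them moves the base point of a
    multiplication operator from [w] to [g w]. Hence the identity holds on monomials. *)
Lemma blk_act g w T : A T ->
  blk (act g w) T = adj (Rtrans g) *o blk w T *o Rtrans g.
Proof.
move=> AT; rewrite Rtrans_adj.
apply: (crossed_lip_eq (F := blk (act g w))
  (F' := fun T => Rtrans g^-1%g *o blk w T *o Rtrans g)) AT.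
- exact: lip_blk.
- apply: eq_lip (lip_comp (Rtrans g^-1%g *o pr w) (emb w *o Rtrans g)) => Q.
  by rewrite /blk -!comp_bopA.
- move=> S; elim=> [|f k S' cf _ IH].
    by rewrite /blk !(comp_bop0r, comp_bop0l).
  rewrite !blkD comp_bopDr comp_bopDl IH; congr (_ + _).
  rewrite !blk_mon; [|exact: CX_linfty|exact: CX_linfty].
  apply/bop_ext => x; apply/ell2_ext => h /=.
  have [M fM] := CX_linfty cf.
  rewrite RtransE !diag_opE ?LtransE ?RtransE ?invgK; last 2 first.
    by exists M => i; exact: fM.
    by exists M => i; exact: fM.
  by rewrite actM mulgA mulgK.
Qed.

(** Replacing [T] by a sum of monomials and [eta] by a truncation costs an error uniform in [w].
    What remains is a finite combination of functions w |-> f(hw), and a uniform limit of continuous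
    functions is continuous. *)
Lemma blk_wot T (xi eta : ell2 R G) : A T ->
  continuous (fun w => inner (blk w T xi) eta).
Proof.
move=> AT; apply: continuous_approx => e e0.
have N0 : 0 < ell2_norm xi + 1 by rewrite ltr_wpDl ?ell2_norm_ge0.
have M0 : 0 < ell2_norm eta + 1 by rewrite ltr_wpDl ?ell2_norm_ge0.
have := AT; rewrite CX_crossedE => /closure_rnorm /(_ (e / 2 / ((ell2_norm xi + 1) * (ell2_norm eta + 1)))).
case=> [|S ES TS]; first by rewrite !divr_gt0 ?mulr_gt0.
have S0 : 0 < (op_norm S + 1) * (ell2_norm xi + 1).
  by rewrite mulr_gt0// ltr_wpDl ?op_norm_ge0.
have [s us st] := trunc_approx eta (divr_gt0 (divr_gt0 e0 (ltr0n R 2)) S0).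
exists (fun w => inner (blk w S xi) (trunc s eta)).
  have H h : continuous (fun w => blk w S xi h : R[i]).
    elim: ES => [|f g S' cf _ IH].
      have -> : (fun w => blk w (0 : B2 R (X * G)%type) xi h) = (fun=> 0).
        by apply/funext => w; rewrite /blk comp_bop0r comp_bop0l.
      by move=> w; exact: cvg_cst.
    have -> : (fun w => blk w (mon act f g + S') xi h) =
        (fun w => f (act h w) * xi (g^-1 * h)%g + blk w S' xi h).
      apply/funext => w; rewrite blkD blk_mon; last exact: CX_linfty.
      rewrite bopDE ell2DE; congr (_ + _).
      rewrite -[(Mult _ _ _ *o _) _]/(Mult act w f (Ltrans g xi)) /Mult diag_opE.
        by rewrite LtransE.
      by have [M fM] := CX_linfty cf; exists M => i; exact: fM.
    apply: (@CX_D (fun w => f (act h w) * xi (g^-1 * h)%g)); last exact: IH.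
    apply: (@CX_M (fun w => f (act h w)) (fun=> xi (g^-1 * h)%g)) => w; last exact: cvg_cst.
    by apply: (@continuous_comp _ _ _ (act h) f); [exact: act_continuous|exact: cf].
  have -> : (fun w => inner (blk w S xi) (trunc s eta)) =
      (fun w => \sum_(h <- s) conjc (eta h) * blk w S xi h).
    apply/funext => w; rewrite /trunc inner_sumr; apply: eq_bigr => h _.
    by rewrite innerZr inner_delta.
  elim: (s) => [|h s' IH].
    under eq_fun do rewrite big_nil.
    by move=> w; exact: cvg_cst.
  under eq_fun do rewrite big_cons.
  apply: (@CX_D (fun w => conjc (eta h) * blk w S xi h)); last exact: IH.
  by apply: (@CX_M (fun=> conjc (eta h)) (fun w => blk w S xi h)) => w; [exact: cvg_cst|exact: H].
move=> w.
have -> : inner (blk w T xi) eta - inner (blk w S xi) (trunc s eta) =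
   inner (blk w (T - S) xi) eta + inner (blk w S xi) (eta - trunc s eta).
  rewrite innerBr blkB.
  rewrite (_ : (blk w T - blk w S) xi = blk w T xi - blk w S xi)// innerBl.
  by rewrite addrA subrK.
apply: le_lt_trans (rnormD _ _) _; rewrite [ltRHS]splitr; apply: ltrD.
  apply: le_lt_trans (cauchy_schwarz _ _) _.
  apply: (@le_lt_trans _ _ (op_norm (T - S) * ((ell2_norm xi + 1) * (ell2_norm eta + 1)))).
    rewrite mulrA; apply: ler_pM; rewrite ?ell2_norm_ge0 ?lerDl//.
    apply: le_trans (op_normP (blk w (T - S)) xi) _.
    by apply: ler_pM; rewrite ?op_norm_ge0 ?rnorm_ge0 ?op_norm_blk// lerDl.
  by rewrite -ltr_pdivlMr// mulr_gt0.
apply: le_lt_trans (cauchy_schwarz _ _) _.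
apply: (@le_lt_trans _ _ ((op_norm S + 1) * (ell2_norm xi + 1) * ell2_norm (eta - trunc s eta))).
  rewrite ler_wpM2r ?ell2_norm_ge0//.
  apply: le_trans (op_normP (blk w S) xi) _.
  apply: ler_pM; rewrite ?op_norm_ge0 ?rnorm_ge0 ?lerDl//.
  by apply: le_trans (op_norm_blk _ _) _; rewrite lerDl.
by rewrite mulrC -ltr_pdivlMr.
Qed.

End CrossedProduct.

(** * The symbol *)

#[local] Existing Instance summability.totally_filter.
Section DiscreteFactor.
Context {G : groupType} {X : topologicalType}.

(** Every point has a neighbourhood whose second coordinates lie in all large enough finite sets; by
    compactness a single finite set serves for all of [K]. *)
Lemma compact_discrete_finite (K : set (X * discrete_topology G)) :
  compact K -> finite_set (snd @` K).
Proof.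
move=> Kc; have : compact (snd @` K : set (discrete_topology G)).
  apply: continuous_compact => //; apply: continuous_subspaceT => x.
  exact: cvg_snd.
move=> /compact_near_coveringP /(_ {fset G} summability.totally
  (fun (D : {fset G}) (g : G) => g \in D) (summability.totally_filter)) [].
  move=> g _; exists ([set g], [set D : {fset G} | (g : G) \in D]) => /=.
    split; first exact: discrete_set1.
    by exists [fset (g : G)]%fset => // D /fsubsetP /(_ g); rewrite fset11 => /(_ isT).
  by move=> [h D] /= [-> ].
move=> D _ KD; apply: (sub_finite_set _ (finite_fset D)) => g Kg.
exact: (KD D (fsubset_refl D)).
Qed.

Lemma gpd_Cc_support (K : topologicalType) (z : K) (F : X * G -> K) :
  gpd_Cc z F -> finite_set [set g | exists x, F (x, g) <> z].
Proof.
move=> [_ Kc]; apply: sub_finite_set (compact_discrete_finite Kc).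
move=> g [x Fx]; exists (x, g) => //.
exact: (@subset_closure (X * discrete_topology G)%type).
Qed.

Lemma gpd_Cc_slice (K : topologicalType) (z : K) (F : X * G -> K) g :
  gpd_Cc z F -> continuous (fun x => F (x, g)).
Proof.
move=> [cF _] x.
apply: (@continuous_comp _ (X * discrete_topology G)%type _ (fun x => (x, g)) F).
  move=> P [[U V] /= [xU gV] UVP]; apply: (filterS _ xU) => y Uy.
  by apply: UVP; split => //=; exact: nbhs_singleton gV.
exact: cF.
Qed.

Lemma continuous_discrete (K : topologicalType) (F : X * G -> K) :
  (forall g, continuous (fun x => F (x, g))) ->
  continuous (F : X * discrete_topology G -> K).
Proof.
move=> cF [x g] P FP; have := cF g x P FP => xP.
exists ([set y | P (F (y, g))], [set g]); first by split => //=; exact: discrete_set1.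
by move=> [y h] [/= yP ->].
Qed.

Lemma compact_slices (s : seq G) : compact [set: X] ->
  compact ([set p | p.2 \in s] : set (X * discrete_topology G)).
Proof.
move=> Xc; have -> : [set p : X * discrete_topology G | p.2 \in s] =
    [set: X] `*` ([set` s] : set (discrete_topology G)).
  by apply/seteqP; split => p //= [].
apply: compact_setX => //.
exact: (@finite_compact (discrete_topology G) _ (finite_seq s)).
Qed.

Lemma gpd_Cc_intro (K : topologicalType) (z : K) (F : X * G -> K) (s : seq G) :
  compact [set: X] -> (forall g, continuous (fun x => F (x, g))) ->
  (forall x g, g \notin s -> F (x, g) = z) -> gpd_Cc z F.
Proof.
move=> Xc cF Fs; split; first exact: continuous_discrete.
apply: (subclosed_compact _ (@compact_slices s Xc)); first exact: closed_closure.
set B := [set p : X * discrete_topology G | p.2 \in s].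
have cB : closed B.
  apply: (@closed_comp _ _ (snd : X * discrete_topology G -> discrete_topology G) [set` s]).
    by move=> p _; exact: cvg_snd.
  exact: discrete_closed.
rewrite closureE => p /(_ B); apply; split => // -[x g] /= Fx.
by apply: contrapT => /negP /(Fs x).
Qed.

End DiscreteFactor.

(** Exhibiting an operator that acts by the formula replaces the proof that the formula is linear
    and bounded. *)
Lemma mk_bop_eq {R : realType} {I J : choiceType}
    (f : (I -> R[i]) -> (J -> R[i])) (T : bop (ell2 R I) (ell2 R J)) :
  (forall xi : ell2 R I, T xi = f xi :> (J -> R[i])) -> mk_bop f = T.
Proof.
move=> Tf; suff H : [set T : bop (ell2 R I) (ell2 R J) |
    forall xi : ell2 R I, T xi = f xi :> (J -> R[i])] (mk_bop f).
  by apply/bop_ext => x; apply/val_inj; rewrite /= H Tf.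
by apply: getPex; exists T.
Qed.

(** * Regular representations of the transformation groupoid *)

Section Symbol.
Context {R : realType} {G : groupType} {X : topologicalType}.
Variable act : homeo_action G X.
Hypothesis X_compact : compact [set: X].
Implicit Types (F : X * G -> R[i]) (g h : G) (w x : X) (T : B2 R (X * G)%type).

Local Notation CXR := (CX : set (X -> R[i])).
Local Notation A := (CX_crossed act : set (B2 R (X * G)%type)).

(* (x, h) |-> (h^-1 x, h) carries the source fibres of the groupoid to the sets
   {y} * G, hence its regular representations to those of the crossed product. *)
Definition unfold_op : B2 R (X * G)%type :=
  mk_bop (fun xi p => xi (act p.2 p.1, p.2)).
Definition fold_op : B2 R (X * G)%type :=
  mk_bop (fun xi p => xi (act p.2^-1%g p.1, p.2)).

Lemma unfold_opE xi p : unfold_op xi p = xi (act p.2 p.1, p.2).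
Proof.
rewrite /unfold_op (@mk_bop_reindexE R _ _ (fun p => (act p.2 p.1, p.2)))//.
move=> [x g] [y h] /= [E gh]; rewrite -gh in E *; congr (_, _).
by rewrite -(act1 act x) -(mulVg g) actM E -actM mulVg act1.
Qed.

Lemma fold_opE xi p : fold_op xi p = xi (act p.2^-1%g p.1, p.2).
Proof.
rewrite /fold_op (@mk_bop_reindexE R _ _ (fun p => (act p.2^-1%g p.1, p.2)))//.
move=> [x g] [y h] /= [E gh]; rewrite -gh in E *; congr (_, _).
by rewrite -(act1 act x) -(mulgV g) actM E -actM mulgV act1.
Qed.

Lemma fold_unfold : fold_op *o unfold_op = id_bop.
Proof.
apply/bop_ext => xi; apply/ell2_ext => -[x h].
by rewrite [LHS]fold_opE unfold_opE /= -actM mulgV act1.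
Qed.

Lemma unfold_fold : unfold_op *o fold_op = id_bop.
Proof.
apply/bop_ext => xi; apply/ell2_ext => -[x h].
by rewrite [LHS]unfold_opE fold_opE /= -actM mulVg act1.
Qed.

Lemma unfoldK T : unfold_op *o (fold_op *o T *o unfold_op) *o fold_op = T.
Proof.
by rewrite !comp_bopA unfold_fold comp_idl -comp_bopA unfold_fold comp_idr.
Qed.

Lemma foldK T : fold_op *o (unfold_op *o T *o fold_op) *o unfold_op = T.
Proof.
by rewrite !comp_bopA fold_unfold comp_idl -comp_bopA fold_unfold comp_idr.
Qed.

Lemma gpd_Cc_Cc F : gpd_Cc 0 F -> Cc CXR (fun g x => F (x, g)).
Proof.
move=> CF; split; first by move=> g; exact: (@gpd_Cc_slice _ _ _ _ _ g CF).
apply: sub_finite_set (gpd_Cc_support CF) => g /= Fg.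
by apply: contrapT => /forallNP H; apply: Fg; apply/funext => x; have /contrapT -> := H x.
Qed.

Lemma Cc_gpd_Cc (a : G -> X -> R[i]) : Cc CXR a -> gpd_Cc 0 (fun p => a p.2 p.1).
Proof.
move=> Ca; have [s us as0] := Cc_seq Ca; case: Ca => aE _.
by apply: (gpd_Cc_intro (s := s)) => // x g /= /as0 ->.
Qed.

Lemma gpd_regularE F : gpd_Cc 0 F ->
  gpd_regular act F = fold_op *o CX_regular act (fun g x => F (x, g)) *o unfold_op.
Proof.
move=> CF; have Ca := gpd_Cc_Cc CF; have [s us as0] := Cc_seq Ca; case: Ca => aE _.
rewrite (regular_seq act (CX_linfty X_compact) aE us as0).
apply: mk_bop_eq => xi; apply/funext => -[x h].
rewrite [LHS]fold_opE bop_sumE ell2_sumE /=.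
(* With e = (x, h), the arrows a having the source of e are parametrized by the g for which e a^-1 =
   (x, g), that is a = (g^-1 x, g^-1 h). The groupoid convolution thus becomes the sum over
   coefficients. *)
have -> : [set a | gsrc act a = gsrc act (x, h)] =
    (fun g => (act (g^-1 * h)%g (act h^-1%g x), (g^-1 * h)%g)) @` [set: G].
  rewrite /gsrc; apply/seteqP; split => [[y k] /= E|_ [k _ <-] /=].
    exists (h * k^-1)%g => //; rewrite invgM invgK mulgVK -E -actM mulgV act1 //.
  by rewrite -actM mulVg act1.
rewrite fsbig_image; last by move=> g k _ _ /= [_ /mulIg/invg_inj].
rewrite (fsum_seq us) => [|g gs].
  apply: eq_bigr => g _; rewrite monE; last exact: (CX_linfty X_compact (aE g)).
  rewrite unfold_opE /gmul /ginv /= -actM mulgV act1.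
  by rewrite invgM invgK mulgA mulgV mul1g.
rewrite /gmul /ginv /= invgM invgK mulgA mulgV mul1g.
by have := as0 g gs => /(congr1 (fun f => f x)) ->; rewrite mul0r.
Qed.

Lemma gpd_Cstar_fold T : A T -> gpd_Cstar act (fold_op *o T *o unfold_op).
Proof.
move=> AT; apply: (closure_lip (f := fun T => fold_op *o T *o unfold_op)) AT.
  exact: lip_comp.
move=> _ [a Ca <-]; apply: subset_closure; exists (fun p => a p.2 p.1).
  exact: Cc_gpd_Cc.
by rewrite gpd_regularE//; exact: Cc_gpd_Cc.
Qed.

Lemma ThetaE T : gpd_Cstar act T -> Theta act T = unfold_op *o T *o fold_op.
Proof.
move=> AT; apply: (ext_limE (f := fun T => unfold_op *o T *o fold_op)) AT.
  exact: lip_comp.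
move=> F CF; by rewrite gpd_regularE// unfoldK.
Qed.

(** [Theta] is conjugation by the invertible [unfold_op], which gives both a witness for the choice
    in [Theta_inv] and its uniqueness. *)
Lemma Theta_invE T : A T -> Theta_inv act T = fold_op *o T *o unfold_op.
Proof.
move=> AT; have [] : [set S | gpd_Cstar act S /\ Theta act S = T] (Theta_inv act T).
  apply: getPex; exists (fold_op *o T *o unfold_op).
  have H := gpd_Cstar_fold AT; split => //.
  by rewrite ThetaE// unfoldK.
by move=> H; rewrite ThetaE// => E; rewrite -[in RHS]E foldK.
Qed.

Definition Vinv w : bop (ell2 R G) (ell2 R (fibre act w)) :=
  mk_bop (fun xi e => xi (val e).2).

Lemma fibre_snd w (e : fibre act w) : (val e).1 = act (val e).2 w.
Proof.
case: e => [[x h] /= /set_mem]; rewrite /fibre /gsrc /= => <-.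
by rewrite -actM mulgV act1.
Qed.

Lemma fibre_pointK w (e : fibre act w) : fibre_point act w (val e).2 = e.
Proof.
by apply/val_inj => /=; rewrite -fibre_snd -surjective_pairing.
Qed.

Lemma VinvE w xi e : Vinv w xi e = xi (val e).2.
Proof.
rewrite /Vinv (@mk_bop_reindexE R _ _ (fun e : fibre act w => (val e).2))//.
by move=> d d' dd'; rewrite -(fibre_pointK d) dd' fibre_pointK.
Qed.

Lemma V_Vinv w : Vunitary act w *o Vinv w = id_bop.
Proof.
by apply/bop_ext => xi; apply/ell2_ext => h; rewrite [LHS]VunitaryE VinvE.
Qed.

Lemma V_adj w : adj (Vunitary act w) = Vinv w.
Proof.
apply/adjE/unitary_adjoint; last exact: V_Vinv.
move=> x; apply: (@ell2_norm_reindex _ _ _ (fibre_point act w)).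
  by exists (fun e => (val e).2) => [//|e]; exact: fibre_pointK.
by move=> h; rewrite VunitaryE.
Qed.

Lemma regular_at0E w F : gpd_Cc 0 F -> regular_at0 act w F =
  Vinv w *o blk w (CX_regular act (fun g x => F (x, g))) *o Vunitary act w.
Proof.
move=> CF; have Ca := gpd_Cc_Cc CF; have [s us as0] := Cc_seq Ca; case: Ca => aE _.
rewrite (regular_seq act (CX_linfty X_compact) aE us as0).
apply: mk_bop_eq => xi; apply/funext => e.
rewrite [LHS]VinvE /blk comp_bop_sumr comp_bop_suml /= bop_sumE ell2_sumE.
pose h := (val e).2.
(* The same parametrization as for [gpd_regular]: [g] stands for the arrow with group component g^-1
   h, whose quotient has component [g]. *)
rewrite (@reindex_fsbigT _ _ _ G (fibre act w) (fun g => fibre_point act w (g^-1 * h)%g)); last first.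
  exists (fun a => h * (val a).2^-1)%g => [g /=|a].
    by rewrite invgM invgK mulgA mulgV mul1g.
  by rewrite invgM invgK mulgVK fibre_pointK.
rewrite (fsum_seq us) => [|g gs].
  apply: eq_bigr => g _.
  rewrite -[pr w *o _ *o _]/(blk w (mon act _ g)) blk_mon; last exact: (CX_linfty X_compact (aE g)).
  rewrite /= diag_opE; last first.
    have [M fM] := CX_linfty X_compact (aE g); exists M => i; exact: fM.
  rewrite LtransE VunitaryE /gmul /ginv /= fibre_snd.
  by rewrite invgM invgK mulgA mulgV mul1g.
rewrite /gmul /ginv /= invgM invgK mulgA mulgV mul1g.
by have := as0 g gs => /(congr1 (fun f => f (val e).1)) ->; rewrite mul0r.
Qed.

Lemma regular_atE w T : A T -> regular_at act w (fold_op *o T *o unfold_op) =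
  Vinv w *o blk w T *o Vunitary act w.
Proof.
move=> AT.
rewrite /regular_at (ext_limE
  (f := fun S => Vinv w *o blk w (unfold_op *o S *o fold_op) *o Vunitary act w)).
- by rewrite unfoldK.
- apply: eq_lip (lip_comp (Vinv w *o pr w *o unfold_op) (fold_op *o emb w *o Vunitary act w)) => S.
  by rewrite /blk -!comp_bopA.
- by move=> F CF; rewrite regular_at0E// gpd_regularE// unfoldK.
exact: gpd_Cstar_fold.
Qed.

Lemma symbolE w T : A T -> symbol act T w = blk w T.
Proof.
move=> AT; rewrite /symbol Theta_invE// regular_atE// V_adj !comp_bopA.
by rewrite V_Vinv comp_idl -comp_bopA V_Vinv comp_idr.
Qed.

End Symbol.

(** * Exactness *)

#[local] Existing Instance summability.totally_filter.
Section DiagonalAlgebras.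
Context {R : realType} {G : groupType} {X : topologicalType}.
Variable act : homeo_action G X.
Implicit Types (f : X -> R[i]) (g h : G) (E : set (X -> R[i])).

Definition Uact g : B2 R X := mk_bop (fun xi x => xi (act g^-1%g x)).

Lemma UactE g xi x : Uact g xi x = xi (act g^-1%g x).
Proof.
rewrite /Uact (@mk_bop_reindexE R _ _ (fun x => act g^-1%g x))// => y z yz.
by rewrite -(act1 act y) -(mulgV g) actM yz -actM mulgV act1.
Qed.

(** The action implemented by unitaries. It is defined on all operators on ell^2(X), as the
    exactness hypothesis requires, and restricts to translation on diagonal ones. *)
Definition conj_act g (T : B2 R X) : B2 R X := Uact g *o T *o Uact g^-1%g.

Lemma conj_act_diag g f : linfty f ->
  conj_act g (diag_op f) = diag_op (translate act g f).
Proof.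
move=> fb; apply/bop_ext => xi; apply/ell2_ext => x.
rewrite [LHS]UactE diag_opE// UactE invgK diag_opE; last exact: linfty_translate.
by rewrite -actM mulgV act1.
Qed.

Lemma diag_inj f f' : linfty f -> linfty f' -> diag_op f = diag_op f' -> f = f'.
Proof.
move=> fb fb' ff; apply/funext => x.
have : diag_op f (delta x) x = diag_op f' (delta x) x by rewrite ff.
by rewrite !diag_opE// deltaE eqxx !mulr1.
Qed.

Lemma diag_lin k f f' : linfty f -> linfty f' ->
  k *: diag_op f + diag_op f' = diag_op (fun x => k * f x + f' x).
Proof.
move=> fb fb'; have [M M0 fM] := linfty_ge0 fb; have [N N0 fN] := linfty_ge0 fb'.
apply/bop_ext => xi; apply/ell2_ext => x.
rewrite bopDE ell2DE bopZE ell2ZE !diag_opE//; last first.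
  exists (rnorm (k : R[i]) * M + N) => i.
  rewrite rmorphD rmorphM /= -(rnormE (k : R[i])).
  by apply: le_trans (ler_normD _ _) _; rewrite lerD// normrM ler_wpM2l.
by rewrite mulrDl mulrA.
Qed.

Lemma diag_mul f f' : linfty f -> linfty f' ->
  diag_op f *o diag_op f' = diag_op (fun x => f x * f' x).
Proof.
move=> fb fb'; apply/bop_ext => xi; apply/ell2_ext => x.
by rewrite [LHS]diag_opE// !diag_opE ?mulrA//; exact: linftyM.
Qed.

Lemma diag0 : diag_op (0 : X -> R[i]) = 0.
Proof.
apply/bop_ext => xi; apply/ell2_ext => x.
by rewrite diag_opE ?mul0r//; exact: linfty0.
Qed.

Lemma diag_adj f : linfty f -> adj (diag_op f) = diag_op (fun x => conjc (f x)).
Proof. by move=> fb; apply/adjE/diag_adjoint. Qed.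

(** What makes the diagonal operators of [E] a G-C*-algebra, stated for functions so that C(X) and
    its restriction to the boundary are treated alike. The last clause is closedness under uniform
    limits. *)
Definition invariant_algebra E :=
  [/\ E `<=` linfty (I := X), E 0,
      (forall k f f', E f -> E f' -> E (fun x => k * f x + f' x)),
      (forall f f', E f -> E f' -> E (fun x => f x * f' x)) &
  [/\ forall f, E f -> E (fun x => conjc (f x)),
      forall g f, E f -> E (translate act g f) &
      forall f, (forall e : R, 0 < e -> exists2 f', E f' &
        forall x, rnorm (f x - f' x : R[i]) < e) -> E f]].

Lemma op_norm_diag_le f (e : R) : 0 <= e -> (forall x, rnorm (f x : R[i]) <= e) ->
  op_norm (diag_op f) <= e.
Proof.
by move=> e0 fe; apply: linfty_op_norm => // x; rewrite (rnormE (f x : R[i])) lecR.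
Qed.

(** The limit must be diagonal with entries <T delta_x, delta_x>. Entries are bounded by the
    operator norm, so norm approximation of [T] gives uniform approximation of the entries. *)
Lemma diag_closed E : invariant_algebra E -> closed (@diag_op R X @` E).
Proof.
move=> [Eb E0 ED EM [EC ET EU]] T /closure_rnorm cT.
pose f x := T (delta x) x.
have key (e : R) f' : E f' -> rnorm (T - diag_op f') < e ->
    forall x, rnorm (f x - f' x : R[i]) < e.
  move=> Ef Tf x; apply: le_lt_trans Tf.
  have -> : f x - f' x = (T - diag_op f') (delta x) x.
    rewrite bopDE ell2DE; congr (_ + _).
    rewrite -[(- diag_op f') (delta x) x]/(- (diag_op f' (delta x) x)).
    by rewrite diag_opE ?deltaE ?eqxx ?mulr1//; exact: Eb.
  apply: le_trans (ell2_eval_le _ _) _; apply: le_trans (op_normP (T - diag_op f') _) _.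
  rewrite -[leRHS]mulr1 ler_wpM2l ?op_norm_ge0// rnorm_ell2.
  rewrite -(@ler_pXn2r _ 2)// ?nnegrE ?ell2_norm_ge0// -lecR -inner_self.
  by rewrite inner_delta deltaE eqxx expr1n.
have Ef : E f.
  apply: EU => e e0; have [_ [f' Ef' <-] Tf] := cT e e0.
  by exists f' => //; exact: key.
exists f => //; apply/eqP; rewrite eq_sym -subr_eq0; apply/eqP/rnorm_small_eq0 => e e0.
have e20 : 0 < e / 2 by rewrite divr_gt0.
have [_ [f' Ef' <-] Tf] := cT _ e20.
have -> : T - diag_op f = (T - diag_op f') + (diag_op f' - diag_op f).
  by rewrite addrA subrK.
apply: le_trans (rnormD _ _) _; rewrite [leRHS]splitr; apply: lerD; first exact: ltW.
have -> : diag_op f' - diag_op f = diag_op (fun x => -1 * f x + f' x).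
  by rewrite -diag_lin ?scaleN1r 1?addrC//; exact: Eb.
apply: (@op_norm_diag_le (fun x => -1 * f x + f' x) (e / 2)); first exact: ltW.
move=> x; rewrite mulN1r addrC (@rnorm_distC R R[i]); apply/ltW.
exact: (key _ f').
Qed.

Lemma conj_act_star E g : invariant_algebra E ->
  star_hom (@diag_op R X @` E) (conj_act g).
Proof.
move=> [Eb E0 ED EM [EC ET EU]]; split.
- move=> k _ _ [f Ef <-] [f' Ef' <-].
  rewrite diag_lin; [|exact: Eb|exact: Eb].
  rewrite !conj_act_diag; [|exact: Eb|exact: Eb|exact/Eb/ED].
  by rewrite diag_lin//; apply: linfty_translate; exact: Eb.
- move=> _ _ [f Ef <-] [f' Ef' <-].
  rewrite diag_mul; [|exact: Eb|exact: Eb].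
  rewrite !conj_act_diag; [|exact: Eb|exact: Eb|exact/Eb/EM].
  by rewrite diag_mul//; apply: linfty_translate; exact: Eb.
- move=> _ [f Ef <-]; rewrite diag_adj; last exact: Eb.
  rewrite !conj_act_diag; [|exact: Eb|exact/Eb/EC].
  by rewrite diag_adj//; apply: linfty_translate; exact: Eb.
Qed.

Lemma diag_GCstar E : invariant_algebra E ->
  GCstar_algebra (@diag_op R X @` E) conj_act.
Proof.
move=> IE; have [Eb E0 ED EM [EC ET EU]] := IE; split; split.
- split.
  + by exists 0 => //; exact: diag0.
  + move=> k _ _ [f Ef <-] [f' Ef' <-].
    exists (fun x => k * f x + f' x); first exact: ED.
    by rewrite diag_lin//; exact: Eb.
  + move=> _ _ [f Ef <-] [f' Ef' <-].
    exists (fun x => f x * f' x); first exact: EM.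
    by rewrite diag_mul//; exact: Eb.
  + move=> _ [f Ef <-]; exists (fun x => conjc (f x)); first exact: EC.
    by rewrite diag_adj//; exact: Eb.
- exact: diag_closed.
- move=> g _ [f Ef <-]; exists (translate act g f); first exact: ET.
  by rewrite conj_act_diag//; exact: Eb.
- by move=> g; exact: conj_act_star.
- move=> _ [f Ef <-]; rewrite conj_act_diag; last exact: Eb.
  by congr diag_op; apply/funext => x; rewrite /translate invg1 act1.
- move=> g h _ [f Ef <-]; rewrite !conj_act_diag; [|exact/Eb/ET|exact: Eb|exact: Eb].
  by congr diag_op; apply/funext => x; rewrite /translate invgM actM.
Qed.

Lemma regular_conj_act (a : G -> X -> R[i]) : (forall g, linfty (a g)) ->
  regular id conj_act (fun g => diag_op (a g)) = CX_regular act a.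
Proof.
move=> ab; apply: eq_fsbigr => g _; congr (_ *o _).
rewrite /coef_op; congr mk_bop; apply/funext => xi; apply/funext => p.
by rewrite conj_act_diag.
Qed.

Lemma Cc_diag E (b : G -> B2 R X) : E `<=` linfty (I := X) ->
  Cc (@diag_op R X @` E) b ->
  exists2 a : G -> X -> R[i], Cc E a & b = (fun g => diag_op (a g)).
Proof.
move=> Eb [bE fb]; have H g : exists f, E f /\ diag_op f = b g.
  by have [f Ef fg] := bE g; exists f.
have [a aP] := boolp.choice H; exists a; last first.
  by apply/funext => g; have [_ ->] := aP g.
split; first by move=> g; have [] := aP g.
apply: sub_finite_set fb => g /= ag bg; apply: ag.
have [Ea ag0] := aP g; apply: diag_inj; [exact: Eb|exact: linfty0|].
by rewrite ag0 bg diag0.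
Qed.

(** Exactness speaks of algebras of operators, the theorem of algebras of functions; both crossed
    products are generated by literally the same operators. *)
Lemma crossed_conj_act E : E `<=` linfty (I := X) ->
  crossed id conj_act (@diag_op R X @` E) = crossed (@diag_op R X) (translate act) E.
Proof.
move=> Eb; rewrite /crossed; congr closure; apply/seteqP; split => _ [a aE <-].
  have [c cE ->] := Cc_diag Eb aE; exists c => //.
  by rewrite regular_conj_act//; case: cE => cE _ g; exact/Eb/cE.
exists (fun g => diag_op (a g)).
  case: aE => aE fa; split; first by move=> g; exists (a g).
  by apply: sub_finite_set fa => g /= ag a0; apply: ag; rewrite a0 diag0.
by rewrite regular_conj_act//; case: aE => aE _ g; exact/Eb/aE.
Qed.

End DiagonalAlgebras.

(* The ideal of the open set and the quotient over its complement *)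
#[local] Existing Instance summability.totally_filter.
Section Exactness.
Context {R : realType} {G : groupType} {X : topologicalType}.
Variables (act : homeo_action G X) (Y : set X).
Hypothesis X_compact : compact [set: X].
Hypothesis X_hausdorff : hausdorff_space X.
Hypothesis Y_open : open Y.
Hypothesis Y_invariant : forall (g : G) (x : X), Y x -> Y (act g x).
Hypothesis G_exact : exact_group R G.

Implicit Types (f : X -> R[i]) (g h : G) (T : B2 R (X * G)%type).

Local Notation CXR := (CX : set (X -> R[i])).
Local Notation A := (CX_crossed act : set (B2 R (X * G)%type)).

Lemma Y_act g x : Y (act g x) <-> Y x.
Proof.
split => [|]; last exact: Y_invariant.
by move=> /(Y_invariant (g^-1)%g); rewrite -actM mulVg act1.
Qed.

Definition chi (x : X) : R[i] := (~~ `[< Y x >])%:R.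

Lemma chi_act g x : chi (act g x) = chi x.
Proof. by rewrite /chi; congr (~~ _)%:R; apply/asbool_equiv_eq/Y_act. Qed.

Lemma chi_in x : Y x -> chi x = 0.
Proof. by move=> Yx; rewrite /chi asboolT. Qed.

Lemma chi_out x : ~ Y x -> chi x = 1.
Proof. by move=> Yx; rewrite /chi asboolF. Qed.

Lemma chi_idem x : chi x * chi x = chi x.
Proof. by rewrite /chi; case: (~~ _); rewrite ?mulr1 ?mulr0. Qed.

Lemma chi_le1 x : rnorm (chi x : R[i]) <= 1.
Proof.
by rewrite /chi -lecR -rnormE; case: (~~ _); rewrite ?normr1 ?normr0// lecR.
Qed.

Lemma chi_linfty : linfty chi.
Proof. by exists 1 => x; rewrite (rnormE (chi x : R[i])) lecR chi_le1. Qed.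

(** A model of C(~Y): restrictions to ~Y of continuous functions on X, extended by zero. *)
Definition CXchi : set (X -> R[i]) := [set (fun x => f x * chi x) | f in CXR].

Lemma CX_algebra : invariant_algebra act CXR.
Proof.
split.
- exact: CX_linfty.
- exact: CX_0.
- move=> k f f' cf cf'.
  have ck : CXR (fun=> k) by move=> x; exact: cvg_cst.
  exact: (@CX_D _ _ _ _ (@CX_M _ _ _ _ ck cf) cf').
- by move=> f f' cf cf'; exact: (@CX_M _ _ _ _ cf cf').
split.
- by move=> f cf; exact: (continuous_conj cf).
- by move=> g f cf; exact: (@CX_translate _ _ _ _ g f cf).
- by move=> f H; apply: (continuous_approx (V := R[i])).
Qed.

Lemma norm_Re_le (z : R[i]) : `|complex.Re z| <= rnorm z.
Proof.
case: z => a b; rewrite /rnorm normc_def /=.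
by rewrite -sqrtr_sqr ler_sqrt ?lerDl ?sqr_ge0// addr_ge0 ?sqr_ge0.
Qed.

Lemma norm_Im_le (z : R[i]) : `|complex.Im z| <= rnorm z.
Proof.
case: z => a b; rewrite /rnorm normc_def /=.
by rewrite -sqrtr_sqr ler_sqrt ?lerDr ?sqr_ge0// addr_ge0 ?sqr_ge0.
Qed.

Lemma rnorm_le_ReIm (z : R[i]) : rnorm z <= `|complex.Re z| + `|complex.Im z|.
Proof.
case: z => a b; rewrite /rnorm normc_def /=.
rewrite -(@ler_pXn2r _ 2)// ?nnegrE ?sqrtr_ge0 ?addr_ge0//.
rewrite sqr_sqrtr ?addr_ge0 ?sqr_ge0// sqrrD !real_normK ?num_real//.
by rewrite lerD2r lerDl mulrn_wge0// mulr_ge0.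
Qed.

Lemma continuous_ReIm (u v : X -> R^o) : continuous u -> continuous v ->
  continuous (fun x => u x +i* v x : R[i]).
Proof.
move=> cu cv; apply/(continuous_rnorm (V := R[i])) => x e e0.
have e20 : 0 < e / 2 by rewrite divr_gt0.
have /cvgrPdist_lt /(_ _ e20) Hu := cu x.
have /cvgrPdist_lt /(_ _ e20) Hv := cv x.
apply: (filterS _ (filterI Hu Hv)) => y [/= uy vy].
by apply: le_lt_trans (rnorm_le_ReIm _) _ => /=; rewrite [ltRHS]splitr ltrD.
Qed.

Lemma within_complex (B : set X) f : (forall e : R, 0 < e -> exists2 f', CXR f' &
    forall x, B x -> rnorm (f x - f' x : R[i]) < e) ->
  {within B, continuous (fun x => complex.Re (f x) : R^o)} /\
  {within B, continuous (fun x => complex.Im (f x) : R^o)}.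
Proof.
move=> H.
(* The approximation holds on [B] only, whereas the uniform limit theorem is applied on all of
   [subspace B]. Points outside [B] are isolated there, so cutting off by zero keeps continuity. *)
pose fB x := if `[< B x >] then f x else 0.
have cfB : continuous (fB : subspace B -> R[i]).
  apply: (continuous_approx (X := subspace B) (V := R[i])) => e e0.
  have [f' cf' ff'] := H e e0.
  exists (fun x => if `[< B x >] then f' x else 0).
    apply: (@subspace_eq_continuous _ B _ f').
      by move=> x /set_mem Bx; rewrite asboolT.
    exact: continuous_subspaceT.
  move=> x; rewrite /fB; case: asboolP => Bx; first exact: ff'.
  by rewrite subrr rnorm0.
have parts (p : R[i] -> R) : (forall z w, p (z - w) = p z - p w) ->
    (forall z, `|p z| <= rnorm (z : R[i])) ->
    continuous ((fun x => p (fB x)) : subspace B -> R^o).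
  move=> pB ple x; apply/cvgrPdist_lt => e e0.
  apply: (filterS _ ((continuous_rnorm _).1 cfB x e e0)) => y /=.
  by apply: le_lt_trans; rewrite -pB.
split.
  apply: (@subspace_eq_continuous _ B _ (fun x => complex.Re (fB x) : R^o)).
    by move=> x /set_mem Bx; rewrite /fB asboolT.
  by apply: parts => [[a b] [c d]//|z]; exact: norm_Re_le.
apply: (@subspace_eq_continuous _ B _ (fun x => complex.Im (fB x) : R^o)).
  by move=> x /set_mem Bx; rewrite /fB asboolT.
by apply: parts => [[a b] [c d]//|z]; exact: norm_Im_le.
Qed.

(** The substance is closedness under uniform limits: a limit is continuous on the closed set ~Y,
    and Tietze's theorem, applied to its bounded real and imaginary parts on the normal space X,
    extends it to X. *)
Lemma CXchi_algebra : invariant_algebra act CXchi.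
Proof.
split.
- by move=> _ [f cf <-]; apply: linftyM; [exact: CX_linfty|exact: chi_linfty].
- by exists 0; [exact: CX_0|apply/funext => x; rewrite mul0r].
- move=> k _ _ [f cf <-] [f' cf' <-]; exists (fun x => k * f x + f' x).
    by have [_ _ H _ _] := CX_algebra; exact: H.
  by apply/funext => x; rewrite mulrDl mulrA.
- move=> _ _ [f cf <-] [f' cf' <-]; exists (fun x => f x * f' x).
    exact: (@CX_M _ _ _ _ cf cf').
  by apply/funext => x; rewrite mulrACA chi_idem.
split.
- move=> _ [f cf <-]; exists (fun x => conjc (f x)).
    exact: (continuous_conj cf).
  apply/funext => x; rewrite rmorphM /= /chi; congr (_ * _).
  by rewrite rmorph_nat.
- move=> g _ [f cf <-]; exists (translate act g f).
    exact: (@CX_translate _ _ _ _ g f cf).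
  by apply/funext => x; rewrite /translate chi_act.
- move=> f H.
  have fY x : Y x -> f x = 0.
    move=> Yx; apply: (rnorm_small_eq0 (V := R[i])) => e e0.
    have [_ [f' _ <-] /(_ x)] := H e e0.
    by rewrite chi_in// mulr0 subr0 => /ltW.
  have fb : linfty f.
    have [_ [f' cf' <-] ff'] := H 1 ltr01.
    have [M Mf] := CX_linfty X_compact cf'.
    exists (1 + M) => x; rewrite (rnormE (f x : R[i])) lecR.
    have -> : f x = (f x - f' x * chi x) + f' x * chi x by rewrite subrK.
    apply: le_trans (rnormD _ _) _; apply: lerD; first exact: ltW.
    rewrite -[leRHS]mulr1; have := Mf x; rewrite (rnormE (f' x : R[i])) lecR => Mx.
    apply: (@le_trans _ _ (rnorm (f' x : R[i]) * rnorm (chi x : R[i]))).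
      by rewrite -lecR rmorphM /= -!(@rnormE R R[i]) normrM.
    by apply: ler_pM; rewrite ?rnorm_ge0 ?chi_le1.
  have [M M0 fM] := linfty_ge0 fb.
  have M10 : 0 < M + 1 by rewrite ltr_wpDl.
  have [cRe cIm] : {within ~` Y, continuous (fun x => complex.Re (f x) : R^o)} /\
      {within ~` Y, continuous (fun x => complex.Im (f x) : R^o)}.
    apply: within_complex => e e0.
    have [_ [f' cf' <-] ff'] := H e e0; exists f' => // x Yx.
    by have := ff' x; rewrite chi_out// mulr1.
  have nX := compact_normal X_hausdorff X_compact.
  have cY : closed (~` Y) by exact: open_closedC.
  have fM1 x : rnorm (f x : R[i]) <= M + 1.
    by rewrite -lecR -rnormE (le_trans (fM x))// lecR lerDl.
  have [|g1 [g1f cg1 _]] := continuous_bounded_extension nX cY M10 cRe.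
    by move=> x _; apply: le_trans (norm_Re_le _) (fM1 x).
  have [|g2 [g2f cg2 _]] := continuous_bounded_extension nX cY M10 cIm.
    by move=> x _; apply: le_trans (norm_Im_le _) (fM1 x).
  exists (fun x => g1 x +i* g2 x); first exact: continuous_ReIm.
  apply/funext => x; have [Yx|Yx] := pselect (Y x).
    by rewrite chi_in// mulr0 fY.
  have xY : x \in ~` Y by exact/mem_set.
  rewrite chi_out// mulr1 -(g1f x xY) -(g2f x xY).
  by case: (f x).
Qed.


(* The quotient C(X) / C_0(Y) = C(~Y) is realised on ell^2(X) by the operators of
   multiplication by f chi, the quotient map being the compression by chi. *)
Definition Pchi : B2 R X := diag_op chi.
Definition compress (T : B2 R X) : B2 R X := Pchi *o T *o Pchi.

Lemma compress_diag f : linfty f -> compress (diag_op f) = diag_op (fun x => f x * chi x).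
Proof.
move=> fb; rewrite /compress /Pchi diag_mul//; last exact: chi_linfty.
rewrite diag_mul//; last exact: chi_linfty.
  by congr diag_op; apply/funext => x; rewrite [chi x * _]mulrC -mulrA chi_idem.
by apply: linftyM => //; exact: chi_linfty.
Qed.

(** Invariance of [Y] makes [chi] constant on orbits, so this is at once the projection onto the
    blocks over ~Y and the operator multiplying at (x, h) by chi(hx). The latter reading lets it be
    absorbed into coefficients. *)
Definition bdry_proj : B2 R (X * G)%type := diag_op (fun p => chi p.1).

Lemma bdry_proj_linfty : linfty (fun p : X * G => chi p.1).
Proof. by have [M M1] := chi_linfty; exists M => p; exact: M1. Qed.

Lemma bdry_proj_mon f g : linfty f -> bdry_proj *o mon act f g = mon act (fun x => f x * chi x) g.
Proof.
move=> fb; apply/bop_ext => xi; apply/ell2_ext => p.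
rewrite monE; last by apply: linftyM => //; exact: chi_linfty.
rewrite -[LHS]/(bdry_proj (mon act f g xi) p) diag_opE; last exact: bdry_proj_linfty.
by rewrite monE// chi_act mulrA; congr (_ * _); rewrite mulrC.
Qed.

Lemma bdry_proj_regular (a : G -> X -> R[i]) : Cc CXR a ->
  CX_regular act (fun g x => a g x * chi x) = bdry_proj *o CX_regular act a.
Proof.
move=> Ca; have [s us as0] := Cc_seq Ca; case: Ca => aE _.
have ab g : linfty (a g) by apply: CX_linfty => //; exact: aE.
rewrite (@regular_seq _ _ _ act (@linfty R X) _ s)//; last first.
- by move=> g /as0 ->; apply/funext => x; rewrite mul0r.
- by move=> g; apply: linftyM => //; exact: chi_linfty.
rewrite (@regular_seq _ _ _ act (@linfty R X) _ s)// comp_bop_sumr.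
by apply: eq_bigr => g _; rewrite bdry_proj_mon.
Qed.

Lemma crossed_homE T : A T ->
  crossed_hom (@diag_op R X @` CXR) (conj_act act) (conj_act act) compress T = bdry_proj *o T.
Proof.
move=> AT; apply: (ext_limE (f := fun T => bdry_proj *o T)); first exact: lip_compl.
  move=> b bE; have [a aE ->] := Cc_diag (CX_linfty X_compact) bE.
  have ab g : linfty (a g) by apply: CX_linfty => //; case: aE.
  rewrite (regular_conj_act _ ab) -bdry_proj_regular//.
  rewrite -regular_conj_act; last by move=> g; apply: linftyM => //; exact: chi_linfty.
  congr regular; apply/funext => g /=; exact: compress_diag.
suff : crossed id (conj_act act) (@diag_op R X @` CXR) T by [].
by rewrite crossed_conj_act//; exact: CX_linfty.
Qed.

(** Exactness is applied to [compress], which induces left multiplication by [bdry_proj] on crossed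
    products. The kernel statement gives the ideal. Surjectivity identifies the image with a crossed
    product, which is closed by definition. *)
Lemma exactness :
  A `&` [set T | bdry_proj *o T = 0] = C0_crossed act Y /\ closed ((fun T => bdry_proj *o T) @` A).
Proof.
have AE : crossed id (conj_act act) (@diag_op R X @` CXR) = A.
  by rewrite crossed_conj_act//; exact: CX_linfty.
have imE : compress @` (@diag_op R X @` CXR) = @diag_op R X @` CXchi.
  apply/seteqP; split => [_ [_ [f cf <-] <-]|_ [_ [f cf <-] <-]].
    rewrite compress_diag; last exact: CX_linfty.
    by exists (fun x => f x * chi x) => //; exists f.
  exists (diag_op f); first by exists f.
  by rewrite compress_diag//; exact: CX_linfty.
have [] := G_exact (phi := compress) (diag_GCstar CX_algebra) (diag_GCstar CXchi_algebra) _ _ imE.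
- have [Cb C0' CD CM [CC CT CU]] := CX_algebra.
  split.
  + by move=> k S T _ _; rewrite /compress comp_bopDr comp_bopDl comp_bopZr comp_bopZl.
  + move=> _ _ [f cf <-] [f' cf' <-]; have fb := Cb _ cf; have fb' := Cb _ cf'.
    rewrite diag_mul// !compress_diag//; last exact/Cb/CM.
    rewrite diag_mul; [|by apply: linftyM => //; exact: chi_linfty..].
    by congr diag_op; apply/funext => x; rewrite mulrACA chi_idem.
  + move=> _ [f cf <-]; have fb := Cb _ cf.
    rewrite diag_adj// !compress_diag//; last exact/Cb/CC.
    rewrite diag_adj; last by apply: linftyM => //; exact: chi_linfty.
    by congr diag_op; apply/funext => x; rewrite rmorphM /= /chi rmorph_nat.
- move=> g _ [f cf <-]; have fb := CX_linfty X_compact cf.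
  rewrite conj_act_diag// !compress_diag//; last exact: linfty_translate.
  rewrite conj_act_diag; last by apply: linftyM => //; exact: chi_linfty.
  by congr diag_op; apply/funext => x; rewrite /translate chi_act.
rewrite AE; set J : set (B2 R X) := _ `&` _ => kerE imE'.
have JE : J = @diag_op R X @` C0 Y.
  apply/seteqP; split => [_ [[f cf <-] /=]|_ [f [cf fY] <-]].
    have fb := CX_linfty X_compact cf.
    rewrite compress_diag// => f0; exists f => //; split => // x Yx.
    have : (fun x => f x * chi x) = 0.
      apply: diag_inj; [by apply: linftyM => //; exact: chi_linfty|exact: linfty0|].
      by rewrite f0 diag0.
    by move=> /(congr1 (fun u => u x)); rewrite chi_out// mulr1.
  split; first by exists f.
  rewrite /= compress_diag; last exact: CX_linfty.
  rewrite -diag0; congr diag_op; apply/funext => x.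
  have [Yx|Yx] := pselect (Y x); first by rewrite chi_in// mulr0.
  by rewrite fY// mul0r.
split.
  transitivity (crossed id (conj_act act) J); last first.
    rewrite JE crossed_conj_act// => f [cf _]; exact: CX_linfty.
  rewrite -kerE; apply/seteqP; split => T [AT /= T0]; split => //=.
    by rewrite crossed_homE.
  by rewrite -crossed_homE.
have -> : (fun T => bdry_proj *o T) @` A =
    crossed_hom (@diag_op R X @` CXR) (conj_act act) (conj_act act) compress @` A.
  by apply/seteqP; split => _ [T AT <-]; exists T => //; rewrite crossed_homE.
by rewrite imE'; exact: closed_closure.
Qed.

Lemma pr_bdry_proj w : pr w *o bdry_proj = chi w *: pr w :> bop (ell2 R (X * G)%type) (ell2 R G).
Proof.
apply/bop_ext => xi; apply/ell2_ext => h.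
by rewrite [LHS]prE diag_opE ?bopZE ?ell2ZE ?prE//; exact: bdry_proj_linfty.
Qed.

Lemma bdry_proj_eq0 T : block_diag T ->
  bdry_proj *o T = 0 <-> forall w, ~ Y w -> blk w T = 0.
Proof.
move=> bT; split => [T0 w Yw|H].
  have : pr w *o (bdry_proj *o T) *o emb w = 0 by rewrite T0 comp_bop0r comp_bop0l.
  by rewrite comp_bopA pr_bdry_proj chi_out// scale1r.
apply: bop_pr_ext => w; rewrite comp_bop0r comp_bopA pr_bdry_proj comp_bopZl bT.
have [Yw|Yw] := pselect (Y w); first by rewrite chi_in// scale0r.
by rewrite H// comp_bop0l scaler0.
Qed.

Lemma C0_crossedP T : C0_crossed act Y T <-> A T /\ forall w, ~ Y w -> blk w T = 0.
Proof.
have [<- _] := exactness; split => [[AT /= T0]|[AT T0]]; split => //.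
  by apply/bdry_proj_eq0 => //; exact: crossed_block AT.
by apply/bdry_proj_eq0 => //; exact: crossed_block AT.
Qed.

End Exactness.

(** * Lifting inverses *)

#[local] Existing Instance summability.totally_filter.
Section Parametrix.
Context {R : realType} {G : groupType} {X : topologicalType}.
Variables (act : homeo_action G X) (Y : set X).
Hypothesis X_compact : compact [set: X].
Hypothesis X_hausdorff : hausdorff_space X.
Hypothesis Y_open : open Y.
Hypothesis Y_invariant : forall (g : G) (x : X), Y x -> Y (act g x).
Hypothesis G_exact : exact_group R G.

Implicit Types (S T : B2 R (X * G)%type).
Local Notation CXR := (CX : set (X -> R[i])).
Local Notation A := (CX_crossed act : set (B2 R (X * G)%type)).
Local Notation projY := (bdry_proj Y : B2 R (X * G)%type).

Lemma bdry_proj_comm S : block_diag S -> projY *o S = S *o projY.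
Proof.
move=> bS; apply: bop_pr_ext => w.
by rewrite !comp_bopA pr_bdry_proj comp_bopZl bS -(comp_bopA _ (pr w)) pr_bdry_proj comp_bopZr.
Qed.

Lemma invertible_modulo_blk T : A T ->
  invertible_modulo A (C0_crossed act Y) T ->
  exists2 S, A S & forall w, ~ Y w -> is_inverse (blk w T) (blk w S).
Proof.
move=> AT [S [AS]].
move=> /C0_crossedP - /(_ X_compact X_hausdorff Y_open Y_invariant G_exact) [_ TS].
move=> /C0_crossedP - /(_ X_compact X_hausdorff Y_open Y_invariant G_exact) [_ ST].
exists S => // w Yw; split; apply/eqP; rewrite -subr_eq0; apply/eqP.
  rewrite -(ST w Yw) blkB blk_id blk_comp//.
  exact: (@crossed_block _ _ _ _ X_compact _ AS).
rewrite -(TS w Yw) blkB blk_id blk_comp//.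
exact: (@crossed_block _ _ _ _ X_compact _ AT).
Qed.

Lemma sqr_norm_sub (I : choiceType) (x y : ell2 R I) (t : R) :
  ell2_norm (x - t%:C *: y) ^+ 2 =
  ell2_norm x ^+ 2 - 2 * t * complex.Re (inner x y) + t ^+ 2 * ell2_norm y ^+ 2.
Proof.
have := inner_self (x - t%:C *: y).
rewrite innerBl !innerBr !innerZl !innerZr !inner_self -(inner_conj x y).
case: (inner x y) => a b => -[<- _] /=; ring.
Qed.

(* Neumann series: S0 approximates the adjoint of T well enough for 1 - t S0 T
   to be a strict contraction on the range of bdry_proj. *)
Lemma contraction T (Ti : B2 R (X * G)%type) : A T -> Ti *o T = projY ->
  exists (t q : R) (S0 : B2 R (X * G)%type), [/\ A S0, 0 <= q, q < 1 &
    forall x, projY x = x -> ell2_norm (x - t%:C *: S0 (T x)) <= q * ell2_norm x].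
Proof.
move=> AT TiT.
(* [C] bounds [T] below on the range of the projection: |x| <= C |Tx|. An error of (2C)^-1 in [T]
   then costs at most half of |Tx|^2 in Re <Tn x, Tx>. *)
pose C := op_norm Ti + 1.
have C1 : 1 <= C by rewrite /C lerDr op_norm_ge0.
have d0 : 0 < (2 * C)^-1 by rewrite invr_gt0; lra.
have cT := AT; rewrite (CX_crossedE _ X_compact) in cT.
have [Tn [ETn Tnd]] : exists Tn : B2 R (X * G)%type,
    mon_span act CXR Tn /\ op_norm (T - Tn) < (2 * C)^-1.
  by have [Tn ETn Tnd] := (closure_rnorm _ _).1 cT _ d0; exists Tn.
have [S0 ES0 adjS0] := mon_span_adj X_compact ETn.
pose N := op_norm S0 + 1.
have N1 : 1 <= N by rewrite /N lerDr op_norm_ge0.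
(* This makes the quadratic term t^2 N^2 |Tx|^2 equal to (t/2) |Tx|^2, half of the gain t |Tx|^2
   from the cross term. The remaining half is at least t/(2 C^2) |x|^2, whence [q2]. *)
pose t := (2 * N ^+ 2)^-1.
have N2 : 1 <= N ^+ 2 by rewrite exprn_ege1.
have C2 : 1 <= C ^+ 2 by rewrite exprn_ege1.
have C0 : C != 0 by rewrite gt_eqF// (lt_le_trans ltr01 C1).
have N0 : N != 0 by rewrite gt_eqF// (lt_le_trans ltr01 N1).
have t0 : 0 < t by rewrite invr_gt0; lra.
have t1 : t <= 1 by rewrite invf_le1; lra.
pose q2 := 1 - t / (2 * C ^+ 2).
have tC : 0 < t / (2 * C ^+ 2) <= 1.
  rewrite divr_gt0//=; last by lra.
  by rewrite ler_pdivrMr ?mul1r; lra.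
have q20 : 0 <= q2 by rewrite /q2; lra.
exists t, (Num.sqrt q2), S0; split.
- exact: (@crossed_span _ _ _ act X_compact _ ES0).
- exact: sqrtr_ge0.
- by rewrite -(@ltr_pXn2r _ 2)// ?nnegrE ?sqrtr_ge0// sqr_sqrtr// expr1n /q2; lra.
move=> x cx.
rewrite -(@ler_pXn2r _ 2)// ?nnegrE ?mulr_ge0 ?ell2_norm_ge0 ?sqrtr_ge0//.
rewrite exprMn (sqr_sqrtr q20) sqr_norm_sub -(adjS0 x (T x)).
have xT : ell2_norm x <= C * ell2_norm (T x).
  rewrite -{1}cx -TiT; apply: le_trans (op_normP Ti (T x)) _.
  by rewrite rnorm_ell2 ler_wpM2r ?ell2_norm_ge0// lerDl.
have -> : Tn x = T x - (T - Tn) x.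
  by rewrite -[(T - Tn) x]/(T x - Tn x) opprB addrC subrK.
rewrite innerBl inner_self.
have dT : complex.Re (inner ((T - Tn) x) (T x)) <= ell2_norm (T x) ^+ 2 / 2.
  apply: le_trans (ler_norm _) _; apply: le_trans (norm_Re_le _) _.
  apply: le_trans (cauchy_schwarz _ _) _.
  apply: (@le_trans _ _ ((2 * C)^-1 * (C * ell2_norm (T x)) * ell2_norm (T x))).
    rewrite ler_wpM2r ?ell2_norm_ge0//; apply: le_trans (op_normP (T - Tn) x) _.
    by apply: ler_pM; rewrite ?op_norm_ge0 ?rnorm_ge0// ltW.
  by rewrite le_eqVlt; apply/orP; left; apply/eqP; field.
have S0T : t ^+ 2 * ell2_norm (S0 (T x)) ^+ 2 <= t / 2 * ell2_norm (T x) ^+ 2.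
  have -> : t / 2 = t ^+ 2 * N ^+ 2 by rewrite /t; field.
  rewrite -mulrA ler_wpM2l ?sqr_ge0// -exprMn ler_pXn2r ?nnegrE ?ell2_norm_ge0//.
    apply: le_trans (op_normP S0 (T x)) _.
    by rewrite rnorm_ell2 ler_wpM2r ?ell2_norm_ge0// lerDl.
  by rewrite mulr_ge0 ?ell2_norm_ge0//; lra.
have xT2 : ell2_norm x ^+ 2 <= C ^+ 2 * ell2_norm (T x) ^+ 2.
  rewrite -exprMn ler_pXn2r ?nnegrE ?ell2_norm_ge0// mulr_ge0 ?ell2_norm_ge0//; lra.
have xT3 : t / (2 * C ^+ 2) * ell2_norm x ^+ 2 <= t / 2 * ell2_norm (T x) ^+ 2.
  have -> : t / 2 * ell2_norm (T x) ^+ 2 =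
      t / (2 * C ^+ 2) * (C ^+ 2 * ell2_norm (T x) ^+ 2) by field.
  by rewrite ler_wpM2l//; lra.
have tdT : 2 * t * complex.Re (inner ((T - Tn) x) (T x)) <=
    2 * t * (ell2_norm (T x) ^+ 2 / 2).
  by apply: (ler_wpM2l _ dT); rewrite mulr_ge0 ?(ltW t0).
move: tdT S0T xT3; rewrite /q2; case: (inner ((T - Tn) x) (T x)) => a b /=.
set nT := ell2_norm (T x) ^+ 2; set nx := ell2_norm x ^+ 2; set nS := ell2_norm _ ^+ 2.
lra.
Qed.

Lemma invertible_modulo_of_blk T (M : R) : A T ->
  (forall w, ~ Y w -> invertible (blk w T)) ->
  (forall w, ~ Y w -> op_norm (inv_bop (blk w T)) <= M) ->
  invertible_modulo A (C0_crossed act Y) T.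
Proof.
move=> AT Tinv TM.
have bT := @crossed_block _ _ _ _ X_compact _ AT.
have invP w : ~ Y w -> is_inverse (blk w T) (inv_bop (blk w T)).
  by move=> /Tinv [S TS]; rewrite (inv_bopE TS).
(* Over [Y] nothing is known about the blocks, and zero makes [Ti] an inverse of [T] relative to the
   projection. *)
pose F w : B2 R G := if `[< Y w >] then 0 else inv_bop (blk w T).
have FM w : op_norm (F w) <= Num.max M 0.
  rewrite /F; case: asboolP => Yw.
    by rewrite le_max; apply/orP; right; apply: op_norm_le => // x; rewrite rnorm0 mul0r.
  by rewrite le_max TM.
pose Ti := bdiag F.
have TiE w : pr w *o Ti = F w *o pr w by exact: bdiagE FM w.
have TiT : Ti *o T = projY.
  apply: bop_pr_ext => w; rewrite comp_bopA TiE -(comp_bopA _ (pr w)) bT (comp_bopA _ _ (pr w)) pr_bdry_proj.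
  rewrite /F; case: asboolP => Yw; first by rewrite comp_bop0l comp_bop0l chi_in// scale0r.
  by have [-> _] := invP w Yw; rewrite comp_idl chi_out// scale1r.
have TTi : T *o Ti = projY.
  apply: bop_pr_ext => w; rewrite comp_bopA bT -(comp_bopA _ (pr w)) TiE (comp_bopA _ _ (pr w)) pr_bdry_proj.
  rewrite /F; case: asboolP => Yw; first by rewrite comp_bop0r comp_bop0l chi_in// scale0r.
  by have [_ ->] := invP w Yw; rewrite comp_idl chi_out// scale1r.
have cTi : projY *o Ti = Ti.
  apply: bop_pr_ext => w; rewrite comp_bopA pr_bdry_proj comp_bopZl TiE.
  rewrite /F; case: asboolP => Yw; first by rewrite comp_bop0l scaler0.
  by rewrite chi_out// scale1r.
have [t [q [S0 [AS0 q0 q1 bq]]]] := contraction AT TiT.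
pose b := id_bop - t%:C *: (S0 *o T).
have Ab : A b.
  apply: (@crossed_B _ _ _ act X_compact); first exact: crossed_id.
  by apply: (@crossed_Z _ _ _ act X_compact); apply: (@crossed_M _ _ _ act X_compact).
have bb := @crossed_block _ _ _ _ X_compact _ Ab.
(* [bn n] is b^n and [Nn n] the partial sum of b^k (t S0) for k < n, so that [Nn n *o T] is 1 - b^n.
   As [b] contracts only on the range of the projection, these sums are compared with [Ti] after
   compression. *)
pose fix bn n := if n is n'.+1 then b *o bn n' else id_bop.
pose fix Nn n := if n is n'.+1 then t%:C *: S0 + b *o Nn n' else 0.
have ANn n : A (Nn n).
  elim: n => [|n IH] /=.
    by rewrite -(subrr (id_bop : B2 R (X * G)%type)); apply: (@crossed_B _ _ _ act X_compact); exact: crossed_id.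
  apply: (@crossed_D _ _ _ act X_compact); first exact: (@crossed_Z _ _ _ act X_compact).
  exact: (@crossed_M _ _ _ act X_compact).
have NnT n : Nn n *o T = id_bop - bn n.
  elim: n => [|n IH] /=; first by rewrite comp_bop0l subrr.
  rewrite comp_bopDl comp_bopZl -comp_bopA IH comp_bopBr comp_idr.
  by rewrite /b addrA [t%:C *: _ + _]addrC subrK.
have bncut n x : projY x = x -> projY (bn n x) = bn n x /\ ell2_norm (bn n x) <= q ^+ n * ell2_norm x.
  move=> cx; elim: n => [|n [IH1 IH2]] /=; first by rewrite expr0 mul1r.
  split; first by rewrite -[projY (b _)]/((projY *o b) _) bdry_proj_comm//= IH1.
  rewrite exprS -mulrA; apply: le_trans (bq _ IH1) _.
  by rewrite ler_wpM2l.
have cutN n : projY *o Nn n = Ti - bn n *o Ti.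
  rewrite bdry_proj_comm; last exact: (@crossed_block _ _ _ _ X_compact _ (ANn n)).
  by rewrite -TTi comp_bopA NnT comp_bopBl comp_idl.
have [_ cl] := exactness X_compact X_hausdorff Y_open Y_invariant G_exact.
(* Closedness of the compressed algebra turns the limit [Ti] of compressions into the compression of
   an element of the crossed product. *)
have [S AS STi] : ((fun T => projY *o T) @` A) Ti.
  apply: cl; apply/closure_rnorm => e e0.
  have D0 : 0 < op_norm Ti + 1 by rewrite ltr_wpDl ?op_norm_ge0.
  have [n qn] : exists n, q ^+ n < e / (op_norm Ti + 1).
    have := @cvg_expr R q; rewrite ger0_norm// => /(_ q1) /cvgrPdist_lt.
    move=> /(_ _ (divr_gt0 e0 D0)) [n _ /(_ n (leqnn n))].
    by rewrite sub0r normrN ger0_norm ?exprn_ge0//; exists n.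
  exists (projY *o Nn n); first by exists (Nn n).
  rewrite cutN opprB addrC subrK.
  apply: (@le_lt_trans _ _ (q ^+ n * op_norm Ti)).
    apply: (op_norm_le (T := bn n *o Ti)) => [|x]; first by rewrite mulr_ge0 ?exprn_ge0 ?op_norm_ge0.
    have cTx : projY (Ti x) = Ti x by rewrite -[projY (Ti x)]/((projY *o Ti) x) cTi.
    have [_ H] := bncut n _ cTx; apply: le_trans H _.
    by rewrite -mulrA ler_wpM2l ?exprn_ge0//; exact: (op_normP Ti x).
  apply: (@le_lt_trans _ _ (q ^+ n * (op_norm Ti + 1))).
    by rewrite ler_wpM2l ?exprn_ge0// lerDl.
  by rewrite -ltr_pdivlMr.
have blkS w : ~ Y w -> blk w S = inv_bop (blk w T).
  move=> Yw.
  have : pr w *o (projY *o S) *o emb w = F w by rewrite STi TiE -(comp_bopA _ (pr w)) pr_emb comp_idr.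
  by rewrite comp_bopA pr_bdry_proj chi_out// scale1r => E; rewrite -[blk w S]/(pr w *o S *o emb w) E /F asboolF.
have bS := @crossed_block _ _ _ _ X_compact _ AS.
have Aid := crossed_id (R := R) act X_compact.
exists S; split => //; apply/C0_crossedP => //; split.
- by apply: (@crossed_B _ _ _ act X_compact) => //; apply: (@crossed_M _ _ _ act X_compact).
- by move=> w Yw; rewrite blkB blk_comp// blk_id blkS// (invP w Yw).2 subrr.
- by apply: (@crossed_B _ _ _ act X_compact) => //; apply: (@crossed_M _ _ _ act X_compact).
- by move=> w Yw; rewrite blkB blk_comp// blk_id blkS// (invP w Yw).1 subrr.
Qed.

End Parametrix.

(** * Bounds on limit operators *)

#[local] Existing Instance summability.totally_filter.
Section WotBounded.
Context {R : realType} {G : groupType} {X : topologicalType}.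

Lemma inner_bop_subproof (I : choiceType) (eta : ell2 R I) :
  (fun xi => inner xi eta) \in @bounded_op R (ell2 R I) R[i].
Proof.
apply/asboolP; split => [k x y|]; first by rewrite innerDl innerZl.
exists (ell2_norm eta) => x; rewrite mulrC; exact: cauchy_schwarz.
Qed.

Definition inner_bop (I : choiceType) (eta : ell2 R I) : bop (ell2 R I) R[i] :=
  Bop (inner_bop_subproof eta).

(** Uniform boundedness is used twice: for fixed [xi], on the functionals given by the vectors
    [F w xi], which compactness bounds pointwise; then on the operators [F w] themselves. *)
Lemma wot_bounded (B : set X) (F : X -> B2 R G) : compact B ->
  wot_continuous_on B F -> exists M, forall w, B w -> op_norm (F w) <= M.
Proof.
move=> Bc cF.
have bF xi : exists M, forall w : {w | B w}, ell2_norm (F (sval w) xi) <= M.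
  have [eta|M FM] := @uniform_boundedness R G R[i] {w | B w}
      (fun w => inner_bop (F (sval w) xi)).
    have [M MP] := compact_rnorm_bounded Bc (cF xi eta).
    exists M => -[w Bw] /=.
    by have := MP w Bw; rewrite -inner_conj /rnorm normcJ.
  (* The norm of a vector is recovered from its functional by evaluating it at the vector itself. *)
  exists M => w; have := op_normP (inner_bop (F (sval w) xi)) (F (sval w) xi).
  rewrite /= inner_self rnorm_ell2; set n := ell2_norm _.
  have n0 : 0 <= n by exact: ell2_norm_ge0.
  rewrite /rnorm normc_def /= expr0n addr0 sqrtr_sqr ger0_norm ?sqr_ge0//.
  have := FM w; set N := op_norm _ => NM nN.
  have [->|n1] := eqVneq n 0; first exact: le_trans (op_norm_ge0 _) NM.
  have {}n1 : 0 < n by rewrite lt_def n1.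
  apply: le_trans NM; move: nN; rewrite expr2 ler_pM2r//.
have [xi|M FM] := @uniform_boundedness R G (ell2 R G) {w | B w} (fun w => F (sval w)).
  by have [M MP] := bF xi; exists M.
by exists M => w Bw; exact: (FM (exist _ w Bw)).
Qed.

End WotBounded.

(** * Norm continuity of blocks on finite supports *)

Section NormContinuity.
Context {R : realType} {G : groupType} {X : topologicalType}.
Variable act : homeo_action G X.
Hypothesis X_compact : compact [set: X].
Implicit Types (S T : B2 R (X * G)%type) (v : ell2 R G).
Local Notation CXR := (CX : set (X -> R[i])).
Local Notation A := (CX_crossed act : set (B2 R (X * G)%type)).

Lemma near_seq (p : X) (J : eqType) (l : seq J) (P : J -> set X) :
  (forall i, i \in l -> nbhs p (P i)) ->
  nbhs p [set w | forall i, i \in l -> P i w].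
Proof.
elim: l => [|i l IH] H; first by apply: filterE => w i.
have Hi := H i (mem_head _ _).
have Hl : nbhs p [set w | forall i, i \in l -> P i w].
  by apply: IH => j jl; apply: H; rewrite inE jl orbT.
apply: (filterS _ (filterI Hi Hl)) => w [wi wl] j.
by rewrite inE => /orP[/eqP ->//|]; exact: wl.
Qed.

Definition supported (B : seq G) v := forall h, v h != 0 -> h \in B.

Lemma diag_norm_le (d : G -> R[i]) (e : R) v : linfty d -> 0 <= e ->
  (forall h, v h != 0 -> rnorm (d h : R[i]) <= e) ->
  ell2_norm (diag_op d v) <= e * ell2_norm v.
Proof.
move=> db e0 de.
rewrite -(@ler_pXn2r _ 2)// ?nnegrE ?mulr_ge0 ?ell2_norm_ge0//.
rewrite exprMn -lee_fin ell2_norm_sqr EFinM ell2_norm_sqr -sqsumZ ?sqr_ge0//; last first.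
  by move=> i; rewrite lee_fin sqmod_ge0.
apply: le_esum => h _; rewrite diag_opE// sqmodM -EFinM lee_fin.
have [->|vh] := eqVneq (v h) 0; first by rewrite /sqmod /= expr0n addr0 !mulr0.
rewrite ler_wpM2r ?sqmod_ge0//; have := de h vh.
rewrite /rnorm normc_def /= => H.
by rewrite -[leLHS]sqr_sqrtr ?sqmod_ge0// ler_pXn2r ?nnegrE ?sqrtr_ge0.
Qed.

Lemma Ltrans_norm g v : ell2_norm (Ltrans g v) = ell2_norm v.
Proof.
apply: (@ell2_norm_reindex _ _ _ (fun h => g^-1 * h)%g); last first.
  by move=> h; rewrite LtransE.
by exists (fun h => g * h)%g => h; rewrite ?mulVKg ?mulKg.
Qed.

(** A monomial f g sends a vector supported in [B] to one supported in gB, and its block at [w] sees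
    [f] only at the finitely many points gbw. Continuity at these points is therefore uniform in the
    vector. *)
Lemma blk_norm_continuous (B : seq G) (p : X) T (e : R) : A T -> 0 < e ->
  nbhs p [set w | forall v, supported B v ->
    ell2_norm (blk w T v - blk p T v) <= e * ell2_norm v].
Proof.
move=> AT; have cT := AT; rewrite (CX_crossedE _ X_compact) in cT.
move=> e0; have e30 : 0 < e / 3 by rewrite divr_gt0.
have [S [ES TS]] : exists S : B2 R (X * G)%type,
    mon_span act CXR S /\ op_norm (T - S) < e / 3.
  by have [S ES TS] := (closure_rnorm _ _).1 cT _ e30; exists S.
(* All radii at once, so that the induction can split the error between the first monomial and the
   rest. *)
have H : forall r : R, 0 < r -> nbhs p [set w | forall v, supported B v ->
    ell2_norm (blk w S v - blk p S v) <= r * ell2_norm v].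
  elim: ES => [|f g S' cf _ IH] r r0.
    apply: filterE => w v _; rewrite /blk !comp_bop0r !comp_bop0l subrr.
    by rewrite -rnorm_ell2 rnorm0 mulr_ge0 ?ell2_norm_ge0 ?ltW.
  have r20 : 0 < r / 2 by rewrite divr_gt0.
  have near1 : nbhs p [set w | forall b, b \in B ->
      rnorm (f (act (g * b)%g w) - f (act (g * b)%g p) : R[i]) < r / 2].
    apply: near_seq => b _.
    have cfb : continuous (fun w => f (act (g * b)%g w)).
      by move=> w; apply: (@continuous_comp _ _ _ (act (g * b)%g) f); [exact: act_continuous|exact: cf].
    apply: (filterS _ ((continuous_rnorm _).1 cfb p _ r20)) => w /=.
    by rewrite (@rnorm_distC R R[i]).
  apply: (filterS _ (filterI near1 (IH _ r20))) => w [fw Sw] v vB.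
  have fb := CX_linfty X_compact cf; have [M fM] := fb.
  rewrite !blkD !blk_mon// !bopDE.
  set a := (Mult act w f *o Ltrans g) v; set b := (Mult act p f *o Ltrans g) v.
  have -> : a + blk w S' v - (b + blk p S' v) = (a - b) + (blk w S' v - blk p S' v).
    by rewrite opprD addrACA.
  apply: le_trans (ell2_normD _ _) _.
  have -> : r * ell2_norm v = r / 2 * ell2_norm v + r / 2 * ell2_norm v.
    by rewrite -mulrDl -splitr.
  apply: lerD; last exact: Sw.
  have db : linfty (fun h => f (act h w) - f (act h p)).
    exists (M + M) => h; rewrite rmorphD; apply: le_trans (ler_normB _ _) _.
    by rewrite lerD.
  have -> : a - b = diag_op (fun h => f (act h w) - f (act h p)) (Ltrans g v).
    apply/ell2_ext => h; rewrite diag_opE// mulrBl /a /b.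
    rewrite -[LHS]/(Mult act w f (Ltrans g v) h - Mult act p f (Ltrans g v) h).
    by rewrite !diag_opE//; exists M => k; exact: fM.
  rewrite -(Ltrans_norm g v); apply: diag_norm_le => //; first exact: ltW.
  move=> h; rewrite LtransE => /vB /fw; rewrite mulVKg => /ltW //.
apply: (filterS _ (H _ e30)) => w Sw v vB.
have -> : blk w T v - blk p T v =
    blk w (T - S) v + (blk w S v - blk p S v) - blk p (T - S) v.
  rewrite !blkB -[(blk w T - blk w S) v]/(blk w T v - blk w S v).
  rewrite -[(blk p T - blk p S) v]/(blk p T v - blk p S v).
  by rewrite opprB (addrA (blk w T v - blk w S v)) subrK addrA subrK.
have TSle z : ell2_norm (blk z (T - S) v) <= e / 3 * ell2_norm v.
  apply: le_trans (op_normP (blk z (T - S)) v) _.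
  rewrite rnorm_ell2 ler_wpM2r ?ell2_norm_ge0//.
  exact: le_trans (op_norm_blk _ _) (ltW TS).
apply: le_trans (ell2_normD _ _) _.
have -> : ell2_norm (- blk p (T - S) v) = ell2_norm (blk p (T - S) v).
  by rewrite -!rnorm_ell2 rnorm_opp.
have := ell2_normD (blk w (T - S) v) (blk w S v - blk p S v).
have := TSle w; have := TSle p; have := Sw v vB.
lra.
Qed.

End NormContinuity.

(** * Localization *)

#[local] Existing Instance summability.totally_filter.
Section Sums.
Context {R : realType}.

Lemma esum_fsum {I : choiceType} (F : I -> R) (s : seq I) :
  (forall i, 0 <= F i) -> uniq s -> (forall i, i \notin s -> F i = 0) ->
  (\esum_(i in [set: I]) (F i)%:E = (\sum_(i \in [set: I]) F i)%:E)%E.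
Proof.
move=> F0 us Fs; rewrite (fsum_seq us Fs).
transitivity (\esum_(i in [set` s]) (F i)%:E)%E.
  rewrite [RHS]esum_mkcond; apply: eq_esum => i _.
  case: ifPn => // /negP i_s; rewrite Fs//; apply/negP => i_s'; apply: i_s.
  exact/mem_set.
rewrite esum_fset//; last by move=> i _; rewrite lee_fin.
by rewrite -fsbig_seq// sumEFin.
Qed.

Lemma esum_swap {I J : choiceType} (a : I -> J -> \bar R) :
  (forall i j, 0 <= a i j)%E ->
  (\esum_(i in [set: I]) \esum_(j in [set: J]) a i j =
   \esum_(j in [set: J]) \esum_(i in [set: I]) a i j)%E.
Proof.
move=> a0; rewrite !esum_esum//.
apply: (@reindex_esum _ _ _ _ _ (fun p : J * I => (p.2, p.1)) (fun p => a p.1 p.2)).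
split => //= [[? ?] [? ?] _ _ [-> ->]//|[i j] _].
by exists (j, i).
Qed.

(** Cauchy-Schwarz against the constant 1; the induction uses [sqmodD] with the number of remaining
    terms as its parameter. *)
Lemma sqmod_sum (J : Type) (s : seq J) (z : J -> R[i]) :
  sqmod (\sum_(j <- s) z j) <= (size s)%:R * \sum_(j <- s) sqmod (z j).
Proof.
elim: s => [|j s IH]; first by rewrite !big_nil /sqmod /= expr0n addr0 mulr0.
rewrite !big_cons /=; have [s0|s0] := eqVneq (size s) 0%N.
  by rewrite s0 (size0nil s0) !big_nil !addr0 mul1r.
have n0 : 0 < (size s)%:R :> R by rewrite ltr0n lt0n.
apply: le_trans (sqmodD _ _ n0) _.
rewrite -[in leRHS]natr1 [leRHS]mulrDr [1 + (size s)%:R]addrC; apply: lerD => //.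
apply: (@le_trans _ _ ((1 + (size s)%:R^-1) * ((size s)%:R * \sum_(j0 <- s) sqmod (z j0)))).
  by rewrite ler_wpM2l// addr_ge0// invr_ge0 ltW.
by rewrite mulrA mulrDl mul1r mulVf// gt_eqF.
Qed.

(** Turns approximate invariance of the weights in the l^1 sense into that of their square roots in
    the l^2 sense. *)
Lemma sqrt_sub_sqr (x y : R) : 0 <= x -> 0 <= y ->
  (Num.sqrt x - Num.sqrt y) ^+ 2 <= `|x - y|.
Proof.
move=> x0 y0.
have sx := sqr_sqrtr x0; have sy := sqr_sqrtr y0.
have a0 := sqrtr_ge0 x; have b0 := sqrtr_ge0 y.
move: sx sy a0 b0; set a := Num.sqrt x; set b := Num.sqrt y => <- <- a0 b0.
have [ab|ba] := leP a b.
  by rewrite distrC ger0_norm ?subr_ge0 ?ler_pXn2r//; nra.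
by rewrite ger0_norm ?subr_ge0 ?ler_pXn2r ?(ltW ba)//; nra.
Qed.

Lemma sqmod_real (x : R) : sqmod (x%:C) = x ^+ 2.
Proof. by rewrite /sqmod /= expr0n addr0. Qed.

End Sums.

Section Localization.
Context {R : realType} {G : groupType}.
Implicit Types (u v : ell2 R G) (m : G -> G -> R) (e : R).

(* m h j is the weight at h of the j-th member of a partition of unity on G. *)
Definition partition_weights (m : G -> G -> R) (e : R) (S K : seq G) :=
  [/\ (forall h j, 0 <= m h j <= 1),
      (forall h j, m h j != 0 -> (j * h^-1)%g \in S),
      (forall h, `|1 - \sum_(j \in [set: G]) m h j| < e) &
      (forall h g, g \in K ->
        \sum_(j \in [set: G]) `|m h j - m (g^-1 * h)%g j| < e)].

Variables (m : G -> G -> R) (e : R) (S K : seq G).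
Hypothesis mP : partition_weights m e S K.

(* Square roots, so that the squares of the cut-offs add up to nearly 1. *)
Definition theta (j : G) : G -> R[i] := fun h => (Num.sqrt (m h j))%:C.

Lemma m_ge0 h j : 0 <= m h j.
Proof. by case: mP => /(_ h j)/andP[]. Qed.

Lemma m_finite h : exists2 s : seq G, uniq s & forall j, j \notin s -> m h j = 0.
Proof.
exists (undup [seq (k * h)%g | k <- S]); first exact: undup_uniq.
move=> j; rewrite mem_undup => js; apply/eqP; apply: contraNT js => mj.
case: mP => _ /(_ h j mj) jS _ _.
by apply/mapP; exists (j * h^-1)%g => //; rewrite mulgVK.
Qed.

Lemma esum_m h : (\esum_(j in [set: G]) (m h j)%:E = (\sum_(j \in [set: G]) m h j)%:E)%E.
Proof.
have [s us ms] := m_finite h; apply: (esum_fsum (s := s)) => // j; exact: m_ge0.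
Qed.

Lemma esum_dm h k : (\esum_(j in [set: G]) (`|m h j - m k j|)%:E =
  (\sum_(j \in [set: G]) `|m h j - m k j|)%:E)%E.
Proof.
have [s us ms] := m_finite h; have [s' us' ms'] := m_finite k.
apply: (esum_fsum (s := undup (s ++ s'))); [by []|exact: undup_uniq|].
move=> j; rewrite mem_undup mem_cat negb_or => /andP[js js'].
by rewrite ms// ms'// subrr normr0.
Qed.

Lemma theta_linfty j : linfty (theta j).
Proof.
exists 1 => h; rewrite normc_def /= expr0n addr0 lecR sqrtr_sqr ger0_norm ?sqrtr_ge0//.
have [/(_ h j)/andP[_ m1] _ _ _] := mP.
by rewrite -[leRHS]sqrtr1 ler_sqrt.
Qed.

Definition cut_off j v : ell2 R G := diag_op (theta j) v.

Lemma cut_offE j v h : cut_off j v h = theta j h * v h.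
Proof. by rewrite /cut_off diag_opE//; exact: theta_linfty. Qed.

Lemma sqmod_cut_off j v h : sqmod (cut_off j v h) = m h j * sqmod (v h).
Proof. by rewrite cut_offE sqmodM sqmod_real sqr_sqrtr ?m_ge0. Qed.

Lemma sum_cut_off v :
  (\esum_(j in [set: G]) sqsum (cut_off j v) =
   \esum_(h in [set: G]) ((\sum_(j \in [set: G]) m h j) * sqmod (v h))%:E)%E.
Proof.
rewrite /sqsum esum_swap; last by move=> *; rewrite lee_fin sqmod_ge0.
apply: eq_esum => h _.
under eq_esum do rewrite sqmod_cut_off mulrC EFinM.
rewrite sqsumZ ?sqmod_ge0//; last by move=> j; rewrite lee_fin m_ge0.
by rewrite esum_m mulrC EFinM.
Qed.

Lemma sum_cut_off_le v :
  (\esum_(j in [set: G]) sqsum (cut_off j v) <= ((1 + e) * ell2_norm v ^+ 2)%:E)%E.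
Proof.
have e0 : 0 <= 1 + e.
  by have [_ _ /(_ 1%g) + _] := mP; have := normr_ge0 (1 - \sum_(j \in [set: G]) m 1%g j); lra.
rewrite sum_cut_off EFinM ell2_norm_sqr -sqsumZ//; last first.
  by move=> h; rewrite lee_fin sqmod_ge0.
apply: le_esum => h _; rewrite -EFinM lee_fin ler_wpM2r ?sqmod_ge0//.
by have [_ _ /(_ h) + _] := mP; rewrite ltr_norml => /andP[]; lra.
Qed.

Lemma sum_cut_off_ge v : e <= 1 ->
  (((1 - e) * ell2_norm v ^+ 2)%:E <= \esum_(j in [set: G]) sqsum (cut_off j v))%E.
Proof.
move=> e1; rewrite sum_cut_off EFinM ell2_norm_sqr -sqsumZ ?subr_ge0//; last first.
  by move=> h; rewrite lee_fin sqmod_ge0.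
apply: le_esum => h _; rewrite -EFinM lee_fin ler_wpM2r ?sqmod_ge0//.
by have [_ _ /(_ h) + _] := mP; rewrite ltr_norml => /andP[]; lra.
Qed.

(* An operator of propagation K nearly commutes with the cut-offs, in the square
   mean over j. *)
Lemma sum_propagation (L : B2 R G) (c : G -> G -> R[i]) (C : R) v : 0 <= C ->
  (forall u h, L u h = \sum_(g <- K) c g h * u (g^-1 * h)%g) ->
  (forall g h, g \in K -> sqmod (c g h) <= C) ->
  (\esum_(j in [set: G]) sqsum (L (cut_off j v)) <=
   (2 * (1 + e) * ell2_norm (L v) ^+ 2 +
    2 * (size K)%:R ^+ 2 * C * e * ell2_norm v ^+ 2)%:E)%E.
Proof.
move=> C0 LE cC; rewrite /sqsum esum_swap; last by move=> *; rewrite lee_fin sqmod_ge0.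
have [m01 mS m1 mK] := mP.
have e0 : 0 < e by apply: le_lt_trans (m1 1%g); exact: normr_ge0.
set n := (size K)%:R : R.
have n0 : 0 <= n by rewrite /n.
(* [b h] dominates the sum over [j] at the point [h]: the weights add up to less than 1 + e, their
   variation under each [g] in [K] to less than [e]. Summing over [h], each translate of [v] has the
   norm of [v], which gives the second factor [size K]. *)
pose b h := 2 * (1 + e) * sqmod (L v h) +
  \sum_(g <- K) (2 * n * C * e * sqmod (v (g^-1 * h)%g)).
have sb0 g h : 0 <= 2 * n * C * e * sqmod (v (g^-1 * h)%g).
  by rewrite !mulr_ge0 ?sqmod_ge0// ltW.
apply: (@le_trans _ _ (\esum_(h in [set: G]) (b h)%:E)%E).
  apply: le_esum => h _.
  have pw j : ((sqmod (L (cut_off j v) h))%:E <=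
      (2 * sqmod (L v h))%:E * (m h j)%:E +
      \sum_(g <- K) (2 * n * C * sqmod (v (g^-1 * h)%g))%:E *
        (`|m h j - m (g^-1 * h)%g j|)%:E)%E.
    have -> : (\sum_(g <- K) (2 * n * C * sqmod (v (g^-1 * h)%g))%:E *
        (`|m h j - m (g^-1 * h)%g j|)%:E =
        (\sum_(g <- K) (2 * n * C * sqmod (v (g^-1 * h)%g) *
        `|m h j - m (g^-1 * h)%g j|))%:E)%E.
      by rewrite -sumEFin; apply: eq_bigr => g _; rewrite EFinM.
    rewrite -EFinM -EFinD lee_fin.
    (* The cut-off is moved to the left of [L]; the second term is the commutator. *)
    have -> : L (cut_off j v) h = theta j h * L v h +
        \sum_(g <- K) c g h * (theta j (g^-1 * h)%g - theta j h) * v (g^-1 * h)%g.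
      rewrite !LE mulr_sumr -big_split /=; apply: eq_bigr => g _.
      by rewrite cut_offE; ring.
    apply: le_trans (sqmodD _ _ ltr01) _; rewrite invr1; apply: lerD.
      rewrite sqmodM sqmod_real sqr_sqrtr ?m_ge0// le_eqVlt; apply/orP; left.
      by apply/eqP; ring.
    apply: (@le_trans _ _ (2 * (n * \sum_(g <- K)
      sqmod (c g h * (theta j (g^-1 * h)%g - theta j h) * v (g^-1 * h)%g)))).
      by rewrite ler_wpM2l// sqmod_sum.
    rewrite mulrA mulr_sumr big_seq [leRHS]big_seq; apply: ler_sum => g gK.
    rewrite !sqmodM -rmorphB sqmod_real.
    have -> : 2 * n * C * sqmod (v (g^-1 * h)%g) * `|m h j - m (g^-1 * h)%g j| =
      2 * n * (C * `|m h j - m (g^-1 * h)%g j| * sqmod (v (g^-1 * h)%g)) by ring.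
    rewrite ler_wpM2l ?mulr_ge0// ler_wpM2r ?sqmod_ge0//.
    apply: ler_pM; rewrite ?sqmod_ge0 ?sqr_ge0//; first exact: cC.
    by rewrite distrC; apply: sqrt_sub_sqr; exact: m_ge0.
  apply: (@le_trans _ _ _ _ _ (le_esum (fun j _ => pw j))).
  rewrite esumD; last 2 first.
    by move=> j _; rewrite -EFinM lee_fin mulr_ge0 ?m_ge0// mulr_ge0 ?sqmod_ge0.
    by move=> j _; apply: sume_ge0 => g _; rewrite -EFinM lee_fin !mulr_ge0 ?sqmod_ge0.
  rewrite sqsumZ ?mulr_ge0 ?sqmod_ge0//; last by move=> j; rewrite lee_fin m_ge0.
  rewrite esum_m esum_sum; last first.
    by move=> j g _ _; rewrite -EFinM lee_fin !mulr_ge0 ?sqmod_ge0.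
  have -> : (\sum_(g <- K) \esum_(j in [set: G])
      ((2 * n * C * sqmod (v (g^-1 * h)%g))%:E * (`|m h j - m (g^-1 * h)%g j|)%:E) =
    (\sum_(g <- K) (2 * n * C * sqmod (v (g^-1 * h)%g) *
       \sum_(j \in [set: G]) `|m h j - m (g^-1 * h)%g j|))%:E)%E.
    rewrite -sumEFin; apply: eq_bigr => g _.
    rewrite sqsumZ ?esum_dm//; last first.
      by rewrite !mulr_ge0 ?sqmod_ge0.
  rewrite -EFinM -EFinD lee_fin; apply: lerD.
    rewrite [leRHS]mulrAC ler_wpM2l ?mulr_ge0 ?sqmod_ge0//.
    by have := m1 h; rewrite ltr_norml => /andP[]; lra.
  rewrite big_seq [leRHS]big_seq; apply: ler_sum => g gK.
  rewrite [leRHS]mulrAC ler_wpM2l ?mulr_ge0 ?sqmod_ge0//.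
  by rewrite ltW// mK.
rewrite /b; under eq_esum do rewrite EFinD -sumEFin.
rewrite esumD; last 2 first.
  by move=> h _; rewrite lee_fin !mulr_ge0 ?sqmod_ge0// addr_ge0// ltW.
  by move=> h _; apply: sume_ge0 => g _; rewrite lee_fin.
rewrite EFinD; apply: leeD.
  under eq_esum do rewrite EFinM.
  rewrite sqsumZ; last 2 first.
    by rewrite mulr_ge0// addr_ge0// ltW.
    by move=> h; rewrite lee_fin sqmod_ge0.
  by rewrite [leRHS]EFinM ell2_norm_sqr.
rewrite esum_sum; last by move=> *; rewrite lee_fin.
apply: (@le_trans _ _ (\sum_(g <- K) (2 * n * C * e * ell2_norm v ^+ 2)%:E)%E).
  apply: lee_sum => g _.
  under eq_esum do rewrite EFinM.
  rewrite sqsumZ; last 2 first.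
    by rewrite !mulr_ge0// ltW.
    by move=> h; rewrite lee_fin sqmod_ge0.
  rewrite -(Ltrans_norm g v) [leRHS]EFinM ell2_norm_sqr.
  rewrite le_eqVlt; apply/orP; left; apply/eqP; congr (_ * _)%E.
  by apply: eq_esum => h _; rewrite LtransE.
rewrite sumEFin lee_fin big_const_seq count_predT iter_addr_0 -mulr_natr -/n.
by rewrite le_eqVlt; apply/orP; left; apply/eqP; ring.
Qed.

End Localization.

(* Amenable actions: cutting down almost annihilated vectors *)
#[local] Existing Instance summability.totally_filter.
Section Amenable.
Context {R : realType} {G : groupType} {X : topologicalType}.
Variable act : homeo_action G X.
Hypothesis X_compact : compact [set: X].
Implicit Types (T : B2 R (X * G)%type) (v : ell2 R G).
Local Notation CXR := (CX : set (X -> R[i])).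
Local Notation A := (CX_crossed act : set (B2 R (X * G)%type)).

(** The approximately invariant function is restricted to the orbit of [w]. The finite set [S] comes
    from its compact support and does not depend on [w], which makes all later bounds uniform over
    the boundary. *)
Lemma amenable_weights (e : R) (K : seq G) : amenable_action R act -> 0 < e ->
  exists (f : X * G -> R) (S : seq G), forall w,
    partition_weights (fun h j => f (act j w, (j * h^-1)%g)) e S K.
Proof.
move=> am e0.
(* The unit is added to [K] because the estimate on the total mass at hw is read off at the arrow
   (hw, 1). *)
have [f [Cf f01 fK]] := am _ e (@compact_slices G X (1%g :: K) X_compact) e0.
have fS := gpd_Cc_support Cf.
exists f, (fset_set [set g | exists x, f (x, g) <> 0]) => w.
(* Arrows with source hw are indexed by the group element [j] for which jw is their range. *)
have setE h : [set a | gsrc act a = act h w] =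
    (fun j => (act j w, (j * h^-1)%g)) @` [set: G].
  rewrite /gsrc; apply/seteqP; split => [[x k] /= E|_ [j _ <-] /=].
    by exists (k * h)%g => //; rewrite actM -E -actM mulgV act1 mulgK.
  by rewrite invgM invgK -actM mulgVK.
have inj h : set_inj [set: G] (fun j => (act j w, (j * h^-1)%g)).
  by move=> j k _ _ /= [_ /mulIg].
split.
- by move=> h j; exact: f01.
- move=> h j fj; rewrite in_fset_set//; apply/mem_set; exists (act j w).
  exact/eqP.
- move=> h; have [|+ _] := fK (act h w, 1%g); first by rewrite /= mem_head.
  by rewrite /grng /= setE fsbig_image.
move=> h g gK; have [|_ +] := fK (act h w, g); first by rewrite /= inE gK orbT.
rewrite /grng /= setE fsbig_image//.
(* Multiplying the arrow with component j h^-1 by [g] gives component j (g^-1 h)^-1, that is, the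
   weight at g^-1 h. *)
by under eq_fsbigr do rewrite /gmul /= -{1}[g]invgK -mulgA -invgM.
Qed.

Lemma blk_regularE (a : G -> X -> R[i]) (s : seq G) w v h : uniq s ->
  (forall g, CXR (a g)) -> (forall g, g \notin s -> a g = 0) ->
  blk w (CX_regular act a) v h = \sum_(g <- s) a g (act h w) * v (g^-1 * h)%g.
Proof.
move=> us aE as0; rewrite (regular_seq act (CX_linfty X_compact) aE us as0).
rewrite /blk comp_bop_sumr comp_bop_suml bop_sumE ell2_sumE.
apply: eq_bigr => g _; rewrite -[pr w *o _ *o _]/(blk w (mon act (a g) g)).
have ab := CX_linfty X_compact (aE g); rewrite blk_mon//.
rewrite -[LHS]/(Mult act w (a g) (Ltrans g v) h) diag_opE ?LtransE//.
by have [M aM] := ab; exists M => i; exact: aM.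
Qed.

(** If every cut-off violated the bound with [c], squaring and summing over the partition of unity
    would contradict the bound with [c / 4] for [v]: the cut-offs nearly commute with a finite
    propagation approximant of [T]. Hence a single cut-off works, and its support is controlled by
    [S]. *)
Lemma localization T (c : R) : amenable_action R act -> A T -> 0 < c ->
  exists B : seq G, forall w v, v != 0 ->
    ell2_norm (blk w T v) <= c / 4 * ell2_norm v ->
    exists v', [/\ v' != 0, ell2_norm (blk w T v') <= c * ell2_norm v',
      (forall h, v h = 0 -> v' h = 0) &
      forall h h', v' h != 0 -> v' h' != 0 -> (h' * h^-1)%g \in B].
Proof.
move=> am AT c0; have c160 : 0 < c / 16 by rewrite divr_gt0.
have [a [Ca Ta]] : exists a, Cc CXR a /\ op_norm (T - CX_regular act a) < c / 16.
  have cT : closure (CX_regular act @` Cc CXR) T by exact: AT.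
  by have [_ [a Ca <-] Ta] := (closure_rnorm _ _).1 cT _ c160; exists a.
have [s us as0] := Cc_seq Ca; case: Ca => aE _.
have [C C0 aC] : exists2 C : R, 0 <= C & forall g x, g \in s -> sqmod (a g x) <= C.
  have bnd g : exists M : R, 0 <= M /\ forall x, sqmod (a g x) <= M.
    have [M M0 aM] := linfty_ge0 (CX_linfty X_compact (aE g)).
    exists (M ^+ 2); split => [|x]; first exact: sqr_ge0.
    have := aM x; rewrite normc_def lecR => H.
    by rewrite -[leLHS]sqr_sqrtr ?sqmod_ge0// ler_pXn2r ?nnegrE ?sqrtr_ge0.
  have [M MP] := boolp.choice bnd.
  have M0 g : 0 <= M g by have [] := MP g.
  exists (\sum_(g <- s) M g) => [|g x gs]; first by rewrite sumr_ge0.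
  have [_ /(_ x) H] := MP g; apply: le_trans H _.
  by rewrite (bigD1_seq g)//= lerDl sumr_ge0.
pose n := (size s)%:R : R.
have n0 : 0 <= n by rewrite /n.
have D0 : 0 < n ^+ 2 * C + 1 by rewrite ltr_wpDl// mulr_ge0 ?sqr_ge0.
(* e is such that 4 (1 + e) (5/16)^2 + 4 n^2 C e / c^2 + 2 (1 + e) / 16^2 < 1 - e. *)
pose e := Num.min (16^-1) (c ^+ 2 / 64 / (n ^+ 2 * C + 1)).
have e0 : 0 < e by rewrite lt_min invr_gt0 ltr0n /= !divr_gt0 ?exprn_gt0.
have e16 : e <= 16^-1 by rewrite ge_min lexx.
have eC : n ^+ 2 * C * e <= c ^+ 2 / 64.
  apply: (@le_trans _ _ ((n ^+ 2 * C + 1) * e)); first by rewrite ler_wpM2r ?lerDl ?ltW.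
  by rewrite mulrC -ler_pdivlMr// ge_min lexx orbT.
have [f [S fP]] := amenable_weights s am e0.
(* Both j h^-1 and j h'^-1 lie in [S], and h' h^-1 is the inverse of the second times the first. *)
exists [seq (k^-1 * l)%g | k <- S, l <- S] => w v v0 Tv.
have mP := fP w; set m := fun h j => _ in mP.
have [j Tj] : exists j, ell2_norm (blk w T (cut_off m j v)) < c * ell2_norm (cut_off m j v).
  apply: contrapT => /forallNP H.
  pose V := ell2_norm v ^+ 2.
  have V0 : 0 < V.
    by rewrite exprn_gt0// -rnorm_ell2 rnorm_gt0.
  pose L := blk w (CX_regular act a).
  have TL u : ell2_norm (blk w T u - L u) <= c / 16 * ell2_norm u.
    rewrite -[_ - _]/((blk w T - L) u) /L -blkB.
    apply: le_trans (op_normP (blk w (T - CX_regular act a)) u) _.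
    rewrite rnorm_ell2 ler_wpM2r ?ell2_norm_ge0//.
    exact: le_trans (op_norm_blk _ _) (ltW Ta).
  have sum1 := sum_propagation (L := L) (c := fun g h => a g (act h w)) (C := C) mP v C0
    (fun u h => blk_regularE w u h us aE as0) (fun g h gs => aC g (act h w) gs).
  (* 5/16 is 1/4 from the hypothesis on [v] plus 1/16 from the approximation of [T]. *)
  have Lv : ell2_norm (L v) ^+ 2 <= 25 / 256 * c ^+ 2 * V.
    have -> : 25 / 256 * c ^+ 2 * V = (5 / 16 * c * ell2_norm v) ^+ 2.
      by rewrite /V; field.
    rewrite ler_pXn2r ?nnegrE ?ell2_norm_ge0//; last first.
      by rewrite !mulr_ge0 ?ell2_norm_ge0// ltW.
    have -> : L v = blk w T v - (blk w T v - L v) by rewrite opprB addrC subrK.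
    apply: le_trans (ell2_normD _ _) _.
    have -> : ell2_norm (- (blk w T v - L v)) = ell2_norm (blk w T v - L v).
      by rewrite -!rnorm_ell2 rnorm_opp.
    by have := TL v; lra.
  have low j : ((c ^+ 2)%:E * sqsum (cut_off m j v) <=
      2%:E * sqsum (L (cut_off m j v)) + (2 * (c / 16) ^+ 2)%:E * sqsum (cut_off m j v))%E.
    rewrite -!ell2_norm_sqr -!EFinM -EFinD lee_fin.
    have /negP := H j; rewrite -leNgt => cj.
    set u := cut_off m j v in cj *.
    have u0 := ell2_norm_ge0 u; have := TL u => TLu.
    have Tu : ell2_norm (blk w T u) <= ell2_norm (L u) + c / 16 * ell2_norm u.
      have -> : blk w T u = L u + (blk w T u - L u) by rewrite addrC subrK.
      by apply: le_trans (ell2_normD _ _) _; rewrite lerD2l.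
    have L0 := ell2_norm_ge0 (L u).
    have : (c * ell2_norm u) ^+ 2 <= (ell2_norm (L u) + c / 16 * ell2_norm u) ^+ 2.
      rewrite ler_pXn2r ?nnegrE ?addr_ge0 ?mulr_ge0 ?(ltW c0) ?(ltW c160)//.
      exact: le_trans cj Tu.
    have := sqr_ge0 (ell2_norm (L u) - c / 16 * ell2_norm u).
    by rewrite sqrrB sqrrD !exprMn; lra.
  have e1 : e <= 1 by lra.
  have sg := sum_cut_off_ge mP v e1.
  have sl := sum_cut_off_le mP v.
  have tot : ((c ^+ 2 * ((1 - e) * V))%:E <=
      (2 * (2 * (1 + e) * ell2_norm (L v) ^+ 2 + 2 * n ^+ 2 * C * e * V) +
       2 * (c / 16) ^+ 2 * ((1 + e) * V))%:E)%E.
    apply: (@le_trans _ _ ((c ^+ 2)%:E * \esum_(j in [set: G]) sqsum (cut_off m j v))%E).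
      by rewrite EFinM; apply: lee_wpmul2l; rewrite ?lee_fin ?sqr_ge0.
    rewrite -sqsumZ ?sqr_ge0//; last by move=> j; exact: sqsum_ge0.
    apply: (@le_trans _ _ _ _ _ (le_esum (fun j _ => low j))).
    rewrite esumD; last 2 first.
      by move=> j _; rewrite mule_ge0 ?lee_fin ?sqsum_ge0.
      by move=> j _; rewrite mule_ge0 ?sqsum_ge0// lee_fin mulr_ge0// sqr_ge0.
    have d0 : 0 <= 2 * (c / 16) ^+ 2 by rewrite mulr_ge0// sqr_ge0.
    rewrite (sqsumZ (ler0n R 2)); last by move=> j; exact: sqsum_ge0.
    rewrite (sqsumZ d0); last by move=> j; exact: sqsum_ge0.
    rewrite [leRHS]EFinD; apply: leeD.
      by rewrite [leRHS]EFinM; apply: lee_wpmul2l; rewrite ?lee_fin.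
    by rewrite [leRHS]EFinM; apply: lee_wpmul2l; rewrite ?lee_fin.
  move: tot; rewrite lee_fin.
  have c2 : 0 < c ^+ 2 * V by apply: mulr_gt0; [exact: exprn_gt0|exact: V0].
  have H1 : (1 + e) * ell2_norm (L v) ^+ 2 <= 17 / 16 * (25 / 256 * c ^+ 2 * V).
    by apply: ler_pM; rewrite ?addr_ge0 ?sqr_ge0 ?(ltW e0)//; lra.
  have H2 : n ^+ 2 * C * e * V <= c ^+ 2 / 64 * V by rewrite ler_wpM2r// ltW.
  have H3 : e * (c ^+ 2 * V) <= 16^-1 * (c ^+ 2 * V) by rewrite ler_wpM2r// ltW.
  have -> : c ^+ 2 * ((1 - e) * V) = c ^+ 2 * V - e * (c ^+ 2 * V) by ring.
  have -> : 2 * (c / 16) ^+ 2 * ((1 + e) * V) =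
      2 / 256 * (c ^+ 2 * V) + 2 / 256 * (e * (c ^+ 2 * V)) by field.
  have -> : 2 * (2 * (1 + e) * ell2_norm (L v) ^+ 2 + 2 * n ^+ 2 * C * e * V) =
      4 * ((1 + e) * ell2_norm (L v) ^+ 2) + 4 * (n ^+ 2 * C * e * V) by ring.
  move: H1 H2 H3; rewrite -[25 / 256 * _ * _]mulrA [c ^+ 2 / 64 * V]mulrAC.
  move: c2; set Q := c ^+ 2 * V.
  lra.
exists (cut_off m j v); split.
- apply/eqP => u0; move: Tj; rewrite u0 linear0 -!rnorm_ell2 !rnorm0 mulr0.
  by rewrite ltxx.
- exact: ltW.
- by move=> h vh; rewrite (cut_offE mP) vh mulr0.
have inS h : cut_off m j v h != 0 -> (j * h^-1)%g \in S.
  rewrite (cut_offE mP) mulf_eq0 negb_or => /andP[th _].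
  have [_ mS _ _] := mP; apply: mS; apply: contra th => /eqP mh.
  by rewrite /theta mh sqrtr0.
move=> h h' vh vh'; apply/allpairsP; exists ((j * h'^-1)%g, (j * h^-1)%g) => /=.
by rewrite !inS// invgM invgK -mulgA mulKg.
Qed.

(* Iterated localization along c = 4^-k: the vectors for the first k are cut out
   of those for the later ones, so that the supports share a point. *)
Lemma localization_chain T : amenable_action R act -> A T ->
  exists B : nat -> seq G, forall n w v, v != 0 ->
    ell2_norm (blk w T v) <= 4 ^- n * ell2_norm v ->
    exists h0, forall k, (k < n)%N -> exists v', [/\ v' h0 != 0,
      ell2_norm (blk w T v') <= 4 ^- k * ell2_norm v' &
      forall h, v' h != 0 -> (h * h0^-1)%g \in B k].
Proof.
move=> am AT.
have p4 k : 0 < 4 ^- k :> R by rewrite invr_gt0 exprn_gt0.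
have [B BP] := boolp.choice (fun k => localization am AT (p4 k)).
exists B => n w v v0 Tv.
(* [v1] is the innermost vector: wherever it is nonzero, so are all the [v']. Any point of its
   support can serve as [h0]. *)
suff [v1 [v10 _ H]] : exists v1, [/\ v1 != 0, (forall h, v h = 0 -> v1 h = 0) &
    forall k, (k < n)%N -> exists v', [/\ (forall h, v' h = 0 -> v1 h = 0),
      ell2_norm (blk w T v') <= 4 ^- k * ell2_norm v' &
      forall h h', v' h != 0 -> v' h' != 0 -> (h' * h^-1)%g \in B k]].
  have [h0 v1h] : exists h0, v1 h0 != 0.
    apply: contrapT => /forallNP N; move/negP: v10; apply; apply/eqP/ell2_ext => h.
    by apply/eqP; apply: contrapT => /negP; exact: N.
  exists h0 => k /H [v' [v'v1 Tv' Bv']]; exists v'.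
  have v'h : v' h0 != 0 by apply: contra v1h => /eqP /v'v1 /eqP.
  by split => // h; exact: Bv'.
elim: n v v0 Tv => [|n IH] v v0 Tv; first by exists v.
(* The factor 4 between consecutive scales is exactly what one application of [localization]
   loses. *)
have E : 4 ^- n.+1 = 4 ^- n / 4 :> R by rewrite exprS invfM mulrC.
rewrite E in Tv.
have [v' [v'0 Tv' vv' Bv']] := BP n w v v0 Tv.
have [v1 [v10 v'v1 H]] := IH v' v'0 Tv'.
exists v1; split => // [h vh|k]; first exact/v'v1/vv'.
by rewrite ltnS leq_eqVlt => /orP[/eqP ->|/H//]; exists v'.
Qed.

(** Right translation takes [h0] to the unit and, by equivariance, the block at [w] to the block at
    [h0 w]. The support is then contained in [B] itself, whatever [h0] was. *)
Lemma supported_translate (B : seq G) (w : X) T v h0 (c : R) : A T ->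
  v h0 != 0 -> ell2_norm (blk w T v) <= c * ell2_norm v ->
  (forall h, v h != 0 -> (h * h0^-1)%g \in B) ->
  exists v', [/\ v' != 0, supported B v' &
    ell2_norm (blk (act h0 w) T v') <= c * ell2_norm v'].
Proof.
move=> AT vh0 Tv vB; exists (Rtrans h0^-1%g v).
have E h : Rtrans h0^-1%g v h = v (h * h0)%g by rewrite RtransE invgK.
split.
- apply/eqP => /(congr1 (fun u : ell2 R G => u 1%g)); rewrite E mul1g => v0.
  by move: vh0; rewrite v0 eqxx.
- by move=> h; rewrite E => /vB; rewrite mulgK.
rewrite (@blk_act _ _ _ _ X_compact h0 w T AT) Rtrans_adj /=.
have -> : Rtrans h0 (Rtrans h0^-1%g v) = v.
  by apply/ell2_ext => h; rewrite !RtransE invgK mulgVK.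
by rewrite !Rtrans_norm.
Qed.

Lemma amenable_bounded_below (Z : set X) T : amenable_action R act -> A T ->
  compact Z -> (forall g x, Z x -> Z (act g x)) ->
  (forall w, Z w -> invertible (blk w T)) ->
  exists2 c : R, 0 < c & forall w v, Z w -> c * ell2_norm v <= ell2_norm (blk w T v).
Proof.
move=> am AT Zc Zinv Tinv; apply: contrapT => nc.
have p4 k : 0 < 4 ^- k :> R by rewrite invr_gt0 exprn_gt0.
have [B BP] := localization_chain am AT.
(* The cluster point, and with it the scale that yields a contradiction, is known only once the
   sequence is chosen. The [n]-th point therefore carries test vectors for all k < n, with supports
   [B k] independent of [n]. *)
have H n : exists w, Z w /\ forall k, (k < n)%N -> exists v, [/\ v != 0, supported (B k) v &
    ell2_norm (blk w T v) <= 4 ^- k * ell2_norm v].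
  have [w [v [Zw vw]]] : exists w v, Z w /\ ell2_norm (blk w T v) < 4 ^- n * ell2_norm v.
    apply: contrapT => N; apply: nc; exists (4 ^- n) => // w v Zw.
    by rewrite leNgt; apply/negP => vw; apply: N; exists w, v.
  have v0 : v != 0.
    apply/eqP => v0; move: vw; rewrite v0 linear0 -!rnorm_ell2 !rnorm0 mulr0.
    by rewrite ltxx.
  have [h0 Hh0] := BP n w v v0 (ltW vw).
  exists (act h0 w); split; first exact: Zinv.
  move=> k /Hh0 [v' [v'h Tv' Bv']]; exact: supported_translate Tv' Bv'.
have [u uP] := boolp.choice H.
have [p [Zp clp]] : (Z `&` cluster (u @ \oo)) !=set0.
  by apply: Zc; exists 0%N => // n _; have [] := uP n.
have [S [ST _]] := Tinv p Zp.
pose M := op_norm S + 1.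
have M0 : 0 < M by rewrite ltr_wpDl ?op_norm_ge0.
(* [M] exceeds the norm of the inverse at [p]. One 4^-k comes from the test vector and one from
   moving it to [p], whence the factor 2. *)
have [k kM] : exists k, 2 * M * 4 ^- k < 1.
  exists (Num.truncn (2 * M)).+1; set k := (Num.truncn _).+1.
  have m1 : 2 * M < k%:R by rewrite truncnS_gt.
  have m2 : k%:R <= 4 ^+ k :> R by rewrite -natrX ler_nat ltnW// ltn_expl.
  by rewrite ltr_pdivrMr ?exprn_gt0// mul1r; apply: lt_le_trans m2.
(* Only points of index above [k] carry a test vector at scale [k]. *)
have uk : (u @ \oo) (u @` [set n | (k < n)%N]).
  by exists k.+1 => // n /= kn; exists n.
have [_ [[n kn <-] /= np]] := clp _ _ uk
  (@blk_norm_continuous R G X act X_compact (B k) p T _ AT (p4 k)).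
have [_ /(_ k kn) [v [v0 Bv Tv]]] := uP n.
have := np v Bv; rewrite -rnorm_ell2 rnorm_distC rnorm_ell2 => d.
have v0' : 0 < ell2_norm v by rewrite -rnorm_ell2 rnorm_gt0.
have Tp : ell2_norm (blk p T v) <= 2 * 4 ^- k * ell2_norm v.
  have -> : blk p T v = (blk p T v - blk (u n) T v) + blk (u n) T v by rewrite subrK.
  by apply: le_trans (ell2_normD _ _) _; lra.
have : ell2_norm v <= M * ell2_norm (blk p T v).
  have {1}-> : v = S (blk p T v) by rewrite -[S _]/((S *o blk p T) v) ST.
  apply: le_trans (op_normP S _) _.
  by rewrite rnorm_ell2 ler_wpM2r ?ell2_norm_ge0// lerDl.
have H2 : M * ell2_norm (blk p T v) <= M * (2 * 4 ^- k * ell2_norm v) by rewrite ler_wpM2l// ltW.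
have H3 : M * (2 * 4 ^- k * ell2_norm v) = (2 * M * 4 ^- k) * ell2_norm v by ring.
have H4 : (2 * M * 4 ^- k) * ell2_norm v < 1 * ell2_norm v by rewrite ltr_pM2r.
lra.
Qed.

End Amenable.

(* Assembling the equivalences *)
#[local] Existing Instance summability.totally_filter.
Lemma op_norm_inv_le {R : realType} {I : choiceType} (T S : B2 R I) (c : R) :
  0 < c -> is_inverse T S ->
  (forall v, c * ell2_norm v <= ell2_norm (T v)) -> op_norm S <= c^-1.
Proof.
move=> c0 [_ TS] Tc; apply: op_norm_le => [|v]; first by rewrite invr_ge0 ltW.
rewrite ler_pdivlMl//; apply: le_trans (Tc _) _.
by rewrite -[T (S v)]/((T *o S) v) TS.
Qed.

Theorem corollary6p24 (R : realType) (G : groupType) (X : topologicalType)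
    (act : homeo_action G X) (Y : set X) (T : B2 R (X * G)%type)
    (G_countable : countable [set: G])
    (G_exact : exact_group R G)
    (X_compact : compact [set: X])
    (X_hausdorff : hausdorff_space X)
    (Y_open : open Y)
    (Y_dense : dense Y)
    (Y_invariant : forall (g : G) (x : X), Y x -> Y (act g x))
    (T_crossed : CX_crossed act T) :
  let c1 := invertible_modulo (CX_crossed act) (C0_crossed act Y) T in
  let c2 := symbol_invertible act (~` Y) (symbol act T) in
  let c3 := (forall w, (~` Y) w -> invertible (limit_op act w T)) /\
            (ereal_sup [set (op_norm (inv_bop (limit_op act w T)))%:E
                       | w in ~` Y] < +oo)%E in
  let c4 := forall w, (~` Y) w -> invertible (limit_op act w T) in
  [/\ c1 <-> c2, c2 <-> c3 & amenable_action R act -> (c3 <-> c4)].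
Proof.
move=> c1 c2 c3 c4.
have limE w : limit_op act w T = blk w T by exact: limit_opE.
have symE S : CX_crossed act S -> symbol act S = (fun w => blk w S).
  by move=> AS; apply/funext => w; exact: symbolE.
have sym_alg S : CX_crossed act S -> symbol_algebra act (~` Y) (fun w => blk w S).
  move=> AS; split.
  - by move=> w _; exact: (@blk_roe _ _ _ _ X_compact w S AS).
  - move=> xi eta; apply: continuous_subspaceT.
    exact: (@blk_wot _ _ _ _ X_compact S xi eta AS).
  - by move=> g w _; exact: (@blk_act _ _ _ _ X_compact g w S AS).
have bdry_compact : compact (~` Y).
  by apply: (subclosed_compact _ X_compact) => //; exact: open_closedC.
have bdry_inv g x : (~` Y) x -> (~` Y) (act g x).
  by move=> Yx /(Y_act Y_invariant).
have c12 : c1 -> c2.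
  move=> /(invertible_modulo_blk X_compact X_hausdorff Y_open Y_invariant G_exact T_crossed).
  move=> [S AS TS]; rewrite /c2 symE//; split; first exact: sym_alg.
  by exists (fun w => blk w S); [exact: sym_alg|exact: TS].
have c31 M : c4 -> (forall w, (~` Y) w -> op_norm (inv_bop (blk w T)) <= M) -> c1.
  move=> Tinv TM.
  apply: (invertible_modulo_of_blk X_compact X_hausdorff Y_open Y_invariant G_exact T_crossed _ TM).
  by move=> w Yw; rewrite -limE; exact: Tinv.
have c3P : c3 <-> c4 /\ exists M, forall w, (~` Y) w -> op_norm (inv_bop (blk w T)) <= M.
  split => [[Tinv sup]|[Tinv [M TM]]]; split => //.
    move: sup; set s := ereal_sup _ => sup.
    (* If ~Y is empty then [s] is -oo and [fine s] has no meaning, but nothing is claimed. Otherwise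
       any [w] bounds [s] below, so [s] is a real number. *)
    exists (fine s) => w Yw.
    have le : ((op_norm (inv_bop (blk w T)))%:E <= s)%E.
      by apply: ereal_sup_ubound; exists w => //; rewrite limE.
    by rewrite -lee_fin fineK// fin_real// sup andbT (lt_le_trans _ le)// ltNyr.
  apply: (@le_lt_trans _ _ M%:E); last exact: ltry.
  by apply: ge_ereal_sup => _ [w Yw <-]; rewrite limE lee_fin TM.
have c23 : c2 -> c3.
  (* The bound comes from the weak operator continuity of the inverse [F], which is part of being
     invertible in the symbol algebra. *)
  rewrite /c2 symE// => -[_ [F [_ Fwot _] TF]].
  have [M FM] := wot_bounded bdry_compact Fwot.
  apply/c3P; split; first by move=> w Yw; exists (F w); rewrite limE; exact: TF.
  by exists M => w Yw; rewrite (inv_bopE (TF w Yw)); exact: FM.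
have c321 : c3 -> c1 by move=> /c3P [Tinv [M TM]]; exact: c31 Tinv TM.
split.
- by split => // /c23.
- by split => // /c321.
move=> am; split => [[]//|Tinv]; apply/c3P; split => //.
have Tinv' w : (~` Y) w -> invertible (blk w T) by rewrite -limE; exact: Tinv.
have [c c0 Tc] := amenable_bounded_below X_compact am T_crossed bdry_compact bdry_inv Tinv'.
exists c^-1 => w Yw; have [S TS] := Tinv' w Yw; rewrite (inv_bopE TS).
by apply: (op_norm_inv_le c0 TS) => v; exact: Tc.
Qed.
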